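(* Let $\mathbb{K}$ be a field of characteristic zero and let $J$ be a finitely presented unital Jordan $\mathbb{K}$-algebra. Then the Lie algebra $\widehat{\mathfrak{sl}}_2(J)$ is finitely presented.
   Context: All vector spaces and algebras are over $\mathbb{K}$. $\mathfrak{sl}_2=\mathfrak{sl}_2(\mathbb{K})$ has basis $h,e,f$ with $[h,e]=2e$, $[h,f]=-2f$, $[e,f]=h$, and $\kappa$ is the invariant form proportional to the Killing form normalized by $\kappa(h,h)=4$. For $a,b\in J$, $\partial_{a,b}(x)=a(bx)-(ax)b$. The Lie algebra $\widehat{\mathfrak{sl}}_2(J)$ (the universal central extension of the Tits-Kantor-Koecher Lie algebra of $J$) is $(\mathfrak{sl}_2\otimes J)\oplus\{J,J\}$, where $\{J,J\}=(\bigwedge^2J)/\mathrm{Span}\{a\wedge a^2\mid a\in J\}$, $\{a,b\}$ is the image of $a\wedge b$, $x(a):=x\otimes a$, with bracket $[x(a),y(b)]=[x,y](ab)+\kappa(x,y)\{a,b\}$, $[\{a,b\},x(c)]=x(\partial_{a,b}c)$, $[\{a,b\},\{c,d\}]=\{\partial_{a,b}c,d\}+\{c,\partial_{a,b}d\}$. *)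

(* Defs.v *)
From HB Require Import structures.
From mathcomp Require Import all_boot all_algebra ring.
From mathcomp Require Import boolp classical_sets.
From mathcomp.multinomials Require Import freeg.

Set Implicit Arguments.
Unset Strict Implicit.
Unset Printing Implicit Defensive.

Import GRing.Theory.

Local Open Scope classical_set_scope.
Local Open Scope ring_scope.

Reserved Notation "x ** y" (at level 40, left associativity).

(* No associativity, commutativity or unit; [**] is also the Lie bracket. *)
HB.mixin Record Lmodule_isNonAssoc (K : fieldType) V of GRing.Lmodule K V := {
  amul : V -> V -> V;
  amul_linearl : forall y, linear (amul^~ y);
  amul_linearr : forall x, linear (amul x)
}.

#[short(type="nonAssocAlgType")]
HB.structure Definition NonAssoc (K : fieldType) :=
  {V of Lmodule_isNonAssoc K V & GRing.Lmodule K V}.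

Notation "x ** y" := (amul x y) : ring_scope.

HB.mixin Record NonAssoc_isLie (K : fieldType) L of NonAssoc K L := {
  lie_alt : forall x : L, x ** x = 0;
  lie_jacobi : forall x y z : L,
    x ** (y ** z) + y ** (z ** x) + z ** (x ** y) = 0
}.

#[short(type="lieAlgType")]
HB.structure Definition Lie (K : fieldType) :=
  {L of NonAssoc_isLie K L & NonAssoc K L}.

HB.mixin Record NonAssoc_isUnitalJordan (K : fieldType) J of NonAssoc K J := {
  jone : J;
  jmul1 : forall x : J, jone ** x = x;
  jmulC : forall x y : J, x ** y = y ** x;
  jordan_id : forall x y : J, (x ** x) ** (y ** x) = ((x ** x) ** y) ** x
}.

#[short(type="unitalJordanType")]
HB.structure Definition UnitalJordan (K : fieldType) :=
  {J of NonAssoc_isUnitalJordan K J & NonAssoc K J}.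

Definition alg_hom (K : fieldType) (A B : nonAssocAlgType K) (f : A -> B) :=
  linear f /\ {morph f : x y / x ** y}.

Definition unital_hom (K : fieldType) (A B : unitalJordanType K) (f : A -> B) :=
  alg_hom f /\ f jone = jone.

Definition is_subspace (K : fieldType) (V : lmodType K) (U : set V) :=
  U 0 /\ forall k x y, U x -> U y -> U (k *: x + y).

Definition is_ideal (K : fieldType) (A : nonAssocAlgType K) (I : set A) :=
  is_subspace I /\ forall x y, I y -> I (x ** y) /\ I (y ** x).

Definition span (K : fieldType) (V : lmodType K) (S : set V) : set V :=
  smallest (@is_subspace K V) S.

Definition ideal_gen (K : fieldType) (A : nonAssocAlgType K) (S : set A) :
  set A := smallest (@is_ideal K A) S.

(* Free objects are given by their universal property. Presentations of unital
   Jordan algebras are taken among unital Jordan algebras: the unit needs no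
   generator. *)
Definition free_lie (K : fieldType) (n : nat) (F : lieAlgType K)
    (g : 'I_n -> F) :=
  forall (L : lieAlgType K) (l : 'I_n -> L),
    exists! f : F -> L, alg_hom f /\ forall i, f (g i) = l i.

Definition free_unital_jordan (K : fieldType) (n : nat)
    (F : unitalJordanType K) (g : 'I_n -> F) :=
  forall (J : unitalJordanType K) (l : 'I_n -> J),
    exists! f : F -> J, unital_hom f /\ forall i, f (g i) = l i.

Definition lie_finitely_presented (K : fieldType) (L : lieAlgType K) :=
  exists (n : nat) (F : lieAlgType K) (g : 'I_n -> F) (f : F -> L) (R : seq F),
  [/\ free_lie g, alg_hom f, forall y, exists x, f x = y
    & forall x, f x = 0 <-> ideal_gen [set` R] x].

Definition unital_jordan_finitely_presented (K : fieldType)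
    (J : unitalJordanType K) :=
  exists (n : nat) (F : unitalJordanType K) (g : 'I_n -> F) (f : F -> J)
    (R : seq F),
  [/\ free_unital_jordan g, unital_hom f, forall y, exists x, f x = y
    & forall x, f x = 0 <-> ideal_gen [set` R] x].

(* A reflexive decision procedure [abel] for identities in abelian groups. *)
Inductive zexpr := ZVar of nat | ZZero | ZAdd of zexpr & zexpr | ZOpp of zexpr.

Fixpoint zeval (V : zmodType) (env : seq V) e : V :=
  match e with
  | ZVar i => env`_i
  | ZZero => 0
  | ZAdd a b => zeval env a + zeval env b
  | ZOpp a => - zeval env a
  end.

Fixpoint zpos (b : bool) e : seq nat :=
  match e with
  | ZVar i => if b then [:: i] else [::]
  | ZZero => [::]
  | ZAdd e1 e2 => zpos b e1 ++ zpos b e2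
  | ZOpp e1 => zpos (~~ b) e1
  end.

Lemma zevalE (V : zmodType) (env : seq V) e :
  zeval env e = \sum_(i <- zpos true e) env`_i - \sum_(i <- zpos false e) env`_i.
Proof.
elim: e => /= [i||a -> b ->|a ->].
- by rewrite big_seq1 big_nil subr0.
- by rewrite !big_nil subr0.
- by rewrite !big_cat /= opprD addrACA.
- by rewrite opprB.
Qed.

Lemma zeval_eq (V : zmodType) (env : seq V) e1 e2 :
  perm_eq (zpos true e1 ++ zpos false e2) (zpos true e2 ++ zpos false e1) ->
  zeval env e1 = zeval env e2.
Proof.
move=> /(perm_big _) /= H; rewrite !zevalE; apply/eqP.
by rewrite subr_eq addrAC eq_sym subr_eq eq_sym -!big_cat /= H.
Qed.

(* Atoms are compared up to unification: the same operation may occur with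
   different, convertible structure instances. *)
Ltac zindex x env :=
  lazymatch env with
  | ?y :: ?s => match constr:(tt) with
                | _ => let _ := match constr:(tt) with _ => unify x y end in
                       constr:(0%N)
                | _ => let n := zindex x s in constr:(n.+1)
                end
  end.
Ltac zmember x env :=
  lazymatch env with
  | ?y :: ?s => match constr:(tt) with
                | _ => let _ := match constr:(tt) with _ => unify x y end in
                       constr:(true)
                | _ => zmember x s
                end
  | _ => constr:(false)
  end.
Ltac zatoms V e env :=
  lazymatch e with
  | (?a + ?b)%R => let env' := zatoms V a env in zatoms V b env'
  | (- ?a)%R => zatoms V a env
  | 0%R => env
  | _ => lazymatch zmember e env with
         | true => env
         | false => constr:(e :: env)
         end
  end.
Ltac zreify e env :=
  lazymatch e with
  | (?a + ?b)%R => let x := zreify a env in let y := zreify b env in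
                   constr:(ZAdd x y)
  | (- ?a)%R => let x := zreify a env in constr:(ZOpp x)
  | 0%R => constr:(ZZero)
  | _ => let i := zindex e env in constr:(ZVar i)
  end.
Ltac abel :=
  lazymatch goal with
  | |- @eq ?V ?l ?r =>
    let e0 := constr:(@nil V) in
    let e1 := zatoms V l e0 in let env := zatoms V r e1 in
    let x := zreify l env in let y := zreify r env in
    apply: (@zeval_eq _ env x y); vm_compute; reflexivity
  end.

Section LinearPredicate.
Context (K : fieldType) (V W : lmodType K) (f : V -> W) (f_lin : linear f).

Lemma linpD x y : f (x + y) = f x + f y.
Proof. by have := f_lin 1 x y; rewrite !scale1r. Qed.
Lemma linp0 : f 0 = 0.
Proof. by apply: (addrI (f 0)); rewrite -linpD !addr0. Qed.
Lemma linpZ k x : f (k *: x) = k *: f x.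
Proof. by have := f_lin k x 0; rewrite linp0 !addr0. Qed.
Lemma linpN x : f (- x) = - f x.
Proof. by rewrite -scaleN1r linpZ scaleN1r. Qed.
Lemma linpB x y : f (x - y) = f x - f y.
Proof. by rewrite linpD linpN. Qed.
Lemma linp_sum (I : Type) (r : seq I) (F : I -> V) :
  f (\sum_(i <- r) F i) = \sum_(i <- r) f (F i).
Proof. by elim: r => [|i r IH]; rewrite ?big_nil ?linp0 // !big_cons linpD IH. Qed.
End LinearPredicate.

Section NonAssocTheory.
Context (K : fieldType) (A : nonAssocAlgType K).
Implicit Types (x y z : A) (k : K).

Lemma amulDl x y z : (x + y) ** z = x ** z + y ** z.
Proof. exact: linpD (amul_linearl z) _ _. Qed.
Lemma amulDr x y z : x ** (y + z) = x ** y + x ** z.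
Proof. exact: linpD (amul_linearr x) _ _. Qed.
Lemma amul0l z : 0 ** z = 0.
Proof. exact: linp0 (amul_linearl z). Qed.
Lemma amul0r z : z ** 0 = 0.
Proof. exact: linp0 (amul_linearr z). Qed.
Lemma amulZl k x y : (k *: x) ** y = k *: (x ** y).
Proof. exact: linpZ (amul_linearl y) _ _. Qed.
Lemma amulZr k x y : x ** (k *: y) = k *: (x ** y).
Proof. exact: linpZ (amul_linearr x) _ _. Qed.
Lemma amulNl x y : (- x) ** y = - (x ** y).
Proof. exact: linpN (amul_linearl y) _. Qed.
Lemma amulNr x y : x ** (- y) = - (x ** y).
Proof. exact: linpN (amul_linearr x) _. Qed.
End NonAssocTheory.

Section Quotient.
Context (K : fieldType) (V : lmodType K) (S : set V).

Lemma span_subspace : is_subspace (span S).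
Proof.
split=> [U [[U0 _] _] //|k x y Sx Sy U US].
by case: (US) => -[_ UD] _; apply: UD; [apply: Sx|apply: Sy].
Qed.

Definition span_pred (x : V) : bool := `[< span S x >].

Fact span_zmod_closed : zmod_closed (span_pred : {pred V}).
Proof.
have [S0 SD] := span_subspace; split; first exact/asboolP.
move=> x y /asboolP Sx /asboolP Sy; apply/asboolP.
by rewrite addrC -scaleN1r; apply: SD.
Qed.
Definition span_closed : zmodClosed V :=
  HB.pack span_pred (GRing.isZmodClosed.Build V span_pred span_zmod_closed).

Definition vquot := Quotient.quot span_closed.
HB.instance Definition _ := GRing.Zmodule.on vquot.

Definition vpi (x : V) : vquot := \pi_vquot%qT x.
Definition vrepr (q : vquot) : V := repr q.

Lemma vreprK q : vpi (vrepr q) = q. Proof. exact: reprK. Qed.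

Lemma vpi_eq x y : vpi x = vpi y <-> span S (x - y).
Proof.
rewrite /vpi; split=> [/eqP|] H; last first.
  apply/eqP; rewrite -Quotient.idealrBE; exact/asboolP.
by move: H; rewrite -Quotient.idealrBE => /asboolP.
Qed.

Lemma vpiD x y : vpi (x + y) = vpi x + vpi y.
Proof. by rewrite /vpi !raddfD. Qed.

Definition vscale (k : K) (q : vquot) : vquot := vpi (k *: vrepr q).

Lemma vscale_pi k x : vscale k (vpi x) = vpi (k *: x).
Proof.
apply/vpi_eq; rewrite -scalerBr -[_ *: _]addr0.
have [S0 SD] := span_subspace; apply: SD => //.
by apply/vpi_eq; rewrite vreprK.
Qed.

Fact vscaleA a b q : vscale a (vscale b q) = vscale (a * b) q.
Proof. by rewrite -[q]vreprK !vscale_pi scalerA. Qed.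
Fact vscale1 : left_id 1 vscale.
Proof. by move=> q; rewrite -[q]vreprK !vscale_pi scale1r. Qed.
Fact vscaleDr : right_distributive vscale +%R.
Proof.
move=> a p q; rewrite -[p]vreprK -[q]vreprK !vscale_pi -!vpiD !vscale_pi.
by rewrite scalerDr.
Qed.
Fact vscaleDl q : {morph vscale^~ q : a b / a + b}.
Proof. by move=> a b; rewrite -[q]vreprK !vscale_pi -vpiD scalerDl. Qed.

HB.instance Definition _ :=
  GRing.Zmodule_isLmodule.Build K vquot vscaleA vscale1 vscaleDr vscaleDl.

Lemma vpi_linear : linear vpi.
Proof. by move=> k x y; rewrite vpiD -vscale_pi. Qed.
HB.instance Definition _ := GRing.isLinear.Build K V vquot _ vpi vpi_linear.

Section Lift.
Context (W : lmodType K) (f : V -> W).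
Definition vlift (q : vquot) : W := f (vrepr q).
Hypotheses (f_lin : linear f) (f_ker : forall x, S x -> f x = 0).

Lemma vlift_pi x : vlift (vpi x) = f x.
Proof.
have : span S (vrepr (vpi x) - x) by apply/vpi_eq; rewrite vreprK.
move=> /(_ [set y | f y = 0]) /= H; apply/eqP; rewrite -subr_eq0.
rewrite /vlift -linpB //; apply/eqP/H; split=> //.
split=> [|k a b /= fa fb]; first exact: linp0.
by rewrite f_lin fa fb scaler0 addr0.
Qed.

Lemma vlift_linear : linear vlift.
Proof.
move=> k p q; rewrite -[p]vreprK -[q]vreprK -vpi_linear !vlift_pi.
exact: f_lin.
Qed.
End Lift.
End Quotient.

Section ExteriorSquare.
Context (K : fieldType) (V : lmodType K).

(* V (x) V is the quotient of the vector space with basis V * V by the first two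
   families. *)
Definition wedge_rel : set {freeg (V * V) / K} := [set x |
  [\/ exists k a b c, x = << (k *: a + b, c) >> - k *: << (a, c) >> - << (b, c) >>,
      exists k a b c, x = << (c, k *: a + b) >> - k *: << (c, a) >> - << (c, b) >>
    | exists a, x = << (a, a) >>]].

Definition ext2 := vquot wedge_rel.
HB.instance Definition _ := GRing.Lmodule.on ext2.

Definition wedge (a b : V) : ext2 := vpi wedge_rel << (a, b) >>.

Lemma wedgel k a b c : wedge (k *: a + b) c = k *: wedge a c + wedge b c.
Proof.
rewrite /wedge -vpi_linear; apply/vpi_eq; apply: sub_gen_smallest.
by apply: Or31; exists k, a, b, c; rewrite opprD addrA.
Qed.
Lemma wedger k a b c : wedge c (k *: a + b) = k *: wedge c a + wedge c b.
Proof.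
rewrite /wedge -vpi_linear; apply/vpi_eq; apply: sub_gen_smallest.
by apply: Or32; exists k, a, b, c; rewrite opprD addrA.
Qed.
Lemma wedgexx a : wedge a a = 0.
Proof.
rewrite /wedge -(linp0 (@vpi_linear _ _ wedge_rel)); apply/vpi_eq; apply: sub_gen_smallest.
by apply: Or33; exists a; rewrite subr0.
Qed.

Context (W : lmodType K) (g : V -> V -> W).
Definition ext2_lift : ext2 -> W :=
  vlift (fglift (fun p : V * V => g p.1 p.2)).

Lemma fglift_linear (T : choiceType) (h : T -> W) : linear (fglift h).
Proof.
have hB := lift_is_additive h.
have h0 : fglift h 0 = 0 by have := hB 0 0; rewrite !subrr.
have hN x : fglift h (- x) = - fglift h x by have := hB 0 x; rewrite h0 !sub0r.
have hD x y : fglift h (x + y) = fglift h x + fglift h y.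
  by rewrite -[y]opprK hB [in RHS]hN.
move=> k x y; rewrite hD; congr (_ + _).
have hS (I : Type) (r : seq I) F :
  fglift h (\sum_(i <- r) F i) = \sum_(i <- r) fglift h (F i).
  by elim: r => [|i r IH]; rewrite ?big_nil // !big_cons hD IH.
rewrite -[in RHS](freeg_sumE x) [in RHS]hS scaler_sumr.
rewrite [k *: x]/(fgscale k x) /fgscale hS.
by apply: eq_bigr => i _; rewrite !liftU scalerA.
Qed.

Hypotheses (gl : forall c, linear (g^~ c)) (gr : forall c, linear (g c))
  (gxx : forall a, g a a = 0).

Lemma wedge_rel_ker x : wedge_rel x ->
  fglift (fun p : V * V => g p.1 p.2) x = 0.
Proof.
have L := fglift_linear (fun p : V * V => g p.1 p.2).
have LZ := linpZ L; have LB := linpB L.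
case.
- move=> [k [a [b [c ->]]]]; rewrite !(LB, LZ, liftU) !scale1r /=.
  by rewrite gl -addrA -opprD subrr.
- move=> [k [a [b [c ->]]]]; rewrite !(LB, LZ, liftU) !scale1r /=.
  by rewrite gr -addrA -opprD subrr.
- by move=> [a ->]; rewrite liftU /= gxx scaler0.
Qed.

Lemma ext2_liftE a b : ext2_lift (wedge a b) = g a b.
Proof.
rewrite /ext2_lift /wedge vlift_pi; last exact: wedge_rel_ker.
  by rewrite liftU scale1r.
exact: fglift_linear.
Qed.

Lemma ext2_lift_linear : linear ext2_lift.
Proof.
by apply: vlift_linear; [apply: fglift_linear | apply: wedge_rel_ker].
Qed.
End ExteriorSquare.

Section JordanPairs.
Context (K : fieldType) (J : unitalJordanType K).
Implicit Types (a b c d x y z : J).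

(* The operator \partial_{a,b}. *)
Definition jder a b x : J := a ** (b ** x) - (a ** x) ** b.

(* The space {J, J}; [jpair a b] is {a, b}. *)
Definition jj := vquot [set wedge a (a ** a) | a in [set: J]].
HB.instance Definition _ := GRing.Lmodule.on jj.

Definition jpair a b : jj := vpi _ (wedge a b).

Definition jj_lift (W : lmodType K) (g : J -> J -> W) : jj -> W :=
  vlift (ext2_lift g).

(* The actions of {J, J} on J and on itself, both linear in s: on {a, b} the
   former is \partial_{a,b}. They are evaluated on representatives, and do not
   depend on them by [jder_actE] and [jj_actE]. *)
Definition jder_act (s : jj) x : J := jj_lift (fun a b => jder a b x) s.

Definition jj_act (s t : jj) : jj :=
  jj_lift (fun c d => jpair (jder_act s c) d + jpair c (jder_act s d)) t.

Lemma jpairl b : linear (jpair^~ b).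
Proof. by move=> k a a'; rewrite /jpair wedgel vpi_linear. Qed.
Lemma jpairr a : linear (jpair a).
Proof. by move=> k b b'; rewrite /jpair wedger vpi_linear. Qed.
Lemma jpairxx a : jpair a a = 0.
Proof. by rewrite /jpair wedgexx (linp0 (@vpi_linear _ _ _)). Qed.
Lemma jpair_sq a : jpair a (a ** a) = 0.
Proof.
rewrite /jpair -(linp0 (@vpi_linear _ _ _)); apply/vpi_eq.
by apply: sub_gen_smallest; exists a; rewrite ?subr0.
Qed.
Definition jpairDl b := linpD (jpairl b).
Definition jpairDr a := linpD (jpairr a).
Definition jpairNl b := linpN (jpairl b).
Definition jpairNr a := linpN (jpairr a).
Definition jpairZl b := linpZ (jpairl b).
Definition jpairZr a := linpZ (jpairr a).
Definition jpair0l b := linp0 (jpairl b).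
Definition jpair0r a := linp0 (jpairr a).
Lemma jpairC a b : jpair a b = - jpair b a.
Proof.
apply/eqP; rewrite -subr_eq0 opprK; apply/eqP.
have := jpairxx (a + b); rewrite jpairDl !jpairDr !jpairxx => <-; abel.
Qed.

Lemma jj_ind (P : jj -> Prop) : P 0 -> (forall s t, P s -> P t -> P (s + t)) ->
  (forall a b, P (jpair a b)) -> forall s, P s.
Proof.
move=> P0 PD Pp s; rewrite -[s]vreprK -[vrepr s]vreprK.
have L1 := @vpi_linear _ _ [set wedge a (a ** a) | a in [set: J]].
have L2 := @vpi_linear _ _ (@wedge_rel _ J).
rewrite -[vrepr (vrepr s)]freeg_sumE (linp_sum L2) (linp_sum L1).
elim/big_ind: _ => // -[a b] _.
rewrite (_ : << _ *g _ >> = (coeff (a, b) (vrepr (vrepr s))) *: << (a, b) >>).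
  by rewrite (linpZ L2) (linpZ L1) -[vpi _ _]/(jpair a b) -jpairZl.
by apply/eqP/freeg_eqP => x; rewrite coeffZ !coeffU mul1r.
Qed.

Section Lift.
Context (W : lmodType K) (g : J -> J -> W).
Hypotheses (gl : forall c, linear (g^~ c)) (gr : forall c, linear (g c))
  (gxx : forall a, g a a = 0) (gsq : forall a, g a (a ** a) = 0).

Lemma jj_liftE a b : jj_lift g (jpair a b) = g a b.
Proof.
rewrite /jj_lift vlift_pi ?ext2_liftE //; first exact: ext2_lift_linear.
by move=> _ [c _ <-]; rewrite ext2_liftE.
Qed.

Lemma jj_lift_linear : linear (jj_lift g).
Proof.
apply: vlift_linear; first exact: ext2_lift_linear.
by move=> _ [c _ <-]; rewrite ext2_liftE.
Qed.
End Lift.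

Definition jlin := (amulDl, amulDr, amulNl, amulNr, amulZl, amulZr).

Lemma jder_l b x : linear (fun a => jder a b x).
Proof.
by move=> k a a'; rewrite /jder !jlin scalerBr; abel.
Qed.
Lemma jder_r a x : linear (fun b => jder a b x).
Proof. by move=> k b b'; rewrite /jder !jlin scalerBr; abel. Qed.
Lemma jder_linear a b : linear (jder a b).
Proof. by move=> k x y; rewrite /jder !jlin scalerBr; abel. Qed.
Lemma jderxx a x : jder a a x = 0.
Proof. by rewrite /jder jmulC subrr. Qed.
Lemma jder_sq a x : jder a (a ** a) x = 0.
Proof.
by rewrite /jder (jmulC (a ** x)) (jmulC a x) jordan_id jmulC subrr.
Qed.

Lemma jder_actE a b x : jder_act (jpair a b) x = jder a b x.
Proof.
apply: jj_liftE => [c|c|c|c]; [exact: jder_l|exact: jder_r|exact: jderxx|].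
exact: jder_sq.
Qed.

Lemma jder_act_l x : linear (jder_act^~ x).
Proof.
apply: jj_lift_linear => [c|c|c|c]; [exact: jder_l|exact: jder_r|exact: jderxx|].
exact: jder_sq.
Qed.

Lemma jder_act_r s : linear (jder_act s).
Proof.
elim/jj_ind: s => [|s t IHs IHt|a b] k x y.
- by rewrite !(linp0 (jder_act_l _)) scaler0 addr0.
- by rewrite !(linpD (jder_act_l _)) IHs IHt scalerDr; abel.
- by rewrite !jder_actE jder_linear.
Qed.

Lemma polarize (W : zmodType) (T : J -> J -> J -> W) :
  (forall b c x y, T (x + y) b c = T x b c + T y b c) ->
  (forall a c x y, T a (x + y) c = T a x c + T a y c) ->
  (forall a b x y, T a b (x + y) = T a b x + T a b y) ->
  (forall a, T a a a = 0) -> forall a b c,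
  (T a b c + T b c a + T c a b) + (T b a c + T c b a + T a c b) = 0.
Proof.
move=> T1 T2 T3 T0 a b c.
transitivity (T (a + b + c) (a + b + c) (a + b + c) - T (a + b) (a + b) (a + b)
  - T (b + c) (b + c) (b + c) - T (a + c) (a + c) (a + c)
  + T a a a + T b b b + T c c c); first by rewrite !(T1, T2, T3); abel.
by rewrite !T0 !oppr0 !addr0.
Qed.

Section CharZero.
Hypothesis charK : [pchar K] =i pred0.

Lemma char0_double0 (W : lmodType K) (x : W) : x + x = 0 -> x = 0.
Proof.
rewrite -mulr2n -scaler_nat => /eqP; rewrite scaler_eq0.
by rewrite ((pcharf0P K).1 charK) => /eqP.
Qed.

Lemma jordan_linearized x y z w :
  (x ** y) ** (w ** z) + (y ** z) ** (w ** x) + (z ** x) ** (w ** y) =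
  ((x ** y) ** w) ** z + ((y ** z) ** w) ** x + ((z ** x) ** w) ** y.
Proof.
pose T a b c := (a ** b) ** (w ** c) - ((a ** b) ** w) ** c.
have : (T x y z + T y z x + T z x y) + (T y x z + T z y x + T x z y) = 0.
  apply: (polarize (T := T)) => *; rewrite /T ?jlin; [abel|abel|abel|].
  by rewrite jordan_id subrr.
rewrite /T (jmulC y x) (jmulC z y) (jmulC x z) => /char0_double0 H.
by apply/eqP; rewrite -subr_eq0 -[X in _ == X]H; apply/eqP; abel.
Qed.

Lemma jder_derivation a b x y :
  jder a b (x ** y) = jder a b x ** y + x ** jder a b y.
Proof.
have H : ((x ** y) ** b) ** a + ((y ** a) ** b) ** x + ((a ** x) ** b) ** y
    - (((x ** y) ** a) ** b + ((y ** b) ** a) ** x + ((b ** x) ** a) ** y) = 0.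
  rewrite -!jordan_linearized (jmulC b a) (jmulC b x) (jmulC b y).
  by rewrite (jmulC a x) (jmulC a y) (jmulC (x ** b)) (jmulC (y ** b)); abel.
rewrite /jder !jlin (jmulC b (x ** y)) (jmulC a (x ** y)).
rewrite (jmulC a (_ ** b)) (jmulC a (b ** x)) !(jmulC x (_ ** _)).
rewrite (jmulC a (b ** y)) (jmulC b y) (jmulC a y).
by apply/eqP; rewrite -subr_eq0 -[X in _ == X]H; apply/eqP; abel.
Qed.

Lemma jder_act_derivation s x y :
  jder_act s (x ** y) = jder_act s x ** y + x ** jder_act s y.
Proof.
elim/jj_ind: s => [|s t IHs IHt|a b].
- by rewrite !(linp0 (jder_act_l _)) amul0l amul0r addr0.
- by rewrite !(linpD (jder_act_l _)) IHs IHt !jlin; abel.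
- by rewrite !jder_actE jder_derivation.
Qed.

Lemma jpair_cyc a b c :
  jpair (a ** b) c + jpair (b ** c) a + jpair (c ** a) b = 0.
Proof.
pose T a b c := jpair a (b ** c).
have : (T a b c + T b c a + T c a b) + (T b a c + T c b a + T a c b) = 0.
  apply: (polarize (T := T)) => *; rewrite /T ?jlin ?(jpairDl, jpairDr) //.
  exact: jpair_sq.
rewrite /T !(jpairC a) !(jpairC b) !(jpairC c) (jmulC c b) (jmulC a c) (jmulC b a).
move=> H; apply: char0_double0.
rewrite -[RHS]oppr0 -[in RHS]H; abel.
Qed.

Section JJAct.
Context (s : jj).
Local Notation g := (fun c d => jpair (jder_act s c) d + jpair c (jder_act s d)).
Lemma jj_act_gl c : linear (g^~ c).
Proof.
by move=> k x y; rewrite jder_act_r !(jpairDl, jpairZl) scalerDr; abel.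
Qed.
Lemma jj_act_gr c : linear (g c).
Proof.
by move=> k x y; rewrite jder_act_r !(jpairDr, jpairZr) scalerDr; abel.
Qed.
Lemma jj_act_gxx c : g c c = 0.
Proof. by rewrite /= jpairC addNr. Qed.
Lemma jj_act_gsq c : g c (c ** c) = 0.
Proof.
rewrite /= jder_act_derivation; set d := jder_act s c.
have := jpair_cyc c c d; rewrite (jmulC c d) => H.
rewrite jpairDr (jpairC d) (jpairC c (d ** c)) -[RHS]oppr0 -[in RHS]H; abel.
Qed.
Definition jj_actE c d : jj_act s (jpair c d) = g c d :=
  jj_liftE jj_act_gl jj_act_gr jj_act_gxx jj_act_gsq c d.
Definition jj_act_r : linear (jj_act s) :=
  jj_lift_linear jj_act_gl jj_act_gr jj_act_gxx jj_act_gsq.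
End JJAct.

Lemma jj_act_l t : linear (jj_act^~ t).
Proof.
move=> k s s'; elim/jj_ind: t => [|t t' IHt IHt'|a b].
- by rewrite !(linp0 (jj_act_r _)) scaler0 addr0.
- by rewrite !(linpD (jj_act_r _)) IHt IHt' scalerDr; abel.
- rewrite !jj_actE !jder_act_l !(jpairDl, jpairDr, jpairZl, jpairZr) scalerDr.
  abel.
Qed.

Lemma jj_actC s t : jj_act s t = - jj_act t s.
Proof.
elim/jj_ind: s => [|s s' IHs IHs'|a b].
- by rewrite (linp0 (jj_act_l _)) (linp0 (jj_act_r _)) oppr0.
- by rewrite (linpD (jj_act_l _)) (linpD (jj_act_r _)) IHs IHs' opprD.
elim/jj_ind: t => [|t t' IHt IHt'|c d].
- by rewrite (linp0 (jj_act_l _)) (linp0 (jj_act_r _)) oppr0.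
- by rewrite (linpD (jj_act_l _)) (linpD (jj_act_r _)) IHt IHt' opprD.
rewrite !jj_actE !jder_actE /jder !(jpairDl, jpairDr, jpairNl, jpairNr).
rewrite !(jmulC c a) !(jmulC c b) !(jmulC d a) !(jmulC d b).
rewrite !(jmulC a (_ ** _)) !(jmulC c (_ ** _)).
rewrite !(jpairC a (_ ** _)) !(jpairC c (_ ** _)).
have F1 := jpair_cyc (b ** c) a d; have F2 := jpair_cyc (a ** c) b d.
have F3 := jpair_cyc (b ** d) a c; have F4 := jpair_cyc (a ** d) b c.
rewrite !(jmulC d (_ ** _)) !(jmulC c (_ ** _)) in F1 F2 F3 F4.
rewrite (jpairC (a ** d)) in F1.
rewrite (jpairC (b ** d)) in F2.
have F : (0 - 0) - (0 - 0) = 0 :> jj by rewrite !subrr.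
apply/eqP; rewrite -subr_eq0 -[X in _ == X]F -{1}F1 -{1}F2 -{1}F3 -{1}F4.
by apply/eqP; abel.
Qed.

Lemma jder_act_jj s t x :
  jder_act (jj_act s t) x = jder_act s (jder_act t x) - jder_act t (jder_act s x).
Proof.
elim/jj_ind: t => [|t t' IHt IHt'|a b].
- by rewrite (linp0 (jj_act_r _)) !(linp0 (jder_act_l _)) (linp0 (jder_act_r _)) subrr.
- rewrite (linpD (jj_act_r _)) !(linpD (jder_act_l _)) IHt IHt'.
  by rewrite (linpD (jder_act_r _)); abel.
rewrite jj_actE (linpD (jder_act_l _)) !jder_actE /jder.
rewrite (linpB (jder_act_r _)) !jder_act_derivation !jlin; abel.
Qed.

Lemma jj_act_jacobi s t r :
  jj_act (jj_act s t) r = jj_act s (jj_act t r) - jj_act t (jj_act s r).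
Proof.
elim/jj_ind: r => [|r r' IHr IHr'|a b].
- by rewrite !(linp0 (jj_act_r _)) subrr.
- by rewrite !(linpD (jj_act_r _)) IHr IHr' ; abel.
rewrite !jj_actE !(linpD (jj_act_r _)) !jj_actE !jder_act_jj.
rewrite !(jpairDl, jpairDr, jpairNl, jpairNr); abel.
Qed.
End CharZero.
End JordanPairs.

(* Coordinates in the basis h, e, f, with [h, e] = 2e, [h, f] = - 2f, [e, f] = h. *)
Definition sl2 (K : fieldType) := 'rV[K]_3.

Section Sl2.
Context (K : fieldType).
HB.instance Definition _ := GRing.Lmodule.on (sl2 K).

Definition idx_h : 'I_3 := @Ordinal 3 0 isT.
Definition idx_e : 'I_3 := @Ordinal 3 1 isT.
Definition idx_f : 'I_3 := @Ordinal 3 2 isT.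

Definition sl2_basis (i : 'I_3) : sl2 K := delta_mx 0 i.

Definition sl2_bracket (x y : sl2 K) : sl2 K :=
  (x 0 idx_e * y 0 idx_f - x 0 idx_f * y 0 idx_e) *: sl2_basis idx_h
  + (2 * (x 0 idx_h * y 0 idx_e - x 0 idx_e * y 0 idx_h)) *: sl2_basis idx_e
  - (2 * (x 0 idx_h * y 0 idx_f - x 0 idx_f * y 0 idx_h)) *: sl2_basis idx_f.

Lemma ord3P (P : 'I_3 -> Prop) : P idx_h -> P idx_e -> P idx_f -> forall i, P i.
Proof.
move=> Ph Pe Pf [[|[|[|//]]] i3]; [move: Ph|move: Pe|move: Pf];
by congr P; apply: val_inj.
Qed.

Lemma sl2_bracketE (x y : sl2 K) :
  [/\ sl2_bracket x y 0 idx_h = x 0 idx_e * y 0 idx_f - x 0 idx_f * y 0 idx_e,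
      sl2_bracket x y 0 idx_e = 2 * (x 0 idx_h * y 0 idx_e - x 0 idx_e * y 0 idx_h)
    & sl2_bracket x y 0 idx_f = - (2 * (x 0 idx_h * y 0 idx_f - x 0 idx_f * y 0 idx_h))].
Proof. by split; rewrite !mxE /=; ring. Qed.

Fact sl2_linearl y : linear (sl2_bracket^~ y).
Proof. by move=> k x x'; apply/rowP; apply: ord3P; rewrite !mxE /=; ring. Qed.
Fact sl2_linearr x : linear (sl2_bracket x).
Proof. by move=> k y y'; apply/rowP; apply: ord3P; rewrite !mxE /=; ring. Qed.
HB.instance Definition _ :=
  Lmodule_isNonAssoc.Build K (sl2 K) sl2_linearl sl2_linearr.

Fact sl2_alt (x : sl2 K) : x ** x = 0.
Proof. by apply/rowP; apply: ord3P; rewrite !mxE /=; ring. Qed.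
Fact sl2_jacobi (x y z : sl2 K) :
  x ** (y ** z) + y ** (z ** x) + z ** (x ** y) = 0.
Proof. by apply/rowP; apply: ord3P; rewrite !mxE /=; ring. Qed.
HB.instance Definition _ := NonAssoc_isLie.Build K (sl2 K) sl2_alt sl2_jacobi.

Lemma sl2_relations :
  [/\ sl2_basis idx_h ** sl2_basis idx_e = 2 *: sl2_basis idx_e,
      sl2_basis idx_h ** sl2_basis idx_f = - 2 *: sl2_basis idx_f
    & sl2_basis idx_e ** sl2_basis idx_f = sl2_basis idx_h].
Proof. by split; apply/rowP; apply: ord3P; rewrite !mxE /=; ring. Qed.

Definition sl2_killing (x y : sl2 K) : K :=
  \tr (lin1_mx (amul x) *m lin1_mx (amul y)).

(* The Killing form takes the value 8 on (h, h). *)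
Definition kappa (x y : sl2 K) : K := sl2_killing x y / 2.

Lemma sl2_killingE (x y : sl2 K) : sl2_killing x y =
  8 * (x 0 idx_h * y 0 idx_h) + 4 * (x 0 idx_e * y 0 idx_f + x 0 idx_f * y 0 idx_e).
Proof.
have E : forall F : 'I_3 -> K, \sum_i F i = F idx_h + F idx_e + F idx_f.
  move=> F; rewrite !big_ord_recl big_ord0 addr0 addrA.
  by congr (F _ + F _ + F _); apply: val_inj.
by rewrite /sl2_killing /mxtrace E !mxE !E !mxE /=; ring.
Qed.

Section KappaCharZero.
Hypothesis charK : [pchar K] =i pred0.

Lemma kappaE (x y : sl2 K) : kappa x y =
  4 * (x 0 idx_h * y 0 idx_h) + 2 * (x 0 idx_e * y 0 idx_f + x 0 idx_f * y 0 idx_e).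
Proof.
rewrite /kappa sl2_killingE; have : (2 != 0 :> K) by rewrite ((pcharf0P K).1 charK).
by move=> ?; field.
Qed.

Lemma kappa_hh : kappa (sl2_basis idx_h) (sl2_basis idx_h) = 4.
Proof. by rewrite kappaE !mxE /=; ring. Qed.

Lemma kappaC x y : kappa x y = kappa y x.
Proof. by rewrite !kappaE; ring. Qed.
Lemma kappa_l y : scalar (kappa^~ y).
Proof. by move=> k x x'; rewrite !kappaE !mxE; ring. Qed.
Lemma kappa_invariant (x y z : sl2 K) : kappa (x ** y) z = kappa x (y ** z).
Proof. by rewrite !kappaE !mxE /=; ring. Qed.
Lemma sl2_double (x y z : sl2 K) :
  (x ** y) ** z = kappa y z *: x - kappa x z *: y.
Proof. by apply/rowP; apply: ord3P; rewrite !kappaE !mxE /=; ring. Qed.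
End KappaCharZero.
End Sl2.

Lemma lie_anticomm (K : fieldType) (L : lieAlgType K) (x y : L) :
  x ** y = - (y ** x).
Proof.
apply/eqP; rewrite -subr_eq0 opprK; apply/eqP.
have := lie_alt (x + y); rewrite amulDl !amulDr !lie_alt => <-; abel.
Qed.

(* sl_2 (x) J, through the basis of sl_2: the function u stands for
   \sum_i sl2_basis i (x) u i. *)
Definition sl2J (K : fieldType) (J : unitalJordanType K) := {ffun 'I_3 -> J}.
HB.instance Definition _ (K : fieldType) (J : unitalJordanType K) :=
  GRing.Lmodule.on (sl2J J).

Section Sl2J.
Context (K : fieldType) (J : unitalJordanType K).

Definition pure_tensor (x : sl2 K) (a : J) : sl2J J := [ffun i => x 0 i *: a].

Definition sl2J_bracket (u v : sl2J J) : sl2J J :=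
  \sum_i \sum_j pure_tensor (sl2_basis K i ** sl2_basis K j) (u i ** v j).

Definition sl2J_form (u v : sl2J J) : jj J :=
  \sum_i \sum_j kappa (sl2_basis K i) (sl2_basis K j) *: jpair (u i) (v j).

Definition sl2J_act (s : jj J) (u : sl2J J) : sl2J J :=
  [ffun i => jder_act s (u i)].

Lemma pure_tensor_l a : linear (pure_tensor^~ a).
Proof. by move=> k x y; apply/ffunP=> i; rewrite !ffunE !mxE scalerDl scalerA. Qed.
Lemma pure_tensor_r x : linear (pure_tensor x).
Proof.
move=> k a b; apply/ffunP=> i.
by rewrite !ffunE scalerDr !scalerA mulrC.
Qed.

Lemma sl2_sum_basis (x : sl2 K) : x = \sum_i x 0 i *: sl2_basis K i.
Proof. exact: row_sum_delta. Qed.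

Lemma sl2J_sum (u : sl2J J) : u = \sum_i pure_tensor (sl2_basis K i) (u i).
Proof.
apply/ffunP=> i; rewrite sum_ffunE (bigD1 i) //= ffunE mxE !eqxx scale1r.
rewrite big1 ?addr0 // => j ji; rewrite ffunE mxE eqxx /= eq_sym (negPf ji).
by rewrite scale0r.
Qed.

Lemma sl2J_bracket_pure x y a b :
  sl2J_bracket (pure_tensor x a) (pure_tensor y b) = pure_tensor (x ** y) (a ** b).
Proof.
rewrite [x in RHS]sl2_sum_basis [y in RHS]sl2_sum_basis.
rewrite (linp_sum (amul_linearl _)) (linp_sum (pure_tensor_l _)).
apply: eq_bigr => i _.
rewrite (linp_sum (amul_linearr _)) (linp_sum (pure_tensor_l _)).
apply: eq_bigr => j _; rewrite !ffunE amulZl amulZr amulZl amulZr.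
by rewrite 2!(linpZ (pure_tensor_r _)) 2!(linpZ (pure_tensor_l _)).
Qed.

Lemma sl2J_bracket_l v : linear (sl2J_bracket^~ v).
Proof.
move=> k u u'; rewrite /sl2J_bracket scaler_sumr -big_split; apply: eq_bigr => i _.
rewrite scaler_sumr -big_split; apply: eq_bigr => j _ /=.
by rewrite !ffunE amul_linearl pure_tensor_r.
Qed.
Lemma sl2J_bracket_r u : linear (sl2J_bracket u).
Proof.
move=> k v v'; rewrite /sl2J_bracket scaler_sumr -big_split; apply: eq_bigr => i _.
rewrite scaler_sumr -big_split; apply: eq_bigr => j _ /=.
by rewrite !ffunE amul_linearr pure_tensor_r.
Qed.
Lemma sl2J_form_l v : linear (sl2J_form^~ v).
Proof.
move=> k u u'; rewrite /sl2J_form scaler_sumr -big_split; apply: eq_bigr => i _.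
rewrite scaler_sumr -big_split; apply: eq_bigr => j _ /=.
by rewrite !ffunE jpairl scalerDr !scalerA mulrC.
Qed.
Lemma sl2J_form_r u : linear (sl2J_form u).
Proof.
move=> k v v'; rewrite /sl2J_form scaler_sumr -big_split; apply: eq_bigr => i _.
rewrite scaler_sumr -big_split; apply: eq_bigr => j _ /=.
by rewrite !ffunE jpairr scalerDr !scalerA mulrC.
Qed.
Lemma sl2J_act_l u : linear (sl2J_act^~ u).
Proof. by move=> k s t; apply/ffunP=> i; rewrite !ffunE jder_act_l. Qed.
Lemma sl2J_act_r s : linear (sl2J_act s).
Proof. by move=> k u v; apply/ffunP=> i; rewrite !ffunE jder_act_r. Qed.
Lemma sl2J_act_pure s x a :
  sl2J_act s (pure_tensor x a) = pure_tensor x (jder_act s a).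
Proof. by apply/ffunP=> i; rewrite !ffunE (linpZ (jder_act_r _)). Qed.

Lemma sl2J_bracketC u v : sl2J_bracket u v = - sl2J_bracket v u.
Proof.
rewrite /sl2J_bracket exchange_big /= -sumrN; apply: eq_bigr => i _.
rewrite -sumrN; apply: eq_bigr => j _.
by rewrite lie_anticomm (linpN (pure_tensor_l _)) jmulC.
Qed.

Lemma sl2J_act_bracket (charK : [pchar K] =i pred0) s u v :
  sl2J_act s (sl2J_bracket u v) =
  sl2J_bracket (sl2J_act s u) v + sl2J_bracket u (sl2J_act s v).
Proof.
rewrite /sl2J_bracket (linp_sum (sl2J_act_r _)) -big_split; apply: eq_bigr => i _.
rewrite (linp_sum (sl2J_act_r _)) -big_split; apply: eq_bigr => j _ /=.
rewrite sl2J_act_pure !ffunE jder_act_derivation //.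
by rewrite (linpD (pure_tensor_r _)).
Qed.

Lemma sl2J_act_form (charK : [pchar K] =i pred0) s u v :
  jj_act s (sl2J_form u v) =
  sl2J_form (sl2J_act s u) v + sl2J_form u (sl2J_act s v).
Proof.
have R := jj_act_r charK s.
rewrite /sl2J_form (linp_sum R) -big_split; apply: eq_bigr => i _.
rewrite (linp_sum R) -big_split; apply: eq_bigr => j _ /=.
by rewrite (linpZ R) jj_actE // !ffunE scalerDr.
Qed.

Lemma sl2J_formC (charK : [pchar K] =i pred0) u v :
  sl2J_form u v = - sl2J_form v u.
Proof.
rewrite /sl2J_form exchange_big /= -sumrN; apply: eq_bigr => i _.
rewrite -sumrN; apply: eq_bigr => j _.
by rewrite kappaC // jpairC scalerN.
Qed.

Lemma sl2J_act_jj (charK : [pchar K] =i pred0) s t u :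
  sl2J_act (jj_act s t) u = sl2J_act s (sl2J_act t u) - sl2J_act t (sl2J_act s u).
Proof. by apply/ffunP => i; rewrite !ffunE jder_act_jj. Qed.

Lemma sl2J_form_pure (charK : [pchar K] =i pred0) x y a b :
  sl2J_form (pure_tensor x a) (pure_tensor y b) = kappa x y *: jpair a b.
Proof.
have kl (z : sl2 K) : linear ((fun x => kappa x z) : sl2 K -> K^o) := kappa_l charK z.
have kr (z : sl2 K) : linear (kappa z : sl2 K -> K^o).
  by move=> k u v; rewrite !(kappaC charK z) kl.
have kZl k (u v : sl2 K) : kappa (k *: u) v = k * kappa u v := linpZ (kl v) k u.
have kZr k (u v : sl2 K) : kappa u (k *: v) = k * kappa u v := linpZ (kr u) k v.
rewrite [x in RHS]sl2_sum_basis [y in RHS]sl2_sum_basis.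
rewrite (linp_sum (kl _)) scaler_suml; apply: eq_bigr => i _.
rewrite (linp_sum (kr _)) scaler_suml; apply: eq_bigr => j _.
rewrite !ffunE jpairZl jpairZr kZl kZr !scalerA.
by congr (_ *: _); ring.
Qed.
End Sl2J.

(* The proof that K has characteristic zero serves only the Lie algebra
   structure: it makes the action of {J, J} on itself well defined. *)
Definition sl2_hat (K : fieldType) (charK : [pchar K] =i pred0)
  (J : unitalJordanType K) : Type := (sl2J J * jj J)%type.

Section Sl2Hat.
Context (K : fieldType) (charK : [pchar K] =i pred0) (J : unitalJordanType K).
Local Notation L := (sl2_hat charK J).
HB.instance Definition _ := GRing.Lmodule.on L.

Definition hat_tensor (x : sl2 K) (a : J) : L := (pure_tensor x a, 0).
Definition hat_pair (a b : J) : L := (0, jpair a b).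

(* The bilinear extension of the formulas [hat_tensorE], [hat_pair_tensor] and
   [hat_pair_pair] below. *)
Definition hat_bracket (X Y : L) : L :=
  (sl2J_bracket X.1 Y.1 + sl2J_act X.2 Y.1 - sl2J_act Y.2 X.1,
   sl2J_form X.1 Y.1 + jj_act X.2 Y.2).

Fact hat_linearl Y : linear (hat_bracket^~ Y).
Proof.
move=> k X X'; rewrite /hat_bracket; congr (_, _) => /=.
  rewrite sl2J_bracket_l sl2J_act_l sl2J_act_r !scalerDr scalerN; abel.
by rewrite sl2J_form_l jj_act_l // !scalerDr; abel.
Qed.
Fact hat_linearr X : linear (hat_bracket X).
Proof.
move=> k Y Y'; rewrite /hat_bracket; congr (_, _) => /=.
  rewrite sl2J_bracket_r sl2J_act_l sl2J_act_r !scalerDr scalerN; abel.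
by rewrite sl2J_form_r jj_act_r // !scalerDr; abel.
Qed.
HB.instance Definition _ := Lmodule_isNonAssoc.Build K L hat_linearl hat_linearr.

Lemma hat_tensor_l a : linear (hat_tensor^~ a).
Proof.
move=> k x y; congr (_, _) => /=; first exact: pure_tensor_l.
by rewrite scaler0 addr0.
Qed.
Lemma hat_tensor_r x : linear (hat_tensor x).
Proof.
move=> k a b; congr (_, _) => /=; first exact: pure_tensor_r.
by rewrite scaler0 addr0.
Qed.

Lemma hat_ind (P : L -> Prop) : P 0 -> (forall X Y, P X -> P Y -> P (X + Y)) ->
  (forall x a, P (hat_tensor x a)) -> (forall a b, P (hat_pair a b)) ->
  forall X, P X.
Proof.
move=> P0 PD Pt Pp [u s].
have -> : (u, s) = ((u, 0) : L) + ((0, s) : L).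
  by congr (_, _); rewrite ?addr0 ?add0r.
apply: (PD).
  rewrite [u]sl2J_sum; apply: (big_ind (fun u => P (u, 0))) => // [v w Pv Pw|i _];
    last exact: Pt.
  have -> : (v + w, 0) = ((v, 0) : L) + ((w, 0) : L) by congr (_, _); rewrite addr0.
  exact: PD.
elim/jj_ind: s => // s t Ps Pt'.
have -> : (0, s + t) = ((0, s) : L) + ((0, t) : L) by congr (_, _); rewrite addr0.
exact: PD.
Qed.

Lemma hat_tensorE x y a b : hat_tensor x a ** hat_tensor y b =
  hat_tensor (x ** y) (a ** b) + kappa x y *: hat_pair a b.
Proof.
congr (_, _) => /=.
  rewrite sl2J_bracket_pure !(linp0 (sl2J_act_l _)) scaler0; abel.
by rewrite (sl2J_form_pure charK) (linp0 (jj_act_l charK _)); abel.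
Qed.
Lemma hat_pair_tensor a b x c :
  hat_pair a b ** hat_tensor x c = hat_tensor x (jder a b c).
Proof.
congr (_, _) => /=.
  rewrite (linp0 (sl2J_bracket_l _)) (linp0 (sl2J_act_l _)) sl2J_act_pure jder_actE.
  abel.
by rewrite (linp0 (sl2J_form_l _)) (linp0 (jj_act_r charK _)) addr0.
Qed.
Lemma hat_pair_pair a b c d : hat_pair a b ** hat_pair c d =
  hat_pair (jder a b c) d + hat_pair c (jder a b d).
Proof.
congr (_, _) => /=.
  by rewrite (linp0 (sl2J_bracket_l _)) !(linp0 (sl2J_act_r _)) subr0 addr0.
by rewrite (linp0 (sl2J_form_l _)) (jj_actE charK) !jder_actE add0r.
Qed.

Lemma hat_anticomm (X Y : L) : X ** Y = - (Y ** X).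
Proof.
congr (_, _) => /=.
  by rewrite sl2J_bracketC; abel.
by rewrite (sl2J_formC charK) (jj_actC charK) opprD.
Qed.

Lemma hat_derivation (s : jj J) (X Y : L) :
  ((0, s) : L) ** (X ** Y) = (((0, s) : L) ** X) ** Y + X ** (((0, s) : L) ** Y).
Proof.
have B0 u := linp0 (@sl2J_bracket_l K J u).
have A0 t := linp0 (@sl2J_act_r K J t).
have F0 u := linp0 (@sl2J_form_l K J u).
have AD := linpD (@sl2J_act_r K J s); have AN := linpN (@sl2J_act_r K J s).
have JD := linpD (jj_act_r charK s).
congr (_, _) => /=.
  rewrite !B0 !A0 !add0r !subr0 !F0 !add0r !(AD, AN).
  by rewrite sl2J_act_bracket // !sl2J_act_jj //; abel.
rewrite !B0 !A0 !add0r !subr0 !F0 !add0r !JD sl2J_act_form //.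
by rewrite (jj_act_jacobi charK); abel.
Qed.

Fact hat_alt (X : L) : X ** X = 0.
Proof.
by apply: (char0_double0 charK); rewrite {1}hat_anticomm addNr.
Qed.

Lemma hat_jacobi_pair (s : jj J) (X Y : L) :
  ((0, s) : L) ** (X ** Y) + X ** (Y ** ((0, s) : L)) + Y ** (((0, s) : L) ** X) = 0.
Proof.
rewrite hat_derivation (hat_anticomm Y (0, s)) amulNr (hat_anticomm Y (_ ** X)).
abel.
Qed.

(* The Jacobi identity for three pure tensors, with values in any space. *)
Lemma jacobi_pure (W : lmodType K) (t : sl2 K -> J -> W) (p : J -> J -> W) k
    x y z a b c :
  (forall d, linear (t^~ d)) -> (forall u, linear (t u)) ->
  p c (a ** b) + p a (b ** c) + p b (c ** a) = 0 ->
  t (z ** (x ** y)) (c ** (a ** b)) + k *: p c (a ** b)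
    + kappa x y *: - t z (jder a b c)
  + (t (x ** (y ** z)) (a ** (b ** c)) + k *: p a (b ** c)
    + kappa y z *: - t x (jder b c a))
  + (t (y ** (z ** x)) (b ** (c ** a)) + k *: p b (c ** a)
    + kappa z x *: - t y (jder c a b)) = 0.
Proof.
move=> tl tr E.
have dbl (u v w : sl2 K) : u ** (v ** w) = kappa u v *: w - kappa w u *: v.
  by rewrite lie_anticomm sl2_double // (kappaC charK v u) opprB.
have HlB u v d : t (u - v) d = t u d - t v d := linpB (tl d) u v.
have HlZ m u d : t (m *: u) d = m *: t u d := linpZ (tl d) m u.
have HrB u d e : t u (d - e) = t u d - t u e := linpB (tr u) d e.
rewrite -[RHS](scaler0 _ k) -[in RHS]E !dbl /jder.
rewrite (jmulC (a ** c)) (jmulC (b ** a)) (jmulC (c ** b)).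
rewrite (jmulC a c) (jmulC b a) (jmulC c b).
rewrite !(HlB, HlZ, HrB) !scalerN !scalerBr !scalerDr; abel.
Qed.

Fact hat_jacobi (X Y Z : L) : X ** (Y ** Z) + Y ** (Z ** X) + Z ** (X ** Y) = 0.
Proof.
pose T X Y Z : L := X ** (Y ** Z) + Y ** (Z ** X) + Z ** (X ** Y).
have Trot U V W : T U V W = T V W U by rewrite /T; abel.
have T0 V W : T 0 V W = 0 by rewrite /T !amul0l !amul0r !addr0.
have TD U U' V W : T (U + U') V W = T U V W + T U' V W.
  by rewrite /T !(amulDl, amulDr); abel.
have Tp a b V W : T (hat_pair a b) V W = 0 by apply: hat_jacobi_pair.
rewrite -[LHS]/(T X Y Z).
elim/hat_ind: X => [|X X' IH IH'|x a|a b] //; first by rewrite TD IH IH' addr0.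
rewrite Trot.
elim/hat_ind: Y => [|Y Y' IH IH'|y b|c d] //; first by rewrite TD IH IH' addr0.
rewrite Trot.
elim/hat_ind: Z => [|Z Z' IH IH'|z c|c d] //; first by rewrite TD IH IH' addr0.
rewrite /T !hat_tensorE !amulDr !amulZr !hat_tensorE.
rewrite !(hat_anticomm (hat_tensor _ _) (hat_pair _ _)) !hat_pair_tensor.
have -> : kappa y (z ** x) = kappa z (x ** y).
  by rewrite kappaC // kappa_invariant.
have -> : kappa x (y ** z) = kappa z (x ** y).
  by rewrite -kappa_invariant // kappaC.
have E : hat_pair c (a ** b) + hat_pair a (b ** c) + hat_pair b (c ** a) = 0.
  have F : jpair c (a ** b) + jpair a (b ** c) + jpair b (c ** a) = 0.
    rewrite -[RHS]oppr0 -[in RHS](jpair_cyc charK a b c).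
    by rewrite (jpairC c) (jpairC a) (jpairC b); abel.
  transitivity ((0 + 0 + 0, jpair c (a ** b) + jpair a (b ** c)
    + jpair b (c ** a)) : L); first by [].
  by rewrite F !addr0.
exact: jacobi_pure (hat_tensor_l) (hat_tensor_r) E.
Qed.
HB.instance Definition _ := NonAssoc_isLie.Build K L hat_alt hat_jacobi.
End Sl2Hat.

(* Main.v *)
From HB Require Import structures.
Require Import Defs.
From mathcomp Require Import all_boot all_algebra.
From mathcomp Require Import boolp classical_sets zify.
From mathcomp.multinomials Require Import freeg.

Set Implicit Arguments.
Unset Strict Implicit.
Unset Printing Implicit Defensive.

Import GRing.Theory.

(** Let J be generated by x_1, ..., x_n. The Lie algebra of J is generated by the
    sl_2-triple e = e(1), f = f(1), h = h(1) and the elements e(x_i). Given an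
    sl_2-triple in a Lie algebra L, call a of weight 2 if it is the highest weight
    vector of a copy of the adjoint representation of sl_2 in L (or 0), and put
    h(a) = [a, f], f(a) = -1/2 [h(a), f] and a.b = 1/2 [h(a), b]. If [a, b] = 0,
    then a.b = b.a is again of weight 2, and the brackets between the two copies
    of sl_2 are those of the Lie algebra of a Jordan algebra ([weight2_jprod],
    [mul_low2], [low2_jprod]); the Jordan identity is a consequence
    ([jordan_cyclic]). So, once [e_u, e_v] = 0 for all nonassociative monomials
    e_u in the e(x_i), these monomials span together with e a Jordan algebra
    ([coordinates_exist]), and formulas define a homomorphism from the Lie algebra
    of J to L ([hat_map_hom]). The relations of the sl_2-triple, those saying that
    the e(x_i) are of weight 2, and the relators of J are finite in number. It
    remains to deduce all relations [e_u, e_v] = 0 from finitely many of them.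

    Suppose that these relations hold in total degree less than d. In degree d,
    the bracket satisfies [e_wu, e_v] = - [e_u, e_wv]. Together with the Jordan
    identity in lower degrees, this forces the sum of the brackets [e_p, y] over
    the three products p = (ab)(cz), (bc)(az), (ca)(bz) to change sign when z and
    y are exchanged; as it is symmetric in a, b, c and z, it vanishes
    ([matchings0]). Hence the radical of the form (u, v) |-> [e_u, e_v] in degree
    d contains the ideal generated by all ab - ba and by the elements
      (ab)(cz) + (bc)(az) + (ca)(bz)  and  c((ab)z) + a((bc)z) + b((ca)z)
    ([nil_ideal_form]). Let a nil algebra be a commutative algebra where these
    elements vanish. If the products of M or more generators vanish in every nil
    algebra on n generators, then the relations of degree at most 2M imply all
    others ([jtree_abelian]).

    Finitely generated nil algebras are nilpotent ([trees_nilpotent]). Write L_a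
    for the multiplication by a. The identities give
      L_a L_x L_b + L_b L_x L_a = - L_((ab)x)  and  2 (ab)^2 = - a^2 b^2.
    By the first one, modulo products of two decomposable elements, a long product
    a_1(b_1(a_2(b_2(...)))) is alternating in the a_i and vanishes if one of them
    is decomposable. So decomposable elements are generated by those of bounded
    degree, hence by finitely many squares c, which satisfy c^2 = 0. Then
    L_c L_y L_c = 0 for all y: the block matrices with one off-diagonal entry L_c
    are sandwiches in a Lie algebra of operators on the sum of two copies of the
    algebra, and it is enough to know that finitely many sandwiches generate a
    nilpotent associative algebra (a theorem of Kostrikin and Zelmanov,
    [sandwich_nilpotent]).

    For this, order the words in the sandwiches lexicographically. Commutators of
    sandwiches are sandwiches, and the leading words of iterated commutators
    include the regular words: the letters, and uv for u, v regular with uv < vu.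
    Since a sandwich c satisfies c^2 = 0 and c l c = 0 for l in the Lie algebra,
    each word containing vv or vav, with v and a regular, is a combination of
    larger words. It remains to bound the length of words without such factors
    ([regular_words_bounded]). Recode long words by blocks zu, where z is the
    least letter and z does not occur in u, and iterate. At each level a letter is
    a word Wx, with x a letter of the original alphabet, such that W is empty or
    regular; as xWx is excluded, x never comes just before Wx. So the last letter
    of z, which comes before no block, is the last letter of none of them, and
    each recoding decreases the number of possible last letters. *)

(** * Words without factors vv and vav, for v and a regular *)

Section Words.
Context (m : nat).
Local Notation word := (seq 'I_m).
Implicit Types (u v w : word) (x y : 'I_m) (s t : seq word).

(** The first difference decides. A word and its prefixes are not comparable, so
    that the relation is inherited by all extensions of two words. *)
Fixpoint wlt u v : bool :=
  match u, v with
  | x :: u', y :: v' => (x < y) || (x == y) && wlt u' v'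
  | _, _ => false
  end.

Fixpoint wlex u v : bool :=
  match u, v with
  | x :: u', y :: v' => (x < y) || (x == y) && wlex u' v'
  | [::], _ :: _ => true
  | _, _ => false
  end.

Lemma wlt_cat2l w u v : wlt (w ++ u) (w ++ v) = wlt u v.
Proof. by elim: w => //= x w ->; rewrite eqxx ltnn. Qed.

Lemma wlex_cat2l w u v : wlex (w ++ u) (w ++ v) = wlex u v.
Proof. by elim: w => //= x w ->; rewrite eqxx ltnn. Qed.

Lemma wlt_catr u v u' v' : wlt u v -> wlt (u ++ u') (v ++ v').
Proof.
elim: u v => [|x u IH] [|y v] //= /orP[->//|/andP[-> /IH ->]].
by rewrite orbT.
Qed.

Lemma wlex_catr u v v' : wlex u v -> wlex u (v ++ v').
Proof.
elim: u v => [|x u IH] [|y v] //= /orP[->//|/andP[-> /IH ->]].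
by rewrite orbT.
Qed.

Lemma wlex_asym u v : wlex u v -> wlex v u -> False.
Proof.
elim: u v => [|x u IH] [|y v] //= /orP[xy|/andP[/eqP -> uv]].
  by rewrite ltnNge (ltnW xy) /= => /andP[/eqP E]; rewrite E ltnn in xy.
by rewrite ltnn eqxx /=; apply: IH.
Qed.

Lemma wlex_trans u v w : wlex u v -> wlex v w -> wlex u w.
Proof.
elim: u v w => [|x u IH] [|y v] [|z w] //= /orP[xy|/andP[/eqP -> uv]].
  by move=> /orP[yz|/andP[/eqP <- _]]; rewrite ?xy // (ltn_trans xy yz).
by move=> /orP[->//|/andP[-> /(IH _ _ uv) ->]]; rewrite orbT.
Qed.

Lemma wlex_total u v : u != v -> wlex u v || wlex v u.
Proof.
elim: u v => [|x u IH] [|y v] //= ne.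
case: (ltngtP x y) => [xy|yx|E] //=; first by rewrite orbT.
have {}E := val_inj E; rewrite E in ne *.
by rewrite eqxx /=; apply: IH; apply: contra ne => /eqP ->.
Qed.

Lemma wlex_prefixF u v : wlex u v -> prefix v u = false.
Proof.
elim: u v => [|x u IH] [|y v] //= /orP[xy|/andP[/eqP -> /IH ->]].
  by case: eqP => // E; rewrite E ltnn in xy.
by rewrite andbF.
Qed.

Lemma wlex_wlt u v : size v <= size u -> wlex u v -> wlt u v.
Proof.
elim: u v => [|x u IH] [|y v] //= uv /orP[->//|/andP[-> /(IH _ uv) ->]].
by rewrite orbT.
Qed.

Lemma wlt_rcons u v x : wlt u (rcons v x) -> ~~ prefix v u -> wlt u v.
Proof.
elim: u v => [|y u IH] [|z v] //=.
move=> /orP[->//|/andP[/eqP -> H]]; rewrite eqxx /= => nv.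
by rewrite (IH _ H nv) orbT.
Qed.

Lemma wlt_catl u w v : wlt (u ++ w) v ->
  wlt u v \/ exists2 v', v = u ++ v' & wlt w v'.
Proof.
elim: u v => [|x u IH] v /=; first by right; exists v.
case: v => //= y v /orP[-> |/andP[/eqP -> /IH[->|[v' -> H]]]]; first by left.
  by left; rewrite eqxx orbT.
by right; exists v'.
Qed.

(** Whether v lies above or below the powers of u decides between uv and vu. *)
Lemma wlt_pow N u v : wlt (flatten (nseq N u)) v -> wlt (u ++ v) (v ++ u).
Proof.
elim: N v => [|N IH] v //= /wlt_catl[H|[v' -> /IH H]].
  exact: wlt_catr.
by rewrite -catA wlt_cat2l.
Qed.

Variables (reg F : word -> Prop).
Hypotheses (reg1 : forall x, reg [:: x])
  (reg_cat : forall u v, reg u -> reg v -> wlt (u ++ v) (v ++ u) -> reg (u ++ v))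
  (F_factor : forall u v w, F (u ++ v ++ w) -> F v)
  (F_vv : forall v, reg v -> ~ F (v ++ v))
  (F_vav : forall v a, reg v -> reg a -> ~ F (v ++ a ++ v)).

Lemma F_catl u v : F (u ++ v) -> F u.
Proof. by move=> H; apply: (@F_factor [::] u v). Qed.
Lemma F_catr u v : F (u ++ v) -> F v.
Proof. by move=> H; apply: (@F_factor u v [::]); rewrite cats0. Qed.

Definition over (S : seq word) s := all [in S] s.

Lemma over_cat S s t : over S (s ++ t) = over S s && over S t.
Proof. exact: all_cat. Qed.
Lemma over_rcons S s a : over S (rcons s a) = (a \in S) && over S s.
Proof. exact: all_rcons. Qed.

Definition unbounded (S : seq word) :=
  forall N, exists s, [/\ over S s, N <= size s & F (flatten s)].

(** The letters of a level: a finite set S of words over the original alphabet. By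
    [level_lex] the first different letters of two words over S decide between
    their expansions. By [level_prefix], if W is not a prefix of z then a letter
    rcons W x above z differs already in W from the words starting with z. *)
Record level (S : seq word) (P : {set 'I_m}) : Prop := Level {
  level_last : forall b, b \in S -> exists W x,
    [/\ b = rcons W x, x \in P, reg b & W = [::] \/ reg W];
  level_lex : forall a b s, a \in S -> b \in S -> wlex a b -> over S s ->
    wlex (a ++ flatten s) b;
  level_prefix : forall a W x s, a \in S -> rcons W x \in S ->
    wlex a (rcons W x) -> over S s -> prefix W (a ++ flatten s) ->
    size W <= size a
}.

Lemma level_sub S S' P : {subset S' <= S} -> level S P -> level S' P.
Proof.
move=> sub [h1 h2 h3].
have ov s : over S' s -> over S s by move=> /allP H; apply/allP => a /H /sub.
split=> [b /sub/h1 //|a b s /sub Sa /sub Sb ab /ov|a W x s /sub Sa /sub Sb ab /ov].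
  exact: (h2 a b s Sa Sb ab).
exact: (h3 a W x s Sa Sb ab).
Qed.

Definition live (S : seq word) b := exists s1 c s2,
  over S (s1 ++ b :: c :: s2) /\ F (flatten (s1 ++ b :: c :: s2)).

(** In a minimal alphabet each letter occurs in all long words, whence
    [min_live]. *)
Lemma unbounded_min S : unbounded S -> exists S',
  [/\ {subset S' <= S}, unbounded S' &
    forall b, b \in S' -> ~ unbounded [seq c <- S' | c != b]].
Proof.
have [n] := ubnP (size S); elim: n S => // n IH S Sn uS.
case: (pselect (exists2 b, b \in S & unbounded [seq c <- S | c != b])); last first.
  by move=> H; exists S; split=> // b Sb ub; apply: H; exists b.
move=> [b Sb /IH[]].
  rewrite -ltnS; apply: leq_trans Sn; rewrite ltnS size_filter.
  rewrite -(count_predC (fun c => c != b)) -addn1 leq_add2l -has_count.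
  by apply/hasP; exists b => //=; rewrite eqxx.
move=> S' [sub uS' mS']; exists S'; split=> // c /sub.
by rewrite mem_filter => /andP[].
Qed.

Lemma min_live S b : unbounded S -> ~ unbounded [seq c <- S | c != b] -> live S b.
Proof.
move=> uS nu.
have [N HN] : exists N, forall s, over [seq c <- S | c != b] s -> F (flatten s) ->
    size s < N.
  apply: contrapT => H; apply: nu => N; apply: contrapT => H'.
  apply: H; exists N => s os Fs; rewrite ltnNge; apply/negP => Ns.
  by apply: H'; exists s.
have [s [os Ns Fs]] := uS N.+1.
case/lastP: s os Ns Fs => // s c; rewrite size_rcons ltnS => os Ns Fs.
have bs : b \in s.
  apply: contraT => bs; move: (HN s); rewrite ltnNge Ns => H.
  suff: false by []. apply: H; last by move: Fs; rewrite flatten_rcons; apply: F_catl.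
  apply/allP => a sa; rewrite mem_filter (contraNneq _ bs); last by move=> <-.
  by move/allP: os; apply; rewrite mem_rcons inE sa orbT.
case/splitPr: bs os Fs Ns => s1 s2 os Fs _.
case: s2 os Fs => [|d s2] os Fs.
  by exists s1, c, [::]; move: os Fs; rewrite rcons_cat.
by exists s1, d, (rcons s2 c); move: os Fs; rewrite rcons_cat.
Qed.

Lemma wlex_min S : S != [::] ->
  exists2 z, z \in S & forall b, b \in S -> b != z -> wlex z b.
Proof.
elim: S => // a S IH _; have [->|/IH[z Sz zmin]] := eqVneq S [::].
  by exists a; rewrite ?inE // => b; rewrite inE => /eqP ->; rewrite eqxx.
case: (boolP (wlex a z)) => az.
  exists a; rewrite ?inE ?eqxx // => b; rewrite inE => /predU1P[->|Sb].
    by rewrite eqxx.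
  by move=> _; have [->//|/(zmin _ Sb)] := eqVneq b z; apply: wlex_trans.
exists z; first by rewrite inE Sz orbT.
move=> b; rewrite inE => /predU1P[-> ne|]; last exact: zmin.
by have := wlex_total ne; rewrite (negPf az).
Qed.

Fixpoint words_upto N (S : seq word) : seq (seq word) :=
  if N is N'.+1 then [::] :: [seq a :: s | a <- S, s <- words_upto N' S] else [:: [::]].

Lemma words_uptoP N S s : over S s -> size s <= N -> s \in words_upto N S.
Proof.
elim: N s => [|N IH] [|a s] //= /andP[Sa os] sN; rewrite inE /=.
by apply/allpairsP; exists (a, s); split=> //; apply: IH.
Qed.

Lemma words_upto_over N S s : s \in words_upto N S -> over S s.
Proof.
elim: N s => [|N IH] s /=; rewrite inE; first by move=> /eqP ->.
by move=> /predU1P[->//|] /allpairsP[[a s'] /= [Sa /IH os ->]] /=; rewrite Sa.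
Qed.

Section Step.
Context (S : seq word) (P : {set 'I_m}) (z : word).
Hypotheses (LS : level S P) (Sz : z \in S)
  (zmin : forall b, b \in S -> b != z -> wlex z b).

Let Sz' := [seq c <- S | c != z].

Definition block t := z ++ flatten t.
Definition is_block B := exists t, [/\ over Sz' t, t != [::] & B = block t].

Lemma over_sub t : over Sz' t -> over S t.
Proof. by move=> /allP H; apply/allP => a /H; rewrite mem_filter => /andP[]. Qed.

Lemma reg_mem b : b \in S -> reg b.
Proof. by move=> /(level_last LS)[W [x []]]. Qed.

(** As z is less than each letter u_i of t, whatever follows, multiplying z u_1 ...
    by u_(i+1) on the right gives a smaller word than multiplying on the left. *)
Lemma block_reg t : over Sz' t -> reg (block t).
Proof.
elim/last_ind: t => [|t e IH]; first by rewrite /block cats0 => _; apply: reg_mem.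
rewrite over_rcons mem_filter => /andP[/andP[ez Se] ot].
rewrite /block flatten_rcons catA; apply: reg_cat; [exact: IH|exact: reg_mem|].
rewrite -[X in wlt X _]cats0; apply: wlt_catr.
apply: wlex_wlt; first by rewrite size_cat leq_addl.
rewrite /block -catA -flatten_rcons; apply: (level_lex LS) => //; first exact: zmin.
by rewrite over_rcons Se; apply: over_sub.
Qed.

Lemma decompose s : over S s -> exists p ts,
  [/\ over Sz' p, all (over Sz') ts, flatten s = flatten p ++ flatten (map block ts)
    & size s = size p + sumn [seq (size t).+1 | t <- ts]].
Proof.
elim: s => [|a s IH] /=; first by exists [::], [::].
move=> /andP[Sa /IH[p [ts [op ots E1 E2]]]].
have [->|az] := eqVneq a z.
  by exists [::], (p :: ts); rewrite /= op ots E1 E2 /block !catA addSn.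
exists (a :: p), ts; rewrite /= mem_filter az Sa; split=> //.
  by rewrite E1 catA.
by rewrite E2.
Qed.

(** Cut a long word before each z. The words between consecutive z have bounded
    length since they avoid z, and are not empty since zz is excluded. *)
Lemma blocks_unbounded : unbounded S -> ~ unbounded Sz' ->
  exists2 B, unbounded B & forall b, b \in B -> is_block b.
Proof.
move=> uS nu.
have [N HN] : exists N, forall s, over Sz' s -> F (flatten s) -> size s <= N.
  apply: contrapT => H; apply: nu => N; apply: contrapT => H'.
  apply: H; exists N => s os Fs; rewrite leqNgt; apply/negP => Ns.
  by apply: H'; exists s; split=> //; apply: ltnW.
exists [seq block t | t <- words_upto N Sz' & t != [::]] => [M|b]; last first.
  move=> /mapP[t]; rewrite mem_filter => /andP[t0 /words_upto_over ot ->].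
  by exists t.
have [s [os Ms Fs]] := uS (N + M.+1 * N.+1).
have [p [ts [op ots Efl Esz]]] := decompose os.
rewrite Efl in Fs; have Fp := F_catl Fs; have {}Fs := F_catr Fs.
have tsN : all (fun t => size t <= N) ts.
  apply/allP => t tts; apply: HN; first by move/allP: ots; apply.
  case/splitPr: tts Fs => t1 t2; rewrite map_cat flatten_cat /=.
  by move=> /F_catr/F_catl/F_catr.
have : size s <= N + size ts * N.+1.
  rewrite Esz leq_add ?HN //; elim: (ts) tsN => //= t ts' IH /andP[tN /IH].
  by rewrite mulSn => H; rewrite leq_add.
move=> H; have := leq_trans Ms H; rewrite leq_add2l leq_pmul2r // => Mts.
case/lastP: ts ots Mts Fs tsN {Efl Esz H} => // ts tl.
rewrite size_rcons ltnS map_rcons flatten_rcons all_rcons => /andP[otl ots] Mts Fs.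
rewrite all_rcons => /andP[_ tsN].
exists (map block ts); rewrite size_map; split=> //; last exact: F_catl Fs.
apply/allP => _ /mapP[t tts ->]; apply/mapP; exists t => //.
rewrite mem_filter words_uptoP; [|by move/allP: ots; apply|by move/allP: tsN; apply].
rewrite andbT; apply/eqP => t0; rewrite t0 in tts.
case/splitPr: tts Fs => t1 t2; rewrite map_cat flatten_cat /= /block /= cats0.
rewrite -catA => /F_catr; case: t2 => [|t' t2] /=.
  by rewrite cats0 catA => /F_catl H; apply: (F_vv (reg_mem Sz) H).
rewrite -!catA catA => /F_catl H; exact: (F_vv (reg_mem Sz) H).
Qed.

(** If t1 runs out before it differs from t2, it is followed by z, which is less
    than the next letter of t2. *)
Lemma wlex_block t1 t2 al : over Sz' t1 -> over Sz' t2 -> over S al ->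
  (al = [::] \/ exists al', al = z :: al') ->
  wlex (flatten t1) (flatten t2) -> wlex (flatten t1 ++ flatten al) (flatten t2).
Proof.
move=> o1 o2 oal hal.
have w0 (u : word) : wlex u [::] = false by case: u.
elim: t1 t2 o1 o2 => [|a t1 IH] [|e t2] //=.
  move=> _; rewrite mem_filter => /andP[/andP[ez Se] _] _.
  case: hal oal => [->|[al' ->]] /=.
    by case: (e) (zmin Se ez) => //; case: (z).
  by move=> /andP[_ oal]; apply: wlex_catr; apply: (level_lex LS) => //; apply: zmin.
  by rewrite w0.
move=> /andP[]; rewrite !mem_filter => /andP[az Sa] o1 /andP[/andP[ez Se] o2].
have [->|ae] := eqVneq a e; first by rewrite -catA !wlex_cat2l; apply: IH.
case/orP: (wlex_total ae) => [ae'|ea] H.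
  rewrite -catA -flatten_cat; apply: wlex_catr; apply: (level_lex LS) => //.
  by rewrite over_cat oal andbT; apply: over_sub.
exfalso; apply: wlex_asym H _; apply: wlex_catr.
by apply: (level_lex LS) => //; apply: over_sub.
Qed.

Definition ending e := exists2 t, over Sz' (rcons t e) & F (e ++ z).

(** Otherwise e z would start with W x W. *)
Lemma ending_prefix e W x : ending e -> e = rcons W x -> W <> [::] -> prefix W z = false.
Proof.
move=> [t]; rewrite over_rcons mem_filter => /andP[/andP[_ Se] _] Fez E W0.
apply/negP => /prefixP[z' Ez]; have [W1 [x1 [E1 _ _ rW]]] := level_last LS Se.
move: E1; rewrite E => /rcons_inj[EW Ex]; case: rW; rewrite -EW // => rW.
apply: (F_vav rW (reg1 x)); apply: (@F_catl _ z').
by move: Fez; rewrite E Ez -cats1 -!catA.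
Qed.

(** Since t2 = rcons t (rcons W x) is above t1, the two can only differ in its last
    letter. If there t1 has another letter, apply [level_prefix]; if t1 has run
    out, the next letter is z, and W is not a prefix of it. *)
Lemma prefix_block t1 t W x al : over Sz' t1 -> over Sz' (rcons t (rcons W x)) ->
  ending (rcons W x) -> over S al -> (al = [::] \/ exists al', al = z :: al') ->
  wlex (flatten t1) (flatten (rcons t (rcons W x))) ->
  prefix (flatten t ++ W) (flatten t1 ++ flatten al) ->
  size (flatten t ++ W) <= size (flatten t1).
Proof.
move=> o1 o2 ee oal hal.
have {}o2 : over Sz' t /\ over Sz' [:: rcons W x].
  by move: o2; rewrite over_rcons => /andP[H ->]; rewrite /over /= H.
case: o2 => o2 oe; move: oe; rewrite /over /= mem_filter andbT => /andP[ez Se].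
elim: t1 t o1 o2 => [|a t1 IH] [|c t] //=.
- move=> _ _ _; case: hal oal => [-> _|[al' ->]] /=; first by case: (W).
  move=> /andP[_ oal] pW; have zle := zmin Se ez.
  have W0 := ending_prefix ee erefl.
  have := level_prefix LS Sz Se zle oal pW; have [->//|/eqP/W0] := eqVneq W [::].
  move: pW; rewrite !prefixE => /eqP E1 /negbT E2 le; case/negP: E2; apply/eqP.
  by rewrite -[RHS]E1 take_cat; case: ltngtP le => // -> _; rewrite subnn take0 cats0 take_size.
- move=> _; rewrite mem_filter => /andP[/andP[cz Sc] _] _.
  case: hal oal => [-> _|[al' ->]] /=; first by case: (_ ++ _).
  move=> /andP[_ oal]; rewrite -catA => /prefixP[r Er].
  have := level_lex LS Sz Sc (zmin Sc cz) oal; rewrite Er => /wlex_prefixF.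
  by rewrite -catA prefix_prefix.
- rewrite mem_filter => /andP[/andP[az Sa] o1] _; rewrite cats0.
  have [->|ae] := eqVneq a (rcons W x).
    by move=> /wlex_prefixF; rewrite prefix_prefix.
  case/orP: (wlex_total ae) => [ae'|ea] H.
    rewrite -catA -flatten_cat => pW.
    have oo : over S (t1 ++ al).
      by rewrite over_cat oal andbT; apply: over_sub.
    have := level_prefix LS Sa Se ae' oo pW; rewrite size_cat => /leq_trans; apply.
    exact: leq_addr.
  exfalso; apply: wlex_asym H _; rewrite -[X in wlex X _]cats0 -[X in wlex (_ ++ X)]/(flatten [::]).
  by apply: wlex_catr; apply: (level_lex LS).
rewrite !mem_filter => /andP[/andP[az Sa] o1] /andP[/andP[cz Sc] o2].
have [->|ac] := eqVneq a c.
  by rewrite -!catA wlex_cat2l (prefix_catr _ _ (erefl (size c))) eqxx /= !size_cat !leq_add2l -!size_cat; apply: IH.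
have oo : over S (t1 ++ al) by rewrite over_cat oal andbT; apply: over_sub.
case/orP: (wlex_total ac) => [ac'|ca] H.
  rewrite -!catA -flatten_cat => /prefixP[r Er].
  have := level_lex LS Sa Sc ac' oo; rewrite Er => /wlex_prefixF.
  by rewrite -catA prefix_prefix.
exfalso; apply: wlex_asym H _; apply: wlex_catr; apply: (level_lex LS) => //.
by rewrite over_rcons Se; apply: over_sub.
Qed.


(** A block B = z t (W x) is followed by z. If W is not empty, it is not a prefix
    of z, and W x differs within W from all words starting with z, in particular from the powers
    of z t, so z t W is regular. If x were the last letter of z = W' x, then the
    excluded word x W' x would occur; hence P loses an element. *)
Lemma block_level (B : seq word) : (forall b, b \in B -> is_block b) ->
  (forall b, b \in B -> live B b) -> exists2 P', level B P' & P' \proper P.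
Proof.
move=> isB lB; have [Wz [xz [Ez Pxz _ rWz]]] := level_last LS Sz.
have overB al : over B al -> exists2 al', over S al' &
    flatten al = flatten al' /\ (al' = [::] \/ exists al'', al' = z :: al'').
  elim: al => [|b al IH] /=; first by exists [::]; [|split; [|left]].
  move=> /andP[/isB[t [ot _ ->]] /IH[al' oal [-> _]]].
  exists (z :: t ++ al'); last first.
    by split; [rewrite /block /= flatten_cat catA|right; exists (t ++ al')].
  by rewrite /over /= Sz -/(over S _) over_cat oal (over_sub ot).
have last_block t e : over Sz' (rcons t e) -> block (rcons t e) \in B -> ending e.
  move=> ot /lB[s1 [c [s2 [oB FB]]]]; exists t => //.
  have /isB[tc [_ _ Ec]] : c \in B.
    by move/allP: oB; apply; rewrite mem_cat !inE eqxx !orbT.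
  move: FB; rewrite flatten_cat /= Ec /block flatten_rcons => /F_catr.
  by rewrite -!catA => /F_catr/F_catr; rewrite catA => /F_catl.
have shape b : b \in B -> exists t W x, [/\ over Sz' (rcons t (rcons W x)),
    b = block (rcons t (rcons W x)), reg b & W = [::] \/ reg W].
  move=> /isB[t [ot + ->]]; have := block_reg ot.
  case/lastP: t ot => // t e ot rB _.
  have Se : e \in S.
    by apply: (allP (over_sub ot)); rewrite mem_rcons mem_head.
  have [W [x [Ee _ _ rW]]] := level_last LS Se.
  by exists t, W, x; rewrite -Ee.
have blockE t W x : block (rcons t (rcons W x)) = rcons (z ++ flatten t ++ W) x.
  by rewrite /block flatten_rcons !rcons_cat.
exists (P :\ xz); last by rewrite properD1.
split.
- move=> b Bb; have [t [W [x [ot Eb rb rW]]]] := shape b Bb.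
  have ee := last_block _ _ ot; rewrite -Eb in ee; have {}ee := ee Bb.
  exists (z ++ flatten t ++ W), x; rewrite Eb blockE; split=> //.
  + have Se : rcons W x \in S.
      by apply: (allP (over_sub ot)); rewrite mem_rcons mem_head.
    have [W' [x' [/rcons_inj[_ <-] Px _ _]]] := level_last LS Se.
    rewrite !inE Px andbT; apply/eqP => xxz.
    case: ee => t' _; rewrite -cats1 -catA => /F_catr.
    rewrite Ez xxz -cats1; case: rWz => [->|rWz]; first exact: F_vv.
    exact: F_vav.
  + by rewrite -blockE -Eb.
  right; have ot' : over Sz' t by move: ot; rewrite over_rcons => /andP[].
  have [W0|W0] := pselect (W = [::]).
    by rewrite W0 cats0; apply: block_reg.
  case: rW => // rW; rewrite catA; apply: reg_cat => //; first exact: block_reg.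
  have := ot; rewrite over_rcons mem_filter => /andP[/andP[ez Se] _].
  have zle := zmin Se ez; have nWz := ending_prefix ee erefl W0.
  (* N copies of z t make a word longer than the last letter rcons W x. *)
pose N := size (rcons W x).
  apply: (@wlt_pow N.+1); apply: (@wlt_rcons _ _ x).
    apply: wlex_wlt.
      rewrite -/N -[N in N <= _]/(N.+1.-1) /= size_cat.
      apply: leq_trans (leq_addl _ _); elim: (N) => //= k IH; rewrite size_cat.
      have z0 : 0 < size z by rewrite Ez size_rcons.
      by rewrite -add1n leq_add // size_cat (leq_trans z0) // leq_addr.
    rewrite [flatten _]/= -catA -[flatten t ++ _]/(flatten t ++ flatten (nseq N _)).
    have -> : flatten (nseq N (z ++ flatten t)) = flatten (flatten (nseq N (z :: t))).
      by elim: (N) => //= k ->; rewrite flatten_cat catA.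
    rewrite -flatten_cat; apply: (level_lex LS) => //.
    rewrite over_cat (over_sub ot') /=; elim: (N) => //= k IH.
    by rewrite Sz over_cat (over_sub ot') IH.
  rewrite [flatten _]/= -catA.
  have -> : flatten (nseq N (z ++ flatten t)) = flatten (flatten (nseq N (z :: t))).
    by elim: (N) => //= k ->; rewrite flatten_cat catA.
  rewrite -flatten_cat; apply/negP => pW.
  have oo : over S (t ++ flatten (nseq N (z :: t))).
    rewrite over_cat (over_sub ot') /=; elim: (N) => //= k IH.
    by rewrite Sz over_cat (over_sub ot') IH.
  have le := level_prefix LS Sz Se zle oo pW.
  move: pW nWz; rewrite !prefixE => /eqP {2}<- /eqP[]; rewrite take_cat.
  by case: ltngtP le => // -> _; rewrite subnn take0 cats0 take_size.
- move=> a b al Ba Bb; have [ta [Wa [xa [oa -> _ _]]]] := shape a Ba.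
  have [tb [Wb [xb [ob -> _ _]]]] := shape b Bb.
  rewrite /block wlex_cat2l -catA wlex_cat2l => lab /overB[al' oal' [-> hal]].
  exact: wlex_block.
move=> a W x al Ba Bb; have [ta [Wa [xa [oa Ea _ _]]]] := shape a Ba.
have [t [We [xe [ot Eb _ _]]]] := shape _ Bb.
have ee := last_block _ _ ot; rewrite -Eb in ee; have {}ee := ee Bb.
move: Eb; rewrite blockE => /rcons_inj[EW Ex]; rewrite EW Ex -blockE Ea.
rewrite {1 2}/block wlex_cat2l => lab /overB[al' oal' [-> hal]].
rewrite -catA (prefix_catr _ _ (erefl (size z))) eqxx /= => pW.
rewrite [size (z ++ _)]size_cat [size (block _)]size_cat leq_add2l.
exact: (prefix_block oa ot ee oal' hal lab pW).
Qed.

End Step.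

Lemma level_bounded S P : level S P -> ~ unbounded S.
Proof.
have [n] := ubnP #|P|; elim: n P S => // n IH P S Pn LS uS.
have [S1 [sub1 u1 m1]] := unbounded_min uS.
have L1 := level_sub sub1 LS.
have S10 : S1 != [::].
  apply/eqP => S10; have [s [os]] := u1 1; rewrite S10 in os.
  by case: s os.
have [z Sz zmin] := wlex_min S10.
have [B uB isB] := blocks_unbounded L1 Sz u1 (m1 z Sz).
have [B1 [subB uB1 mB1]] := unbounded_min uB.
have [|b /(mB1) nb|P' LB PP] := block_level L1 Sz zmin (B := B1).
- by move=> b /subB/isB.
- exact: min_live.
apply: (IH P' B1 _ LB uB1); rewrite -ltnS; apply: leq_trans Pn; rewrite ltnS.
exact: proper_card.
Qed.

Theorem regular_words_bounded : exists M, forall w, M <= size w -> ~ F w.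
Proof.
apply: contrapT => H.
have/level_bounded[] : level [seq [:: x] | x <- enum 'I_m] finset.setT.
  split.
  - by move=> _ /mapP[x _ ->]; exists [::], x; split; rewrite ?inE //; left.
  - move=> _ _ s /mapP[x _ ->] /mapP[y _ ->] /=.
    by rewrite !andbF !orbF => ->.
  - by move=> a [|? [|? ?]] x s _ /mapP[y _ E] //; case: E.
move=> N; apply: contrapT => H'; apply: H; exists N => w Nw Fw; apply: H'.
exists [seq [:: x] | x <- w]; rewrite size_map; split=> //.
  by apply/allP => _ /mapP[x _ ->]; apply/mapP; exists x; rewrite ?mem_enum.
by rewrite (_ : flatten _ = w) //; elim: (w) => //= x w' ->.
Qed.

End Words.

(** * The sandwich theorem *)

Local Open Scope ring_scope.

Lemma wlt_trans m (u v w : seq 'I_m) : wlt u v -> wlt v w -> wlt u w.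
Proof.
elim: u v w => [|x u IH] [|y v] [|z w] //= /orP[xy|/andP[/eqP -> uv]].
  by move=> /orP[yz|/andP[/eqP <- _]]; rewrite ?xy // (ltn_trans xy yz).
by move=> /orP[->//|/andP[-> /(IH _ _ uv) ->]]; rewrite orbT.
Qed.

Lemma wlt_irr m (u : seq 'I_m) : wlt u u = false.
Proof. by elim: u => //= x u ->; rewrite ltnn andbF. Qed.

Section Sandwich.
Context (V : zmodType).
Implicit Types (f g l : V -> V).

Definition additive_map f := forall x y, f (x - y) = f x - f y.
Definition commutator f g := fun y => f (g y) - g (f y).

Lemma additive_map0 f : additive_map f -> f 0 = 0.
Proof. by move=> fB; rewrite -[X in f X](subrr 0) fB subrr. Qed.

Lemma additive_comp f g : additive_map f -> additive_map g ->
  additive_map (fun y => f (g y)).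
Proof. by move=> fB gB x y; rewrite gB fB. Qed.

Context (L : (V -> V) -> Prop).
Hypotheses (L_additive : forall f, L f -> additive_map f)
  (L_commutator : forall f g, L f -> L g -> L (commutator f g)).

Record sandwich f : Prop := Sandwich {
  sandwich_mem : L f;
  sandwich_sq : forall y, f (f y) = 0;
  sandwich_mid : forall l y, L l -> f (l (f y)) = 0
}.

(** Applying f l' f = 0 to the commutator l' of k and l gives f k l f = f l k f.
    These exchanges bring to each term of the expansion one of the zero factors. *)
Lemma sandwich_commutator f g : sandwich f -> sandwich g -> sandwich (commutator f g).
Proof.
move=> [Lf ff fLf] [Lg gg gLg].
have fB := L_additive Lf; have gB := L_additive Lg.
have f0 := additive_map0 fB; have g0 := additive_map0 gB.
split; first exact: L_commutator.
  move=> y; rewrite /commutator !(fB, gB) !(ff, gg, f0, g0).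
  by rewrite (fLf g) // (gLg f) // ?(f0, g0) !subr0.
move=> l y Ll; have lB := L_additive Ll; have l0 := additive_map0 lB.
have swap h k x : L h -> (forall l' y', L l' -> h (l' (h y')) = 0) -> L k ->
    h (k (l (h x))) = h (l (k (h x))).
  move=> Lh hLh Lk; have := hLh _ x (L_commutator Lk Ll).
  rewrite /commutator (L_additive Lh) => /eqP; rewrite subr_eq0 => /eqP.
  exact.
rewrite /commutator !lB !(fB, gB).
rewrite (swap f g) // (swap g f) // (gLg f) // (fLf g) // (gLg l) // (fLf l) //.
by rewrite !(l0, f0, g0) !subr0.
Qed.

Context (m : nat) (act : 'I_m -> V -> V).
Hypothesis (act_sandwich : forall x, sandwich (act x)).

Definition word_act (w : seq 'I_m) (y : V) : V := foldr act y w.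

Lemma word_act_cat u v y : word_act (u ++ v) y = word_act u (word_act v y).
Proof. exact: foldr_cat. Qed.

Lemma word_act_additive w : additive_map (word_act w).
Proof.
elim: w => [|x w IH] // y z; rewrite /= IH.
exact: (L_additive (sandwich_mem (act_sandwich x))).
Qed.

Definition larger w (X : V -> V) y := forall w', size w' = size w -> wlt w w' ->
  X (word_act w' y) = 0.

(** The operator f is that of w up to larger words. Testing this on all additive X
    and all y stands for being a linear combination of larger words, and spares an
    algebra of operators. *)
Definition leads w f := forall X y, additive_map X -> larger w X y ->
  X (f y) = X (word_act w y).

Lemma leads_cat u v f g : additive_map f -> leads u f -> leads v g ->
  leads (u ++ v) (fun y => f (g y)).
Proof.
move=> fB uf vg X y XB lg.
have lgu u' : size u' = size u -> wlt u u' -> X (word_act u' (g y)) = 0.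
  move=> su uu'; rewrite (vg (fun y => X (word_act u' y))).
  - by rewrite -word_act_cat lg ?size_cat ?su // wlt_catr.
  - exact: (additive_comp XB (@word_act_additive _)).
  by move=> v' sv vv'; rewrite -word_act_cat lg ?size_cat ?su ?sv // wlt_catr.
rewrite (uf X (g y) XB lgu).
rewrite word_act_cat; apply: (vg (fun y => X (word_act u y))).
  exact: (additive_comp XB (@word_act_additive _)).
by move=> v' sv vv'; rewrite -word_act_cat lg ?size_cat ?sv // wlt_cat2l.
Qed.

Definition regular w := exists2 f, sandwich f & leads w f.

(** The word is not a combination of larger words of the same length. *)
Definition irreducible w :=
  ~ forall X y, additive_map X -> larger w X y -> X (word_act w y) = 0.

Lemma regular1 x : regular [:: x].
Proof. by exists (act x). Qed.

Lemma regular_cat u v : regular u -> regular v -> wlt (u ++ v) (v ++ u) ->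
  regular (u ++ v).
Proof.
move=> [f sf uf] [g sg vg] uv; exists (commutator f g).
  exact: sandwich_commutator.
have fB := L_additive (sandwich_mem sf); have gB := L_additive (sandwich_mem sg).
move=> X y XB lg; rewrite /commutator XB (leads_cat fB uf vg) //.
have svu : size (v ++ u) = size (u ++ v) by rewrite !size_cat addnC.
rewrite (leads_cat gB vg uf XB); first by rewrite (lg (v ++ u)) // subr0.
by move=> w sw vw; apply: lg; [rewrite sw|apply: wlt_trans uv vw].
Qed.

Lemma irreducible_factor u v w : irreducible (u ++ v ++ w) -> irreducible v.
Proof.
move=> H red; apply: H => X y XB lg; rewrite !word_act_cat.
apply: (red (fun z => X (word_act u z))); first exact: (additive_comp XB (@word_act_additive _)).
move=> v' sv vv'; have := lg (u ++ v' ++ w); rewrite !word_act_cat; apply.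
  by rewrite !size_cat sv.
by rewrite wlt_cat2l wlt_catr.
Qed.

Lemma irreducible_vv v : regular v -> ~ irreducible (v ++ v).
Proof.
move=> [f sf vf] H; apply: H => X y XB lg.
have fB := L_additive (sandwich_mem sf).
by rewrite -(leads_cat fB vf vf) // (sandwich_sq sf) (additive_map0 XB).
Qed.

Lemma irreducible_vav v a : regular v -> regular a -> ~ irreducible (v ++ a ++ v).
Proof.
move=> [f sf vf] [g sg ag] H; apply: H => X y XB lg.
have fB := L_additive (sandwich_mem sf); have gB := L_additive (sandwich_mem sg).
rewrite -(leads_cat fB vf (leads_cat gB ag vf)) //.
by rewrite (sandwich_mid sf _ (sandwich_mem sg)) (additive_map0 XB).
Qed.

(** A reducible word acts as zero as soon as all larger words of its length do, and
    there are finitely many of these. *)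
Theorem sandwich_nilpotent :
  exists M, forall w y, (M <= size w)%N -> word_act w y = 0.
Proof.
have [M HM] := regular_words_bounded regular1 regular_cat irreducible_factor irreducible_vv
  irreducible_vav.
exists M => w y Mw; pose bigger w := [set t : (size w).-tuple 'I_m | wlt w t].
have [n] := ubnP #|bigger w|; elim: n w Mw => // n IH w Mw wn.
have red : forall X y', additive_map X -> larger w X y' -> X (word_act w y') = 0.
  exact: contrapT (HM w Mw).
apply: (red id y) => // w' sw ww' /=.
apply: (IH w'); rewrite ?sw //; rewrite -ltnS; apply: leq_trans wn.
rewrite ltnS /bigger sw; apply: proper_card; apply/properP; split.
  by apply/fintype.subsetP => t; rewrite !inE; apply: wlt_trans.
have sw' : size w' == size w by rewrite sw.
by exists (Tuple sw'); rewrite inE //= wlt_irr.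
Qed.
End Sandwich.

(** * Nilpotency of finitely generated nil algebras *)

Inductive tree (T : Type) := Leaf of T | Node of tree T & tree T.

Fixpoint leaves T (t : tree T) : nat :=
  if t is Node u v then (leaves u + leaves v)%N else 1%N.

Lemma leaves_gt0 T (t : tree T) : (0 < leaves t)%N.
Proof. by elim: t => //= u IHu v IHv; rewrite addn_gt0 IHu. Qed.

Fixpoint tree_eval (K : fieldType) (A : nonAssocAlgType K) T (g : T -> A)
    (t : tree T) : A :=
  match t with
  | Leaf x => g x
  | Node u v => tree_eval g u ** tree_eval g v
  end.

Lemma repeated_fst (T : eqType) U (l : seq (T * U)) : ~~ uniq [seq p.1 | p <- l] ->
  exists l1 x b l2 d l3, l = l1 ++ (x, b) :: l2 ++ (x, d) :: l3.
Proof.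
elim: l => //= [[x b] l IH]; rewrite negb_and negbK /= => /orP[|/IH]; last first.
  move=> [l1 [y [c [l2 [d [l3 ->]]]]]].
  by exists ((x, b) :: l1), y, c, l2, d, l3.
move=> xl; have [l2 [d [l3 ->]]] : exists l2 d l3, l = l2 ++ (x, d) :: l3.
  elim: l xl {IH} => //= [[y c] l IH]; rewrite inE => /predU1P[-> /=|].
    by exists [::], c, l.
  by move=> /IH[l2 [d [l3 ->]]]; exists ((y, c) :: l2), d, l3.
by exists [::], x, b, l2, d, l3.
Qed.

Section NilAlgebra.
Context (K : fieldType) (charK : [pchar K] =i pred0) (A : nonAssocAlgType K).
Hypotheses (mulC : forall x y : A, x ** y = y ** x)
  (N1 : forall a b c x : A,
    (a ** b) ** (c ** x) + (b ** c) ** (a ** x) + (c ** a) ** (b ** x) = 0)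
  (N2 : forall a b c x : A,
    c ** ((a ** b) ** x) + a ** ((b ** c) ** x) + b ** ((c ** a) ** x) = 0).
Implicit Types (a b c x y v : A).

(** [N2] as an identity between operators applied to c. *)
Lemma triple_mul a x b v :
  a ** (x ** (b ** v)) + b ** (x ** (a ** v)) = - (((a ** b) ** x) ** v).
Proof.
apply/eqP; rewrite -addr_eq0 -(N2 a b v x) (mulC v) (mulC x (b ** v)).
by rewrite (mulC x (a ** v)) (mulC v a); apply/eqP; abel.
Qed.

(** [N1] with c = a and x = b. *)
Lemma sq_mul a b : (a ** b) ** (a ** b) + (a ** b) ** (a ** b) = - ((a ** a) ** (b ** b)).
Proof.
by apply/eqP; rewrite -addr_eq0 -(N1 a b a b) (mulC b a); apply/eqP; abel.
Qed.

Lemma sq_mul0 a b : a ** a = 0 -> (a ** b) ** (a ** b) = 0.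
Proof. by move=> a0; apply: (@char0_double0 _ charK); rewrite sq_mul a0 amul0l oppr0. Qed.

Lemma sq_sq a : (a ** a) ** (a ** a) = 0.
Proof.
have := N1 a a a a; set q := _ ** _ => q3.
have : 3%:R *: q = 0 by rewrite scaler_nat !mulrS mulr0n addr0 addrA.
by move/eqP; rewrite scaler_eq0 ((pcharf0P K).1 charK) /= => /eqP.
Qed.

Lemma sq0_mid c y v : c ** c = 0 -> c ** (y ** (c ** v)) = 0.
Proof. by move=> c0; apply: (@char0_double0 _ charK); rewrite triple_mul c0 !amul0l oppr0. Qed.

Section Sandwich.
Local Notation AA := (A * A)%type.

Definition upper y : AA -> AA := fun p => (y ** p.2, 0).
Definition lower y : AA -> AA := fun p => (0, y ** p.1).
Definition diagonal (D1 D2 : A -> A) : AA -> AA := fun p => (D1 p.1, D2 p.2).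

(** The commutators of the diagonal operator of D1 and D2 with upper operators are
    upper. Exchanging D1 and D2 gives the condition for lower operators. *)
Definition intertwines (D1 D2 : A -> A) :=
  forall y, exists y', forall v, D1 (y ** v) - y ** D2 v = y' ** v.

(** The union of the three homogeneous components of a graded Lie algebra. It is
    closed under commutators, and for homogeneous elements the sandwich property is
    immediate. *)
Inductive pair_lie : (AA -> AA) -> Prop :=
| PairUpper y : pair_lie (upper y)
| PairLower y : pair_lie (lower y)
| PairDiag D1 D2 of additive_map D1 & additive_map D2 & intertwines D1 D2
    & intertwines D2 D1 : pair_lie (diagonal D1 D2).

Lemma amulBl x y z : (x - y) ** z = x ** z - y ** z.
Proof. by rewrite amulDl amulNl. Qed.
Lemma amulBr x y z : z ** (x - y) = z ** x - z ** y.
Proof. by rewrite amulDr amulNr. Qed.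

Lemma pair_lie_additive f : pair_lie f -> additive_map f.
Proof.
case=> [y|y|D1 D2 a1 a2 _ _] p q; congr (_, _) => /=;
  by rewrite ?subrr ?amulBr ?a1 ?a2.
Qed.

Lemma pair_lie_opp f : pair_lie f -> pair_lie (fun p => - f p).
Proof.
case=> [y|y|D1 D2 a1 a2 i1 i2].
- rewrite (_ : (fun p => _) = upper (- y)); first exact: PairUpper.
  by apply/funext => p; congr (_, _); rewrite /= ?oppr0 ?amulNl.
- rewrite (_ : (fun p => _) = lower (- y)); first exact: PairLower.
  by apply/funext => p; congr (_, _); rewrite /= ?oppr0 ?amulNl.
rewrite (_ : (fun p => _) = diagonal (fun v => - D1 v) (fun v => - D2 v)) //.
have opp_add (D : A -> A) : additive_map D -> additive_map (fun v => - D v).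
  by move=> aD u v; rewrite aD opprD.
have opp_int E1 E2 : intertwines E1 E2 -> intertwines (fun v => - E1 v) (fun v => - E2 v).
  move=> E y; have [y' Ey] := E y; exists (- y') => v.
  by rewrite amulNr amulNl -Ey opprB opprK addrC.
by apply: PairDiag; [exact: opp_add|exact: opp_add|exact: opp_int|exact: opp_int].
Qed.

Lemma commutatorC (f g : AA -> AA) : commutator f g = (fun p => - commutator g f p).
Proof. by apply/funext => p; rewrite /commutator opprB. Qed.

Lemma pair_lie_upper_lower y y' : pair_lie (commutator (upper y) (lower y')).
Proof.
rewrite (_ : commutator _ _ =
    diagonal (fun v => y ** (y' ** v)) (fun v => - (y' ** (y ** v)))); last first.
  by apply/funext => p; congr (_, _); rewrite /= ?amul0r ?subr0 ?sub0r.
apply: PairDiag.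
- by move=> u v; rewrite !amulBr.
- by move=> u v; rewrite !amulBr opprD.
- move=> z; exists (- ((y ** z) ** y')) => v.
  by rewrite amulNr opprK triple_mul amulNl.
move=> z; exists ((y' ** z) ** y) => v.
by apply: oppr_inj; rewrite -triple_mul opprD !opprK.
Qed.

Lemma pair_lie_diag D1 D2 f : additive_map D1 -> additive_map D2 ->
  intertwines D1 D2 -> intertwines D2 D1 -> pair_lie f ->
  pair_lie (commutator (diagonal D1 D2) f).
Proof.
move=> a1 a2 i1 i2; have z1 := additive_map0 a1; have z2 := additive_map0 a2.
case=> [y|y|E1 E2 b1 b2 j1 j2].
- have [y' Ey] := i1 y; rewrite (_ : commutator _ _ = upper y'); first exact: PairUpper.
  by apply/funext => p; congr (_, _); rewrite /= ?Ey ?z2 ?subrr.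
- have [y' Ey] := i2 y; rewrite (_ : commutator _ _ = lower y'); first exact: PairLower.
  by apply/funext => p; congr (_, _); rewrite /= ?Ey ?z1 ?subrr.
rewrite (_ : commutator _ _ = diagonal (fun v => D1 (E1 v) - E1 (D1 v))
  (fun v => D2 (E2 v) - E2 (D2 v))) //.
have add (D E : A -> A) : additive_map D -> additive_map E ->
    additive_map (fun v => D (E v) - E (D v)).
  by move=> aD aE u v; rewrite aE aD aD aE; abel.
have int (D D' E E' : A -> A) : additive_map D -> additive_map E ->
   intertwines D D' -> intertwines E E' ->
   intertwines (fun v => D (E v) - E (D v)) (fun v => D' (E' v) - E' (D' v)).
  move=> aD aE iD iE y; have [y1 H1] := iD y; have [y2 H2] := iE y.
  have [y3 H3] := iD y2; have [y4 H4] := iE y1; exists (y3 - y4) => v.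
  rewrite amulBl -H3 -H4 -!H1 -!H2 !(aD, aE) !amulBr; abel.
by apply: PairDiag; [exact: add|exact: add|exact: int|exact: int].
Qed.

Lemma pair_lie_commutator f g : pair_lie f -> pair_lie g -> pair_lie (commutator f g).
Proof.
have zero : pair_lie (fun _ => 0).
  rewrite (_ : (fun _ => _) = upper 0); first exact: PairUpper.
  by apply/funext => p; rewrite /upper amul0l.
move=> pf pg; case: pf pg => [y|y|D1 D2 a1 a2 i1 i2] pg; last exact: pair_lie_diag.
- case: pg => [y'|y'|D1 D2 a1 a2 i1 i2]; last first.
  + by rewrite commutatorC; apply/pair_lie_opp/pair_lie_diag => //; constructor.
  + exact: pair_lie_upper_lower.
  rewrite (_ : commutator _ _ = (fun _ => 0)) //; apply/funext => p.
  by congr (_, _); rewrite /= ?amul0r subrr.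
case: pg => [y'|y'|D1 D2 a1 a2 i1 i2]; last first.
- by rewrite commutatorC; apply/pair_lie_opp/pair_lie_diag => //; constructor.
- rewrite (_ : commutator _ _ = (fun _ => 0)) //; apply/funext => p.
  by congr (_, _); rewrite /= ?amul0r subrr.
by rewrite commutatorC; apply/pair_lie_opp/pair_lie_upper_lower.
Qed.

Lemma sandwich_upper c : c ** c = 0 -> sandwich pair_lie (upper c).
Proof.
move=> c0; split; first exact: PairUpper.
  by move=> p; rewrite /upper /= amul0r.
move=> l p [y|y|D1 D2 a1 a2 _ _]; rewrite /upper /= ?amul0r ?sq0_mid //.
by rewrite (additive_map0 a2) amul0r.
Qed.

Lemma sandwich_lower c : c ** c = 0 -> sandwich pair_lie (lower c).
Proof.
move=> c0; split; first exact: PairLower.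
  by move=> p; rewrite /lower /= amul0r.
move=> l p [y|y|D1 D2 a1 a2 _ _]; rewrite /lower /= ?amul0r ?sq0_mid //.
by rewrite (additive_map0 a1) amul0r.
Qed.

Definition mulw (s : seq A) v := foldr amul v s.

(** The action of a word on the diagonal of A + A in which [upper] and [lower]
    alternate is the composition of the multiplications by its letters. *)
Lemma sq0_words (S : seq A) : (forall c, c \in S -> c ** c = 0) ->
  exists M, forall s v, all [in S] s -> (M <= size s)%N -> mulw s v = 0.
Proof.
move=> S0; pose k := size S.
pose act (j : 'I_(k + k)) : AA -> AA :=
  match split j with inl i => upper S`_i | inr i => lower S`_i end.
have [|M HM] := @sandwich_nilpotent _ _ pair_lie_additive pair_lie_commutator _ act.
  by move=> j; rewrite /act; case: split => i;
    [apply: sandwich_upper|apply: sandwich_lower]; apply/S0/mem_nth.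
exists M => s v sS Ms.
have Ew (b : bool) : exists2 w, size w = size s & word_act act w (v, v) =
    if s is [::] then (v, v) else if b then (mulw s v, 0) else (0, mulw s v).
  elim: s sS b {Ms} => [|c s IH] /=; first by exists [::].
  move=> /andP[Sc /IH {}IH] b; have [w sw Ew] := IH (~~ b).
  have ck : (index c S < k)%N by rewrite index_mem.
  case: b Ew => /= Ew.
    exists (lshift k (Ordinal ck) :: w); first by rewrite /= sw.
    rewrite /= Ew /act (unsplitK (inl _)) /upper /= nth_index //.
    by case: (s).
  exists (rshift k (Ordinal ck) :: w); first by rewrite /= sw.
  rewrite /= Ew /act (unsplitK (inr _)) /lower /= nth_index //.
  by case: (s).
have [w1 sw1] := Ew true; rewrite HM ?sw1 //.
by case: (s) => [|c s'] /(congr1 fst) /= <-.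
Qed.

End Sandwich.

Fixpoint leaves_in (S : seq A) (t : tree A) : bool :=
  match t with
  | Leaf x => x \in S
  | Node u v => leaves_in S u && leaves_in S v
  end.

Local Notation ev := (tree_eval id).

(** The operator of a tree t is a linear combination of compositions of
    multiplications by elements c and c ** d with c, d in S, hence of length at
    least half the number of leaves. Such a statement is tested on all additive
    maps X out of A. *)
Lemma tree_words (S S' : seq A) : {subset S <= S'} ->
  (forall c d, c \in S -> d \in S -> c ** d \in S') ->
  forall t (W : zmodType) (X : A -> W) v, leaves_in S t ->
  (forall x y, X (x + y) = X x + X y) ->
  (forall w, all [in S'] w -> (leaves t <= (size w).*2)%N -> X (mulw w v) = 0) ->
  X (ev t ** v) = 0.
Proof.
move=> SS' prod t; have [n] := ubnP (leaves t); elim: n t => // n IH t tn W X v St XD H.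
(* Expand the operator of (ab)q by [triple_mul]; each of its two terms is a
   composition of three operators to which the induction applies. *)
have split (a b q : tree A) : leaves t = (leaves a + leaves b + leaves q)%N ->
    leaves_in S a -> leaves_in S b -> leaves_in S q ->
    X (((ev a ** ev b) ** ev q) ** v) = 0.
  move=> Et Sa Sb Sq.
  have [a0 b0 q0] := And3 (leaves_gt0 a) (leaves_gt0 b) (leaves_gt0 q).
  have X0 : X 0 = 0 by apply: (addIr (X 0)); rewrite -XD !add0r.
  have XN x : X (- x) = - X x by apply/eqP; rewrite -addr_eq0 -XD addNr X0.
  have half (c d : tree A) : (leaves c < n)%N -> (leaves d < n)%N -> leaves_in S c ->
      leaves_in S d -> (leaves t = leaves c + leaves q + leaves d)%N ->
      X (ev c ** (ev q ** (ev d ** v))) = 0.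
    move=> cn dn Sc Sd Ecd.
    apply: (IH c) => // w1 Sw1 cw1; apply: (IH q _ _ (fun x => X (mulw w1 x))) => //.
    - by move: tn; rewrite Et ltnS => /(leq_trans _); apply; lia.
    - move=> x y; rewrite -XD; congr X; elim: (w1) => //= c' w ->.
      by rewrite amulDr.
    move=> w2 Sw2 qw2; apply: (IH d _ _ (fun x => X (mulw w1 (mulw w2 x)))) => //.
      move=> x y; rewrite -XD; congr X; elim: (w1) => /= [|c' w ->]; last first.
        by rewrite amulDr.
      by elim: (w2) => //= c' w ->; rewrite amulDr.
    move=> w3 Sw3 dw3; rewrite /mulw -!foldr_cat; apply: H.
      by rewrite !all_cat Sw1 Sw2.
    by rewrite !size_cat Ecd; lia.
  rewrite -[_ ** v]opprK -triple_mul XN XD !half ?addr0 ?oppr0 //; by move: tn; lia.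
case: t tn St H split => [c|t1 t2] /= tn St H split.
  by apply: (H [:: c]); rewrite //= SS'.
case: t1 tn St H split => [c|a b] tn /= /andP[S1 S2] H split.
  case: t2 tn S2 H split => [d|a b] /= tn S2 H split.
    by apply: (H [:: c ** d]); rewrite //= prod.
  rewrite (mulC c); move: S2 => /andP[Sa Sb]; apply: (split a b (Leaf c)) => //=.
  by rewrite addnC.
by move: S1 => /andP[Sa Sb]; apply: split.
Qed.

Theorem sq0_trees (S : seq A) : (forall c, c \in S -> c ** c = 0) ->
  exists M, forall t, leaves_in S t -> (M <= leaves t)%N -> ev t = 0.
Proof.
move=> S0; pose S' := S ++ [seq c ** d | c <- S, d <- S].
have S'0 c : c \in S' -> c ** c = 0.
  rewrite mem_cat => /orP[/S0 //|/allpairsP[[a b] /= [Sa Sb ->]]].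
  by apply: sq_mul0; apply: S0.
have [M HM] := sq0_words S'0.
exists (4 * M).+2%N => -[x|p q] //= /andP[Sp Sq] sz.
have words (t : tree A) v : leaves_in S t -> (2 * M <= leaves t)%N -> ev t ** v = 0.
  move=> St Mt; apply: (@tree_words S S' _ _ t _ id v) => //.
  - by move=> c Sc; rewrite mem_cat Sc.
  - by move=> c d Sc Sd; rewrite mem_cat allpairs_f ?orbT.
  by move=> w Sw tw; apply: HM => //; lia.
have [pq|qp] := leqP (leaves p) (leaves q); last by apply: words => //; lia.
by rewrite mulC; apply: words => //; lia.
Qed.

Section Generators.
Context (n : nat) (g : 'I_n -> A).
Local Notation gev := (tree_eval g).

Section Chains.
Context (W : lmodType K) (X : A -> W) (N : nat).
Hypotheses (XD : forall x y, X (x + y) = X x + X y)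
  (X_mul : forall u v : tree 'I_n, (1 < leaves u)%N -> (1 < leaves v)%N ->
     (leaves u + leaves v)%N = N -> X (gev u ** gev v) = 0).

Let X0 : X 0 = 0. Proof. by apply: (addIr (X 0)); rewrite -XD !add0r. Qed.
Definition chain (l : seq (tree 'I_n * tree 'I_n)) (y : tree 'I_n) : tree 'I_n :=
  foldr (fun p t => Node p.1 (Node p.2 t)) y l.
Definition chainw (l : seq (tree 'I_n * tree 'I_n)) (y : A) : A :=
  foldr (fun p t => gev p.1 ** (gev p.2 ** t)) y l.

Lemma chain_cat l1 l2 (y : tree 'I_n) : chain (l1 ++ l2) y = chain l1 (chain l2 y).
Proof. exact: foldr_cat. Qed.
Lemma chainwE l (y : tree 'I_n) : gev (chain l y) = chainw l (gev y).
Proof. by elim: l => //= p l ->. Qed.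
Lemma chainwD l x y : chainw l (x + y) = chainw l x + chainw l y.
Proof. by elim: l => //= p l ->; rewrite !amulDr. Qed.
Lemma leaves_chain l (y z : tree 'I_n) : leaves y = leaves z -> leaves (chain l y) = leaves (chain l z).
Proof. by move=> yz; elim: l => //= p l ->. Qed.

(** [triple_mul] applied inside a chain. *)
Lemma chain_swap l (a b c r : tree 'I_n) :
  X (gev (chain l (Node a (Node b (Node c r))))) +
  X (gev (chain l (Node c (Node b (Node a r))))) +
  X (gev (chain l (Node (Node (Node a c) b) r))) = 0.
Proof.
rewrite !chainwE -!XD -!chainwD /= triple_mul addNr.
by rewrite (_ : chainw _ 0 = 0) //; elim: (l) => //= p l' ->; rewrite !amul0r.
Qed.

(** Move the letter a with at least two leaves to the front, where [X_mul] applies.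
    The correction terms of [chain_swap] are shorter chains, which contain the
    decomposable letter (c a) d. *)
Lemma big_chain l1 (a b : tree 'I_n) l2 (v : tree 'I_n) : (1 < leaves a)%N ->
  leaves (chain (l1 ++ (a, b) :: l2) v) = N -> X (gev (chain (l1 ++ (a, b) :: l2) v)) = 0.
Proof.
have [k] := ubnP (size l1 + size l2).
elim: k l1 a b l2 => // k IHk l1; elim/last_ind: l1 => [|l1 [c d] IH] a b l2.
  move=> _ a1 E; apply: (@X_mul a (Node b (chain l2 v))) => //=.
  by rewrite -addn1 leq_add ?leaves_gt0.
rewrite size_rcons cat_rcons addSn ltnS => lk a1.
rewrite !chain_cat /= => E; have := chain_swap l1 c d a (Node b (chain l2 v)).
have sz r : leaves r = (leaves c + (leaves d + (leaves a + (leaves b + leaves (chain l2 v)))))%N ->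
    leaves (chain l1 r) = N by move=> Er; rewrite -E; apply: leaves_chain.
rewrite -[Node a (Node d (Node c _))]/(chain ((a, d) :: (c, b) :: l2) v).
rewrite -[Node (Node (Node c a) d) _]/(chain ((Node (Node c a) d, b) :: l2) v).
rewrite -!chain_cat IH /=; last 3 first.
- by rewrite /= addnS.
- exact: a1.
- by rewrite chain_cat sz //=; lia.
rewrite IHk ?addr0 //=.
- by have := leaves_gt0 c; lia.
by rewrite chain_cat sz //=; lia.
Qed.

(** Up to shorter chains with a decomposable letter, the chain changes sign when
    two of its odd letters are exchanged. Bring the two copies of x next to each
    other. *)
Lemma repeated_chain l1 (x : 'I_n) (b : tree 'I_n) l2 (d : tree 'I_n) l3 (v : tree 'I_n) :
  (1 < leaves v)%N ->
  leaves (chain (l1 ++ (Leaf x, b) :: l2 ++ (Leaf x, d) :: l3) v) = N ->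
  X (gev (chain (l1 ++ (Leaf x, b) :: l2 ++ (Leaf x, d) :: l3) v)) = 0.
Proof.
move=> v1; elim: l2 l1 b => [|[c e] l2 IH] l1 b /=; rewrite chain_cat /= => E.
  have := chain_swap l1 (Leaf x) b (Leaf x) (Node d (chain l3 v)).
  rewrite -[Node (Node _ b) _]/(chain ((Node (Node (Leaf x) (Leaf x)) b, d) :: l3) v).
  rewrite -chain_cat big_chain //; first by rewrite addr0; apply: (@char0_double0 _ charK).
  rewrite -E !chain_cat; apply: leaves_chain => /=; lia.
set R := chain (l2 ++ (Leaf x, d) :: l3) v in E *.
have sz r : leaves r = (1 + (leaves b + (leaves c + (leaves e + leaves R))))%N ->
    leaves (chain l1 r) = N by move=> Er; rewrite -E; apply: leaves_chain.
have := chain_swap l1 (Leaf x) b c (Node e R).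
have := IH (rcons l1 (c, b)) e; rewrite cat_rcons chain_cat /= -/R => ->; last first.
  by apply: sz => /=; lia.
have := @big_chain l1 (Node (Node (Leaf x) c) b) e (l2 ++ (Leaf x, d) :: l3) v.
rewrite chain_cat /= -/R => ->; first by rewrite !addr0.
- by have := leaves_gt0 c; lia.
by apply: sz => /=; lia.
Qed.

Lemma leaves_sorted (t : tree 'I_n) : (1 < leaves t)%N -> exists p q,
  [/\ gev t = gev p ** gev q, leaves t = (leaves p + leaves q)%N & (leaves p <= leaves q)%N].
Proof.
case: t => //= p q _; have [pq|qp] := leqP (leaves p) (leaves q); first by exists p, q.
by exists q, p; rewrite mulC addnC; split=> //; apply: ltnW.
Qed.

(** A tree v with many leaves is p (q1 q2) where q2 has at least a quarter of them.
    Either p is decomposable, or the chain becomes longer; after more than n steps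
    a generator is repeated. *)
Lemma deep_tree k (l : seq ('I_n * tree 'I_n)) (v : tree 'I_n) :
  (n < size l + k)%N -> (2 * 4 ^ k <= leaves v)%N ->
  leaves (chain [seq (Leaf p.1, p.2) | p <- l] v) = N ->
  X (gev (chain [seq (Leaf p.1, p.2) | p <- l] v)) = 0.
Proof.
elim: k l v => [|k IH] l v.
  rewrite addn0 => nl v2; have /repeated_fst[l1 [x [b [l2 [d [l3 ->]]]]]] :
      ~~ uniq [seq p.1 | p <- l].
    apply/negP => /card_uniqP; rewrite size_map => E.
    by have := max_card [in [seq p.1 | p <- l]]; rewrite E card_ord leqNgt nl.
  by rewrite !map_cat /= !map_cat /=; apply: repeated_chain.
rewrite addnS -addSn expnS => nl v8.
have [|p [q [Ev Lv pq]]] := @leaves_sorted v; first by lia.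
have [|q1 [q2 [Eq Lq q12]]] := @leaves_sorted q; first by lia.
set l' := map _ _ => EN.
have EN' : leaves (chain (l' ++ [:: (p, q1)]) q2) = N.
  by rewrite -EN chain_cat; apply: leaves_chain => /=; lia.
have -> : gev (chain l' v) = gev (chain (l' ++ [:: (p, q1)]) q2).
  by rewrite chain_cat !chainwE /= Ev Eq.
have [p1|p1] := ltnP 1 (leaves p); first exact: big_chain.
case: p p1 Ev Lv pq EN' => [x|p1 p2] /=; last first.
  by have := leaves_gt0 p1; have := leaves_gt0 p2; lia.
move=> _ _ Lv pq EN'.
have -> : l' ++ [:: (Leaf x, q1)] = [seq (Leaf p.1, p.2) | p <- rcons l (x, q1)].
  by rewrite map_rcons cats1.
apply: IH; [by rewrite size_rcons|by lia|by rewrite map_rcons -cats1].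
Qed.
End Chains.

Fixpoint vals k : seq A :=
  if k is k'.+1 then [seq g i | i <- enum 'I_n] ++ [seq a ** b | a <- vals k', b <- vals k']
  else [::].

Lemma valsP k (t : tree 'I_n) : (leaves t <= k)%N -> gev t \in vals k.
Proof.
elim: k t => [|k IH] t; first by rewrite leqNgt leaves_gt0.
case: t => [i|u v] /= uv; rewrite mem_cat; first by rewrite map_f ?mem_enum.
have u0 := leaves_gt0 u; have v0 := leaves_gt0 v.
by apply/orP; right; apply: allpairs_f; apply: IH; lia.
Qed.

Let D := (2 * 4 ^ n.+1)%N.
Definition squares := [seq (a + b) ** (a + b) | a <- vals D, b <- vals D]
  ++ [seq a ** a | a <- vals D].

(** A tree with more than D leaves is a combination of products of two trees with at
    least two leaves each; the small ones are polarized squares. *)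
Lemma tree_squares (t : tree 'I_n) (W : lmodType K) (X : A -> W) : (1 < leaves t)%N ->
  (forall x y, X (x + y) = X x + X y) ->
  (forall s, leaves_in squares s -> (leaves t <= D * leaves s)%N -> X (ev s) = 0) ->
  X (gev t) = 0.
Proof.
have [m] := ubnP (leaves t); elim: m t W X => // m IH t W X tm t1 XD H.
have D1 : (1 < D)%N by rewrite /D; have := expn_gt0 4 n.+1; lia.
have [tD|Dt] := leqP (leaves t) D.
  have sq a : a \in squares -> X a = 0.
    by move=> Sa; apply: (H (Leaf a)); rewrite //= muln1.
  case: t tm t1 tD H => //= u v _ _ uv _.
  have u0 := leaves_gt0 u; have v0 := leaves_gt0 v.
  have Su : gev u \in vals D by apply: valsP; lia.
  have Sv : gev v \in vals D by apply: valsP; lia.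
  have Xu : X (gev u ** gev u) = 0.
    by apply: sq; rewrite mem_cat; apply/orP; right; apply: (map_f (fun a => a ** a)).
  have Xv : X (gev v ** gev v) = 0.
    by apply: sq; rewrite mem_cat; apply/orP; right; apply: (map_f (fun a => a ** a)).
  have : X ((gev u + gev v) ** (gev u + gev v)) = 0.
    by apply: sq; rewrite mem_cat; apply/orP; left; apply/allpairsP; exists (gev u, gev v).
  rewrite amulDl !amulDr !XD Xu Xv add0r addr0 (mulC (gev v)); exact: (@char0_double0 _ charK).
apply: (@deep_tree W X (leaves t) XD _ n.+1 [::] t) => //; last exact: ltnW.
move=> u v u1 v1 uv; apply: (IH u W (fun x => X (x ** gev v))) => //.
- by lia.
- by move=> x y; rewrite amulDl XD.
move=> s1 S1 us1; apply: (IH v W (fun x => X (ev s1 ** x))) => //.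
- by lia.
- by move=> x y; rewrite amulDr XD.
move=> s2 S2 vs2; apply: (H (Node s1 s2)); first by rewrite /= S1.
by rewrite -uv /= mulnDr leq_add.
Qed.

Theorem trees_nilpotent : exists M, forall t : tree 'I_n, (M <= leaves t)%N -> gev t = 0.
Proof.
have [|M HM] := @sq0_trees squares.
  move=> c; rewrite mem_cat => /orP[/allpairsP[p [_ _ ->]]|/mapP[a _ ->]]; exact: sq_sq.
exists (D * M).+2%N => t Mt; apply: (@tree_squares t A id) => //; first by lia.
move=> s Ss ts; apply: HM => //.
have D0 : (0 < D)%N by rewrite /D; have := expn_gt0 4 n.+1; lia.
by rewrite -(leq_pmul2l D0); lia.
Qed.
End Generators.
End NilAlgebra.

(** * Free nonassociative algebras, quotient algebras and free Lie algebras *)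

Local Open Scope classical_set_scope.

Section FreegLinear.
Context (K : fieldType) (T : choiceType).
Implicit Types (V W : lmodType K).

Lemma fglift_sum V (f : T -> V) (x : {freeg T / K}) :
  fglift f x = \sum_(z <- dom x) coeff z x *: f z.
Proof.
rewrite -[x in LHS]freeg_sumE (linp_sum (fglift_linear f)).
by apply: eq_bigr => z _; rewrite liftU.
Qed.

Lemma freeg_linear_eq V (f h : {freeg T / K} -> V) : linear f -> linear h ->
  (forall z, f << z >> = h << z >>) -> f =1 h.
Proof.
move=> fl hl fh x; rewrite -[x]freeg_sumE (linp_sum fl) (linp_sum hl).
apply: eq_bigr => z _; rewrite (_ : << _ *g _ >> = coeff z x *: << z >>).
  by rewrite (linpZ fl) (linpZ hl) fh.
by apply/eqP/freeg_eqP => y; rewrite coeffZ !coeffU mul1r.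
Qed.

Lemma fglift_fun_linear V W (f : V -> T -> W) x : (forall z, linear (f^~ z)) ->
  linear (fun v => fglift (f v) x).
Proof.
move=> fl k u v; rewrite !fglift_sum scaler_sumr -big_split; apply: eq_bigr => z _ /=.
by rewrite fl scalerDr !scalerA mulrC.
Qed.
End FreegLinear.

HB.instance Definition _ (T : Type) := gen_eqMixin (tree T).
HB.instance Definition _ (T : Type) := gen_choiceMixin (tree T).

Definition free_magma_algebra (K : fieldType) (T : Type) := {freeg (tree T) / K}.

Section FreeMagmaAlgebra.
Context (K : fieldType) (T : Type).
Local Notation C := (free_magma_algebra K T).
HB.instance Definition _ := GRing.Lmodule.on C.

Definition tree_elt (t : tree T) : C := << t >>.

Definition tree_mul (x y : C) : C :=
  fglift (fun u => fglift (fun v => tree_elt (Node u v)) y) x.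

Fact tree_mul_linearl y : linear (tree_mul^~ y).
Proof. exact: fglift_linear. Qed.
Fact tree_mul_linearr x : linear (tree_mul x).
Proof. by apply: fglift_fun_linear => z; apply: fglift_linear. Qed.
HB.instance Definition _ := Lmodule_isNonAssoc.Build K C tree_mul_linearl tree_mul_linearr.

Lemma tree_eltM u v : tree_elt u ** tree_elt v = tree_elt (Node u v).
Proof. by rewrite /amul /= /tree_mul !liftU !scale1r. Qed.

Context (A : nonAssocAlgType K) (g : T -> A).
Definition tree_lift : C -> A := fglift (tree_eval g).

Lemma tree_lift_linear : linear tree_lift. Proof. exact: fglift_linear. Qed.
Lemma tree_liftE t : tree_lift (tree_elt t) = tree_eval g t.
Proof. by rewrite /tree_lift liftU scale1r. Qed.

Lemma bilinear_tree_eq (V : lmodType K) (f h : C -> C -> V) :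
  (forall y, linear (f^~ y)) -> (forall x, linear (f x)) ->
  (forall y, linear (h^~ y)) -> (forall x, linear (h x)) ->
  (forall u v, f (tree_elt u) (tree_elt v) = h (tree_elt u) (tree_elt v)) ->
  forall x y, f x y = h x y.
Proof.
move=> fl fr hl hr fh x y; apply: (freeg_linear_eq (fl y) (hl y)) => u.
by apply: (freeg_linear_eq (fr _) (hr _)) => v; apply: fh.
Qed.

Lemma tree_lift_hom : alg_hom tree_lift.
Proof.
split; first exact: tree_lift_linear.
have L := tree_lift_linear.
apply: bilinear_tree_eq => [y k a b|x k a b|y k a b|x k a b|u v].
- by rewrite amul_linearl L.
- by rewrite amul_linearr L.
- by rewrite L amul_linearl.
- by rewrite L amul_linearr.
by rewrite tree_eltM !tree_liftE.
Qed.

Lemma tree_lift_unique (f : C -> A) : alg_hom f ->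
  (forall i, f (tree_elt (Leaf i)) = g i) -> f =1 tree_lift.
Proof.
move=> [fl fM] fg; apply: freeg_linear_eq => //; first exact: tree_lift_linear.
move=> t; rewrite -[<< t >>]/(tree_elt t) tree_liftE.
by elim: t => [i|u IHu v IHv] //=; rewrite -tree_eltM fM IHu IHv.
Qed.
End FreeMagmaAlgebra.

Section Ideals.
Context (K : fieldType) (A : nonAssocAlgType K).

Lemma ideal_gen_ideal (S : set A) : is_ideal (ideal_gen S).
Proof.
split; first split.
- by move=> U [[[U0 _] _] _].
- move=> k x y Sx Sy U US; have [[[_ UD] _] _] := US; apply: UD; [exact: Sx|exact: Sy].
by move=> x y Sy; split=> U US; have [[_ UM] _] := US; have [] := UM x y (Sy U US).
Qed.

Lemma ideal_gen_sub (S : set A) : S `<=` ideal_gen S.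
Proof. by move=> x Sx U [_ SU]; apply: SU. Qed.

Lemma ideal_gen_min (S I : set A) : is_ideal I -> S `<=` I -> ideal_gen S `<=` I.
Proof. by move=> II SI x; apply. Qed.

Lemma kernel_ideal (B : nonAssocAlgType K) (f : A -> B) : alg_hom f ->
  is_ideal [set x | f x = 0].
Proof.
move=> [fl fM]; split; first split=> [|k x y /= fx fy]; first exact: linp0.
  by rewrite fl fx fy scaler0 addr0.
by move=> x y /= fy; rewrite !fM fy amul0r amul0l.
Qed.

Lemma span_ideal (I : set A) x : is_ideal I -> Defs.span I x -> I x.
Proof. by move=> [II _] H; apply: (H I); split. Qed.
End Ideals.

(** The type depends on the proof that I is an ideal, from which it gets its
    product. *)
Definition quotient_algebra (K : fieldType) (A : nonAssocAlgType K) (I : set A)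
  (_ : is_ideal I) := vquot I.

Section QuotientAlgebra.
Context (K : fieldType) (A : nonAssocAlgType K) (I : set A) (idI : is_ideal I).
Local Notation Q := (quotient_algebra idI).
HB.instance Definition _ := GRing.Lmodule.on Q.

Definition qpi (x : A) : Q := vpi I x.
Lemma qpi_linear : linear qpi. Proof. exact: vpi_linear. Qed.
Lemma qpi_surj (q : Q) : exists x, qpi x = q.
Proof. by exists (vrepr q); apply: vreprK. Qed.
Lemma qpi_eq0 x : qpi x = 0 <-> I x.
Proof.
rewrite -(linp0 qpi_linear) /qpi vpi_eq subr0; split; first exact: span_ideal.
by move=> Ix; apply: sub_gen_smallest.
Qed.
Lemma qpi_eq x y : qpi x = qpi y <-> I (x - y).
Proof.
rewrite -qpi_eq0 (linpB qpi_linear); split=> [->|/eqP]; first by rewrite subrr.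
by rewrite subr_eq0 => /eqP.
Qed.

Definition qmul (p q : Q) : Q := qpi (vrepr (p : vquot I) ** vrepr (q : vquot I)).

Lemma qmul_pi x y : qmul (qpi x) (qpi y) = qpi (x ** y).
Proof.
apply/qpi_eq; have [[I0 ID] IM] := idI.
have repr_pi z : I (vrepr (qpi z : vquot I) - z).
  by apply/qpi_eq; apply: vreprK.
set x' := vrepr _; set y' := vrepr _.
rewrite (_ : _ - _ = 1 *: ((x' - x) ** y') + x ** (y' - y)).
  by apply: ID; [have [] := IM y' _ (repr_pi x)|have [] := IM x _ (repr_pi y)].
by rewrite scale1r amulDl amulNl amulDr amulNr; abel.
Qed.

Fact qmul_linearl q : linear (qmul^~ q).
Proof.
move=> k p p'; have [x <-] := qpi_surj p; have [y <-] := qpi_surj p'.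
have [z <-] := qpi_surj q; rewrite -qpi_linear !qmul_pi amul_linearl.
exact: qpi_linear.
Qed.
Fact qmul_linearr p : linear (qmul p).
Proof.
move=> k q q'; have [x <-] := qpi_surj q; have [y <-] := qpi_surj q'.
have [z <-] := qpi_surj p; rewrite -qpi_linear !qmul_pi amul_linearr.
exact: qpi_linear.
Qed.
HB.instance Definition _ := Lmodule_isNonAssoc.Build K Q qmul_linearl qmul_linearr.

Lemma qpiM x y : qpi (x ** y) = qpi x ** qpi y.
Proof. by rewrite -qmul_pi. Qed.
Lemma qpi_hom : alg_hom qpi.
Proof. by split; [exact: qpi_linear|exact: qpiM]. Qed.

Section Lift.
Context (B : nonAssocAlgType K) (f : A -> B) (fh : alg_hom f)
  (fI : forall x, I x -> f x = 0).
Definition qlift (q : Q) : B := vlift f (q : vquot I).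
Lemma qlift_pi x : qlift (qpi x) = f x.
Proof. by apply: vlift_pi => //; case: fh. Qed.
Lemma qlift_hom : alg_hom qlift.
Proof.
split; first by apply: vlift_linear => //; case: fh.
move=> p q; have [x <-] := qpi_surj p; have [y <-] := qpi_surj q.
by rewrite -qpiM !qlift_pi (proj2 fh).
Qed.
End Lift.
End QuotientAlgebra.

Definition lie_laws (K : fieldType) (A : nonAssocAlgType K) :=
  (forall x : A, x ** x = 0) /\
  (forall x y z : A, x ** (y ** z) + y ** (z ** x) + z ** (x ** y) = 0).

Definition lie_of (K : fieldType) (A : nonAssocAlgType K) (_ : lie_laws A) : Type := A.
Section LieOf.
Context (K : fieldType) (A : nonAssocAlgType K) (H : lie_laws A).
HB.instance Definition _ := NonAssoc.on (lie_of H).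
HB.instance Definition _ := NonAssoc_isLie.Build K (lie_of H) (proj1 H) (proj2 H).
End LieOf.

Section FreeLie.
Context (K : fieldType) (n : nat).
Local Notation C := (free_magma_algebra K 'I_n).

Definition lie_relators : set C := [set w |
  (exists x, w = x ** x) \/
  (exists x y z, w = x ** (y ** z) + y ** (z ** x) + z ** (x ** y))].

Definition free_lie_ideal := ideal_gen_ideal lie_relators.

Lemma free_lie_laws : lie_laws (quotient_algebra free_lie_ideal).
Proof.
split=> [p|p q r].
  have [x <-] := qpi_surj p; rewrite -qpiM; apply/qpi_eq0.
  by apply: ideal_gen_sub; left; exists x.
have [x <-] := qpi_surj p; have [y <-] := qpi_surj q; have [z <-] := qpi_surj r.
have M := qpiM free_lie_ideal.
rewrite -(M y z) -(M z x) -(M x y) -3!M -!(linpD (@qpi_linear _ _ _ _)); apply/qpi_eq0.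
by apply: ideal_gen_sub; right; exists x, y, z.
Qed.

Definition free_lie_algebra : lieAlgType K := lie_of free_lie_laws.
Definition free_lie_gen (i : 'I_n) : free_lie_algebra :=
  qpi free_lie_ideal (tree_elt K (Leaf i)).

Lemma free_lieP : free_lie free_lie_gen.
Proof.
move=> L l; have h := tree_lift_hom l.
have kill x : ideal_gen lie_relators x -> tree_lift l x = 0.
  apply: (ideal_gen_min (kernel_ideal h)) => w; have [hl hM] := h.
  case=> [[y ->]|[y [z [t ->]]]] /=; first by rewrite hM lie_alt.
  by rewrite !(linpD hl) !hM lie_jacobi.
exists (qlift (idI := free_lie_ideal) (tree_lift l) : free_lie_algebra -> L); split.
  split; first exact: (qlift_hom free_lie_ideal h kill).
  by move=> i; rewrite /free_lie_gen (qlift_pi free_lie_ideal h kill) tree_liftE.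
move=> f [fh fg]; apply/funext => q.
have [x <-] := qpi_surj (q : quotient_algebra free_lie_ideal).
rewrite (qlift_pi free_lie_ideal h kill); apply/esym.
apply: (tree_lift_unique (f := fun x => f (qpi free_lie_ideal x))) => //.
split=> [k a b|a b]; first by rewrite qpi_linear; apply: (proj1 fh).
by rewrite qpiM; apply: (proj2 fh).
Qed.
End FreeLie.

(** * The ideal of nil relations *)

Section FreeNil.
Context (K : fieldType) (charK : [pchar K] =i pred0) (n : nat).
Local Notation C := (free_magma_algebra K 'I_n).
Local Notation te := (@tree_elt K 'I_n).

Inductive nil_relators : set C :=
| NilComm u v : nil_relators (te (Node u v) - te (Node v u))
| NilLeft a b c z : nil_relators (te (Node (Node a b) (Node c z))
    + te (Node (Node b c) (Node a z)) + te (Node (Node c a) (Node b z)))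
| NilRight a b c z : nil_relators (te (Node c (Node (Node a b) z))
    + te (Node a (Node (Node b c) z)) + te (Node b (Node (Node c a) z))).

Definition nil_ideal := ideal_gen_ideal nil_relators.
Local Notation Q := (quotient_algebra nil_ideal).

Lemma quadrilinear_eq0 (F : C -> C -> C -> C -> Q) :
  (forall b c z, linear (fun a => F a b c z)) ->
  (forall a c z, linear (fun b => F a b c z)) ->
  (forall a b z, linear (fun c => F a b c z)) ->
  (forall a b c, linear (F a b c)) ->
  (forall a b c z, F (te a) (te b) (te c) (te z) = 0) -> forall a b c z, F a b c z = 0.
Proof.
move=> Fa Fb Fc Fz F0 a b c z.
have lin0 : linear (fun _ : C => 0 : Q) by move=> k u v; rewrite scaler0 addr0.
apply: (freeg_linear_eq (Fa b c z) lin0) => {}a.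
apply: (freeg_linear_eq (Fb _ c z) lin0) => {}b.
apply: (freeg_linear_eq (Fc _ _ z) lin0) => {}c.
by apply: (freeg_linear_eq (Fz _ _ _) lin0) => {}z; apply: F0.
Qed.

Lemma nil_quotient_laws :
  [/\ forall p q : Q, p ** q = q ** p,
      forall a b c x : Q,
        (a ** b) ** (c ** x) + (b ** c) ** (a ** x) + (c ** a) ** (b ** x) = 0
    & forall a b c x : Q,
        c ** ((a ** b) ** x) + a ** ((b ** c) ** x) + b ** ((c ** a) ** x) = 0].
Proof.
have [piL piM] := qpi_hom nil_ideal.
have piD := linpD piL; have piB := linpB piL.
have lin (f : C -> C) : linear f -> linear (fun x => qpi nil_ideal (f x)).
  by move=> fl k u v; rewrite fl piL.
split.
- move=> p q; have [x <-] := qpi_surj p; have [y <-] := qpi_surj q.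
  rewrite -!piM; apply: (@bilinear_tree_eq K 'I_n Q (fun x y => qpi _ (x ** y))
    (fun x y => qpi _ (y ** x))) => [z|z|z|z|u v].
  + exact: lin (amul_linearl z).
  + exact: lin (amul_linearr z).
  + exact: lin (amul_linearr z).
  + exact: lin (amul_linearl z).
  apply/qpi_eq; rewrite !tree_eltM; apply: ideal_gen_sub; exact: NilComm.
- move=> p q r s; have [a <-] := qpi_surj p; have [b <-] := qpi_surj q.
  have [c <-] := qpi_surj r; have [z <-] := qpi_surj s.
  rewrite -!(piM a) -!(piM b) -!(piM c) -!piM -!piD.
  apply: (quadrilinear_eq0 (F := fun a b c z => qpi nil_ideal
    ((a ** b) ** (c ** z) + (b ** c) ** (a ** z) + (c ** a) ** (b ** z)))).
  1-4: by move=> x1 x2 x3; apply: lin => k u v;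
    rewrite !(amul_linearl, amul_linearr) !scalerDr; abel.
  move=> {}a {}b {}c {}z; apply/qpi_eq0; rewrite !tree_eltM.
  by apply: ideal_gen_sub; apply: NilLeft.
move=> p q r s; have [a <-] := qpi_surj p; have [b <-] := qpi_surj q.
have [c <-] := qpi_surj r; have [z <-] := qpi_surj s.
rewrite -(piM a b) -(piM b c) -(piM c a) -(piM (a ** b)) -(piM (b ** c)) -(piM (c ** a)).
rewrite -3!piM -!piD.
apply: (quadrilinear_eq0 (F := fun a b c z => qpi nil_ideal
  (c ** ((a ** b) ** z) + a ** ((b ** c) ** z) + b ** ((c ** a) ** z)))).
1-4: by move=> x1 x2 x3; apply: lin => k u v;
  rewrite !(amul_linearl, amul_linearr) !scalerDr; abel.
move=> {}a {}b {}c {}z; apply/qpi_eq0; rewrite !tree_eltM.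
by apply: ideal_gen_sub; apply: NilRight.
Qed.

(** The bound is uniform as it is that of the free nil algebra. *)
Lemma nil_ideal_trees : exists M, forall t : tree 'I_n, (M <= leaves t)%N ->
  ideal_gen nil_relators (te t).
Proof.
have [mC n1 n2] := nil_quotient_laws.
have [M HM] := trees_nilpotent charK mC n1 n2 (fun i => qpi nil_ideal (te (Leaf i))).
exists M => t /HM E; apply/(qpi_eq0 nil_ideal); rewrite -[RHS]E.
elim: t {E} => //= u <- v <-; by rewrite -tree_eltM qpiM.
Qed.
End FreeNil.

(** * Vectors of weight 2 in a Lie algebra with an sl_2-triple *)

Section LieLemmas.
Context (K : fieldType) (L : lieAlgType K).
Implicit Types x y z : L.
Lemma lieC x y : x ** y = - (y ** x). Proof. exact: lie_anticomm. Qed.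
Lemma lie_derl x y z : x ** (y ** z) = (x ** y) ** z + y ** (x ** z).
Proof.
have := lie_jacobi x y z; rewrite (lieC z (x ** y)) (lieC z x) amulNr => /eqP.
by rewrite -addrA -opprD subr_eq0 => /eqP ->; rewrite addrC.
Qed.
Lemma lie_derr x y z : (y ** z) ** x = (y ** x) ** z + y ** (z ** x).
Proof. by rewrite (lieC _ x) lie_derl (lieC y x) (lieC z x) amulNl amulNr opprD. Qed.
End LieLemmas.

Section Weight2.
Context (K : fieldType) (charK : [pchar K] =i pred0) (L : lieAlgType K) (e f h : L).
Hypotheses (he : h ** e = 2 *: e) (hf : h ** f = - 2 *: f) (ef : e ** f = h).

Lemma nat_unit k : (k.+1%:R : K) != 0.
Proof. by rewrite ((pcharf0P K).1 charK). Qed.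

Lemma natZ_inj k (x y : L) : k.+1%:R *: x = k.+1%:R *: y -> x = y.
Proof.
move=> H; apply/eqP; rewrite -subr_eq0; apply/eqP.
have/eqP : k.+1%:R *: (x - y) = 0 by rewrite scalerBr H subrr.
by rewrite scaler_eq0 (negPf (nat_unit k)) => /eqP.
Qed.

(** For a of weight 2, [low0 a] and [low2 a] are the elements h(a) and f(a) of the
    copy of sl_2 with highest weight vector a, and [jprod a b] is the Jordan
    product. *)
Definition low0 a := locked (a ** f).
Definition low2 a := locked (- (2^-1 *: low0 (low0 a))).
Definition jprod a b := locked (2^-1 *: (low0 a ** b)).

Definition weight2 a := [/\ h ** a = 2 *: a, e ** a = 0 & low0 (low2 a) = 0].

Lemma low0E a : low0 a = a ** f. Proof. by rewrite /low0 -lock. Qed.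
Lemma low2E a : low2 a = - (2^-1 *: low0 (low0 a)). Proof. by rewrite /low2 -lock. Qed.
Lemma jprodE a b : jprod a b = 2^-1 *: (low0 a ** b). Proof. by rewrite /jprod -lock. Qed.
Lemma low0_linear : linear low0.
Proof. by move=> k a b; rewrite !low0E amul_linearl. Qed.
Definition low0D := linpD low0_linear.
Definition low0B := linpB low0_linear.
Definition low0N := linpN low0_linear.
Definition low0Z := linpZ low0_linear.
Definition low00 := linp0 low0_linear.
Lemma low0M a b : low0 (a ** b) = low0 a ** b + a ** low0 b.
Proof. by rewrite !low0E; apply: lie_derr. Qed.

Lemma low2_linear : linear low2.
Proof.
by move=> k a b; rewrite !low2E !low0_linear scalerDr opprD scalerN !scalerA mulrC.
Qed.
Lemma jprod_linearl b : linear (jprod^~ b).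
Proof.
by move=> k a a'; rewrite !jprodE low0_linear amul_linearl scalerDr !scalerA mulrC.
Qed.
Lemma jprod_linearr a : linear (jprod a).
Proof. by move=> k b b'; rewrite !jprodE amul_linearr scalerDr !scalerA mulrC. Qed.

Lemma half2 (W : lmodType K) (w : W) : 2 *: (2^-1 *: w) = w.
Proof. by rewrite scalerA divff ?scale1r ?nat_unit. Qed.
Lemma half2V (W : lmodType K) (w : W) : 2^-1 *: (2 *: w) = w.
Proof. by rewrite scalerA mulVf ?scale1r ?nat_unit. Qed.
Lemma scale2 (W : lmodType K) (w : W) : 2 *: w = w + w.
Proof. by rewrite -[2]/(1 + 1) scalerDl !scale1r. Qed.

Lemma low0_low0E a : low0 (low0 a) = - (2 *: low2 a).
Proof. by rewrite low2E scalerN opprK half2. Qed.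
Lemma low0_mul a b : low0 a ** b = 2 *: jprod a b.
Proof. by rewrite jprodE half2. Qed.

Lemma weight2_sub : is_subspace weight2.
Proof.
split.
  split; first by rewrite amul0r scaler0.
    exact: amul0r.
  by rewrite (linp0 low2_linear) low00.
move=> k a b [a1 a2 a3] [b1 b2 b3]; split.
- by rewrite amul_linearr a1 b1 scalerDr !scalerA mulrC.
- by rewrite amul_linearr a2 b2 scaler0 addr0.
by rewrite low2_linear low0_linear a3 b3 scaler0 addr0.
Qed.

Lemma low0_e : low0 e = h. Proof. by rewrite low0E. Qed.
Lemma low2_e : low2 e = f.
Proof.
by rewrite low2E low0_e low0E hf -scaleNr scalerA mulrNN mulVf ?scale1r ?nat_unit.
Qed.
Lemma weight2_e : weight2 e.
Proof. by split; rewrite ?low2_e ?low0E ?lie_alt. Qed.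
Lemma jprod_e a : weight2 a -> jprod e a = a.
Proof. by case=> ha _ _; rewrite jprodE low0_e ha half2V. Qed.

Section Pair.
Context (a b : L).
Hypotheses (wa : weight2 a) (wb : weight2 b) (ab0 : a ** b = 0).

(** The identities of [low0_swap], [low0_low0], [low0_low2_swap] and [low2_low2] are
    obtained from a ** b = 0 by applying the derivation [low0] from one to four
    times. *)
Lemma low0_swap : low0 a ** b = low0 b ** a.
Proof.
have : low0 (a ** b) = 0 by rewrite ab0 low00.
by rewrite low0M => /eqP; rewrite addr_eq0 => /eqP ->; rewrite -lieC.
Qed.

Lemma jprodC : jprod a b = jprod b a.
Proof. by rewrite !jprodE low0_swap. Qed.

Lemma low0_low0 : low0 a ** low0 b = a ** low2 b + low2 a ** b.
Proof.
have : low0 (low0 a ** b - low0 b ** a) = 0 by rewrite low0_swap subrr low00.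
rewrite low0B !low0M !low0_low0E !amulNl !amulZl.
rewrite (lieC (low0 b) (low0 a)) (lieC (low2 b) a) scalerN opprK => H.
apply: (@natZ_inj 1); apply/eqP; rewrite -subr_eq0 -[X in _ == X]H !scale2; by apply/eqP; abel.
Qed.

Lemma low0_low2_swap : low0 a ** low2 b = low0 b ** low2 a.
Proof.
have : low0 (low0 a ** low0 b - (a ** low2 b + low2 a ** b)) = 0.
  by rewrite low0_low0 subrr low00.
have [_ _ fa] := wa; have [_ _ fb] := wb.
rewrite low0B low0D !low0M !low0_low0E fa fb.
rewrite amul0r amul0l !amulNl !amulNr !amulZl !amulZr (lieC (low2 a)) => H.
apply: (@natZ_inj 2); apply/eqP; rewrite -subr_eq0 -oppr_eq0 -[X in _ == X]H.
by rewrite -[2.+1%:R]/(1 + (1 + 1)) !scalerDl !scale1r ?scale2; apply/eqP; abel.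
Qed.

Lemma low0_jprod : 2 *: low0 (jprod a b) = a ** low2 b - low2 a ** b.
Proof.
rewrite jprodE -low0Z half2 low0M low0_low0E amulNl amulZl.
by rewrite low0_low0 scale2; abel.
Qed.

Lemma low2_jprod : low0 a ** low2 b = - (2 *: low2 (jprod a b)).
Proof.
have [_ _ fa] := wa; have [_ _ fb] := wb.
rewrite -low0_low0E; apply: (@natZ_inj 1); rewrite -low0Z low0_jprod.
rewrite low0B !low0M fa fb amul0r amul0l.
by rewrite (lieC (low2 a)) -low0_low2_swap scale2; abel.
Qed.

Lemma mul_low2 : a ** low2 b = low0 (jprod a b) + 2^-1 *: (low0 a ** low0 b).
Proof.
apply: (@natZ_inj 1); rewrite scalerDr half2 low0_jprod low0_low0 scale2; abel.
Qed.

Lemma low2_low2 : low2 a ** low2 b = 0.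
Proof.
have [_ _ fa] := wa; have [_ _ fb] := wb.
have : low0 (low0 a ** low2 b - low0 b ** low2 a) = 0.
  by rewrite low0_low2_swap subrr low00.
rewrite low0B !low0M fa fb !amul0r !addr0 !low0_low0E !amulNl !amulZl.
rewrite (lieC (low2 b)) scalerN opprK => H.
apply: (@natZ_inj 3); rewrite scaler0 -[RHS]oppr0 -[in RHS]H.
by rewrite (natrD _ 2 2) scalerDl; abel.
Qed.

Lemma weight2_jprod : weight2 (jprod a b).
Proof.
have [ha ea fa] := wa; have [hb eb fb] := wb; split.
- rewrite jprodE amulZr lie_derl hb low0E (lie_derl h a f) ha hf amulZl amulZr scaleNr subrr.
  by rewrite amul0l add0r amulZr !scalerA mulrC.
- rewrite jprodE amulZr lie_derl eb amul0r addr0 low0E (lie_derl e a f) ea amul0l add0r ef.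
  by rewrite (lieC a h) ha amulNl amulZl ab0 scaler0 oppr0 scaler0.
apply: (@natZ_inj 1); rewrite scaler0 -low0Z -[2 *: _]opprK -low2_jprod low0N low0M.
by rewrite fb amul0r addr0 low0_low0E amulNl amulZl low2_low2 scaler0 !oppr0.
Qed.
End Pair.

(** Both sides come from the part symmetric in a and b of the bracket of [low0 c]
    with a ** low2 b, which is computed by [mul_low2] before or after applying the
    derivation [low0 c]. *)
Lemma low0_low0_jprod a b c : weight2 a -> weight2 b -> weight2 c ->
  a ** b = 0 -> c ** a = 0 -> c ** b = 0 -> jprod c a ** b = 0 -> jprod c b ** a = 0 ->
  low0 c ** low0 (jprod a b) = low0 (jprod c a) ** low0 b + low0 (jprod c b) ** low0 a.
Proof.
move=> wa wb wc ab ca cb cab cba.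
have ba : b ** a = 0 by rewrite lieC ab oppr0.
have E a' b' : weight2 a' -> weight2 b' -> a' ** b' = 0 -> c ** a' = 0 ->
    c ** b' = 0 -> jprod c a' ** b' = 0 -> jprod c b' ** a' = 0 ->
    low0 c ** low0 (jprod a' b') + 2^-1 *: (low0 c ** (low0 a' ** low0 b')) =
    2 *: low0 (jprod (jprod c a') b') + low0 (jprod c a') ** low0 b'
    - 2 *: low0 (jprod a' (jprod c b')) - low0 a' ** low0 (jprod c b').
  move=> wa' wb' ab' ca' cb' cab' cba'.
  have wca := weight2_jprod wc wa' ca'; have wcb := weight2_jprod wc wb' cb'.
  have acb : a' ** jprod c b' = 0 by rewrite lieC cba' oppr0.
  rewrite -amulZr -amulDr -mul_low2 // lie_derl low0_mul low2_jprod //.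
  rewrite amulZl amulNr amulZr !mul_low2 // !scalerDr !half2; abel.
have := E a b wa wb ab ca cb cab cba; have := E b a wb wa ba cb ca cba cab.
rewrite (jprodC ba) (jprodC cba).
rewrite (jprodC cab) (lieC (low0 b) (low0 a)) amulNr scalerN.
rewrite (lieC (low0 b)) (lieC (low0 a) (low0 (jprod c b))) => E1 E2.
apply: (@natZ_inj 1); apply/eqP; rewrite -subr_eq0.
have F : (0 : L) = 0 - 0 - (0 - 0) by rewrite !subrr.
move/eqP: E1; rewrite -subr_eq0 => /eqP E1; move/eqP: E2; rewrite -subr_eq0 => /eqP E2.
rewrite -[X in _ == X]addr0 -{1}E1 -E2 !(scale2 (low0 c ** _)) (scale2 (_ + _)).
by apply/eqP; abel.
Qed.

(** By [low0_low0_jprod] the sum of the brackets of [low0 (jprod a b)] and [low0 c]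
    over the cyclic permutations of a, b, c vanishes; apply it to x. *)
Lemma jordan_cyclic a b c x : weight2 a -> weight2 b -> weight2 c ->
  a ** b = 0 -> c ** a = 0 -> b ** c = 0 ->
  jprod a b ** c = 0 -> jprod b c ** a = 0 -> jprod c a ** b = 0 ->
  jprod (jprod a b) (jprod c x) + jprod (jprod b c) (jprod a x) + jprod (jprod c a) (jprod b x) =
  jprod c (jprod (jprod a b) x) + jprod a (jprod (jprod b c) x) + jprod b (jprod (jprod c a) x).
Proof.
move=> wa wb wc ab ca bc abc bca cab.
have cb : c ** b = 0 by rewrite lieC bc oppr0.
have H := low0_low0_jprod wa wb wc ab ca cb cab.
rewrite (jprodC cb) in H; have {}H := H bca.
have := congr1 (fun y => y ** x) H; rewrite amulDl.
rewrite (lieC (low0 c)) => H1.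
have der u v : (low0 u ** low0 v) ** x = 4 *: (jprod u (jprod v x) - jprod v (jprod u x)).
  have -> : (low0 u ** low0 v) ** x = low0 u ** (low0 v ** x) - low0 v ** (low0 u ** x).
    by rewrite (lie_derl (low0 u)); abel.
  by rewrite !low0_mul !(linpZ (jprod_linearr _)) !scalerA -natrM scalerBr.
move: H1; rewrite amulNl !der -!scalerDr -scalerN => /(@natZ_inj 3 _ _) /eqP.
rewrite -subr_eq0 => /eqP E; apply/eqP; rewrite -subr_eq0 -oppr_eq0 -[X in _ == X]E.
by apply/eqP; abel.
Qed.

(** The derivation [low0 c] applied to a ** b = 0. *)
Lemma low0_skew a b c : a ** b = 0 -> jprod c a ** b + a ** jprod c b = 0.
Proof.
move=> ab; apply: (@natZ_inj 1); rewrite scaler0 scalerDr -amulZl -amulZr -!low0_mul.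
by rewrite -lie_derl ab amul0r.
Qed.

Section Trees.
Context (n : nat) (x : 'I_n -> L).
Hypothesis (wx : forall i, weight2 (x i)).

Fixpoint jtree (t : tree 'I_n) : L :=
  match t with
  | Leaf i => x i
  | Node u v => jprod (jtree u) (jtree v)
  end.

Section Degree.
Context (d : nat).
Hypothesis (low : forall u v, (leaves u + leaves v < d)%N -> jtree u ** jtree v = 0).

Lemma jtree_weight2 u : (leaves u < d)%N -> weight2 (jtree u).
Proof.
elim: u => //= u IHu v IHv uv; apply: weight2_jprod; last exact: low.
  by apply: IHu; lia.
by apply: IHv; lia.
Qed.

Lemma jtreeC u v : (leaves u + leaves v < d)%N -> jtree (Node u v) = jtree (Node v u).
Proof.
by move=> uv; apply: jprodC; apply: low.
Qed.

Lemma jtree_skew u v w : (leaves u + leaves v + leaves w = d)%N ->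
  jtree (Node w u) ** jtree v = - (jtree u ** jtree (Node w v)).
Proof.
move=> uv; apply/eqP; rewrite -addr_eq0; apply/eqP; apply: low0_skew; apply: low.
by have := leaves_gt0 w; lia.
Qed.

Definition form5 (a b c z y : tree 'I_n) := jtree (Node (Node a b) (Node c z)) ** jtree y.
(** By [form5_swap] and [form5_flip], [form5 a b c z y] depends only on y and on the
    perfect matching ab|cz of the other four trees; the sum is over the three
    perfect matchings. *)
Definition matchings (a b c z y : tree 'I_n) := form5 a b c z y + form5 b c a z y + form5 c a b z y.

Lemma form5_swap (a b c z y : tree 'I_n) : (leaves a + leaves b + leaves c + leaves z + leaves y = d)%N ->
  form5 a b c z y = form5 b a c z y.
Proof.
by move=> E; rewrite /form5 /= -[jprod (jtree a) _]/(jtree (Node a b)) jtreeC //;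
  have := leaves_gt0 y; have := leaves_gt0 c; lia.
Qed.

Lemma form5_flip (a b c z y : tree 'I_n) : (leaves a + leaves b + leaves c + leaves z + leaves y = d)%N ->
  form5 a b c z y = form5 c z a b y.
Proof. by move=> E; rewrite /form5 jtreeC //=; have := leaves_gt0 y; lia. Qed.

Lemma form5_swap2 (a b c z y : tree 'I_n) : (leaves a + leaves b + leaves c + leaves z + leaves y = d)%N ->
  form5 a b c z y = form5 a b z c y.
Proof.
move=> E; rewrite form5_flip // form5_swap; last by lia.
by rewrite form5_flip //; lia.
Qed.

Lemma matchings_jordan (a b c z y : tree 'I_n) :
  (leaves a + leaves b + leaves c + leaves z + leaves y = d)%N ->
  matchings a b c z y =
  jtree (Node c (Node (Node a b) z)) ** jtree y +
  jtree (Node a (Node (Node b c) z)) ** jtree y +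
  jtree (Node b (Node (Node c a) z)) ** jtree y.
Proof.
move=> E; have y0 := leaves_gt0 y; have z0 := leaves_gt0 z.
rewrite /matchings /form5 -!amulDl; congr (_ ** _); apply: jordan_cyclic.
- by apply: jtree_weight2; lia.
- by apply: jtree_weight2; lia.
- by apply: jtree_weight2; lia.
- by apply: low; lia.
- by apply: low; lia.
- by apply: low; lia.
- by apply: (low (u := Node a b)) => /=; lia.
- by apply: (low (u := Node b c)) => /=; lia.
by apply: (low (u := Node c a)) => /=; lia.
Qed.

(** By the Jordan identity the sum is that of the brackets of c((ab)z) with y, and
    skewness moves c and then ab to the other side. *)
Lemma matchings_anti (a b c z y : tree 'I_n) :
  (leaves a + leaves b + leaves c + leaves z + leaves y = d)%N ->
  matchings a b c z y = - matchings a b c y z.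
Proof.
move=> E; rewrite matchings_jordan //.
have move_out u v w : (leaves u + leaves v + leaves w + leaves z + leaves y = d)%N ->
    jtree (Node w (Node (Node u v) z)) ** jtree y = - form5 u v w y z.
  move=> Eu; rewrite jtree_skew; last by rewrite /=; lia.
  rewrite jtree_skew; last by rewrite /=; lia.
  by rewrite opprK /form5 lieC.
by rewrite !move_out ?/matchings ?opprD //; lia.
Qed.

(** Exchange the last argument with another one three times, so that y is last
    again: the sign has changed, and the other arguments are only permuted. *)
Lemma matchings0 (a b c z y : tree 'I_n) :
  (leaves a + leaves b + leaves c + leaves z + leaves y = d)%N ->
  matchings a b c z y = 0.
Proof.
move=> E; apply: (@char0_double0 _ charK).
(* The sum is symmetric in its first four arguments: it ranges over the
   perfect matchings of these. *)
have rot : forall a b c z y : tree 'I_n, (leaves a + leaves b + leaves c + leaves z + leaves y = d)%N ->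
    matchings a b c z y = matchings z b c a y.
  move=> {E} {}a {}b {}c {}z {}y E; rewrite /matchings.
  have -> : form5 a b c z y = form5 c z a b y by apply: form5_flip.
  have -> : form5 c z a b y = form5 c z b a y by apply: form5_swap2; lia.
  have -> : form5 b c a z y = form5 b c z a y by apply: form5_swap2; lia.
  have -> : form5 c a b z y = form5 z b c a y.
    rewrite form5_flip; last by lia.
    by apply: form5_swap; lia.
  abel.
have E1 : matchings a b c z y = - matchings a b c y z by apply: matchings_anti.
have E2 : matchings a b c y z = matchings y b c a z by apply: rot; lia.
have E3 : matchings y b c a z = - matchings y b c z a by apply: matchings_anti; lia.
have E4 : matchings y b c z a = matchings z b c y a by apply: rot; lia.
have E5 : matchings z b c y a = - matchings z b c a y by apply: matchings_anti; lia.
have E6 : matchings z b c a y = matchings a b c z y by rewrite -rot.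
by rewrite {2}E1 E2 E3 E4 E5 E6 opprK subrr.
Qed.

(** The bracket in total degree d, the only degree in which the induction hypothesis
    makes it skew. *)
Definition graded_form (y w : tree 'I_n) : L :=
  if (leaves w + leaves y == d)%N then jtree w ** jtree y else 0.

Lemma graded_form_skew (w z y : tree 'I_n) : graded_form y (Node z w) = - graded_form (Node z y) w.
Proof.
rewrite /graded_form /= addnA -addnA [(leaves z + _)%N]addnC -!addnA.
rewrite [(leaves y + _)%N]addnC; case: eqP => E; last by rewrite oppr0.
by apply: jtree_skew; lia.
Qed.

Lemma graded_formC (w z y : tree 'I_n) : graded_form y (Node w z) = graded_form y (Node z w).
Proof.
rewrite /graded_form /= [(leaves w + leaves z)%N]addnC; case: eqP => // E.
by have := @jtreeC w z; rewrite /= => -> //; have := leaves_gt0 y; lia.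
Qed.

Lemma nil_ideal_form (p : free_magma_algebra K 'I_n) (y : tree 'I_n) :
  ideal_gen (@nil_relators K n) p -> fglift (graded_form y) p = 0.
Proof.
pose I := [set p : free_magma_algebra K 'I_n | forall y : tree 'I_n, fglift (graded_form y) p = 0].
have lin z := fglift_linear (graded_form z).
have teE z t : fglift (graded_form z) (tree_elt K t) = graded_form z t.
  by rewrite /tree_elt liftU scale1r.
move=> Ip; move: p Ip y; apply: (ideal_gen_min (I := I)).
  split; first split=> [z|k p q Ip Iq z]; first exact: linp0 (lin z).
    by rewrite lin Ip Iq scaler0 addr0.
  have leftE (z w : tree 'I_n) q : fglift (graded_form z) (tree_elt K w ** q) =
      - fglift (graded_form (Node w z)) q.
    apply: (freeg_linear_eq (f := fun q => fglift (graded_form z) (tree_elt K w ** q))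
      (h := fun q => - fglift (graded_form (Node w z)) q)) => [k u v|k u v|t].
    - by rewrite amul_linearr lin.
    - by rewrite lin opprD scalerN.
    by rewrite -/(tree_elt K t) tree_eltM !teE graded_form_skew.
  have rightE (z w : tree 'I_n) q : fglift (graded_form z) (q ** tree_elt K w) =
      fglift (graded_form z) (tree_elt K w ** q).
    suff H : (fun q => fglift (graded_form z) (q ** tree_elt K w)) =1
      (fun q => fglift (graded_form z) (tree_elt K w ** q)) by exact: (H q).
    apply: freeg_linear_eq => [k u v|k u v|t].
    - by rewrite amul_linearl lin.
    - by rewrite amul_linearr lin.
    by rewrite -/(tree_elt K t) !tree_eltM !teE graded_formC.
  move=> p q Iq; have lin0 : linear (fun _ : free_magma_algebra K 'I_n => 0 : L).
    by move=> k u v; rewrite scaler0 addr0.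
  split=> z.
    suff H : (fun p => fglift (graded_form z) (p ** q)) =1 (fun _ => 0) by exact: (H p).
    apply: freeg_linear_eq => // [k u v|t]; first by rewrite amul_linearl lin.
    by rewrite -/(tree_elt K t) leftE Iq oppr0.
  suff H : (fun p => fglift (graded_form z) (q ** p)) =1 (fun _ => 0) by exact: (H p).
  apply: freeg_linear_eq => // [k u v|t]; first by rewrite amul_linearr lin.
  by rewrite -/(tree_elt K t) rightE leftE Iq oppr0.
move=> p [u v|a b c z|a b c z] y.
- by rewrite (linpB (lin y)) !teE graded_formC subrr.
- rewrite !(linpD (lin y)) !teE /graded_form /=.
  have -> : (leaves b + leaves c + (leaves a + leaves z) + leaves y =
    leaves a + leaves b + (leaves c + leaves z) + leaves y)%N by lia.
  have -> : (leaves c + leaves a + (leaves b + leaves z) + leaves y =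
    leaves a + leaves b + (leaves c + leaves z) + leaves y)%N by lia.
  case: eqP => E; last by rewrite !addr0.
  by apply: (@matchings0 a b c z y); lia.
rewrite !(linpD (lin y)) !teE /graded_form /=.
have -> : (leaves a + (leaves b + leaves c + leaves z) + leaves y =
  leaves c + (leaves a + leaves b + leaves z) + leaves y)%N by lia.
have -> : (leaves b + (leaves c + leaves a + leaves z) + leaves y =
  leaves c + (leaves a + leaves b + leaves z) + leaves y)%N by lia.
case: eqP => E; last by rewrite !addr0.
have Ed : (leaves a + leaves b + leaves c + leaves z + leaves y = d)%N by lia.
by have := matchings_jordan Ed; rewrite (matchings0 Ed) /= => <-.
Qed.
End Degree.

Lemma jtree_abelian M :
  (forall t : tree 'I_n, (M <= leaves t)%N -> ideal_gen (@nil_relators K n) (tree_elt K t)) ->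
  (forall u v, (leaves u + leaves v <= 2 * M)%N -> jtree u ** jtree v = 0) ->
  forall u v, jtree u ** jtree v = 0.
Proof.
move=> HM base u v; have [d] := ubnP (leaves u + leaves v).
elim: d u v => // d IH u v uvd; have [|uv] := leqP (leaves u + leaves v) (2 * M).
  exact: base.
have low u' v' : (leaves u' + leaves v' < leaves u + leaves v)%N ->
    jtree u' ** jtree v' = 0 by move=> H; apply: IH; lia.
have formE (w y : tree 'I_n) : (leaves w + leaves y = leaves u + leaves v)%N -> (M <= leaves w)%N ->
    jtree w ** jtree y = 0.
  move=> wy Mw; have := nil_ideal_form low y (HM w Mw).
  by rewrite /tree_elt liftU scale1r /graded_form wy eqxx.
have [Mu|uM] := leqP M (leaves u); first exact: formE.
rewrite lieC formE ?oppr0 //; lia.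
Qed.
End Trees.
End Weight2.

(** * Coordinate Jordan algebras *)

Section SubJordan.
Context (K : fieldType) (V : lmodType K) (P : set V) (subP : is_subspace P)
  (m : V -> V -> V) (ml : forall y, linear (m^~ y)) (mr : forall x, linear (m x))
  (mP : forall x y, P x -> P y -> P (m x y)) (u : V) (Pu : P u)
  (m1 : forall x, P x -> m u x = x)
  (mC : forall x y, P x -> P y -> m x y = m y x)
  (mJ : forall x y, P x -> P y -> m (m x x) (m y x) = m (m (m x x) y) x).

Local Notation T := {x : V | `[< P x >]}.
Let mk x (Px : P x) : T := exist _ x (asboolT Px).
Let TP (a : T) : P (val a). Proof. exact/asboolP/(valP a). Qed.

Let P0 : P 0. Proof. by case: subP. Qed.
Let PZD k x y : P x -> P y -> P (k *: x + y). Proof. by case: subP => _; apply. Qed.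
Let PD x y : P x -> P y -> P (x + y).
Proof. by move=> Px Py; rewrite -[x]scale1r; apply: PZD. Qed.
Let PZ k x : P x -> P (k *: x).
Proof. by move=> Px; rewrite -[_ *: _]addr0; apply: PZD. Qed.
Let PN x : P x -> P (- x). Proof. by rewrite -scaleN1r; apply: PZ. Qed.

Lemma subalgebra_jordan : exists (J : unitalJordanType K) (i : J -> V),
  [/\ linear i, injective i, forall x, P x <-> exists a, i a = x,
      forall a b, i (a ** b) = m (i a) (i b) & i jone = u].
Proof.
pose add (a b : T) : T := mk (PD (TP a) (TP b)).
pose opp (a : T) : T := mk (PN (TP a)).
pose scale k (a : T) : T := mk (PZ k (TP a)).
have addA : associative add by move=> a b c; apply: val_inj; apply: addrA.
have addC : commutative add by move=> a b; apply: val_inj; apply: addrC.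
have add0 : left_id (mk P0) add by move=> a; apply: val_inj; apply: add0r.
have addN : left_inverse (mk P0) opp add by move=> a; apply: val_inj; apply: addNr.
pose Tz : zmodType := HB.pack T (GRing.isZmodule.Build T addA addC add0 addN).
have scA : forall a b (v : Tz), scale a (scale b v) = scale (a * b) v.
  by move=> a b v; apply: val_inj; apply: scalerA.
have sc1 : left_id 1 (scale : K -> Tz -> Tz).
  by move=> v; apply: val_inj; apply: scale1r.
have scDr : right_distributive (scale : K -> Tz -> Tz) +%R.
  by move=> k a b; apply: val_inj; apply: scalerDr.
have scDl : forall v : Tz, {morph (scale : K -> Tz -> Tz)^~ v : a b / a + b}.
  by move=> v a b; apply: val_inj; apply: scalerDl.
pose Tl : lmodType K := HB.pack Tz (GRing.Zmodule_isLmodule.Build K Tz scA sc1 scDr scDl).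
pose mul (a b : Tl) : Tl := mk (mP (TP a) (TP b)).
have mull y : linear (mul^~ y) by move=> k a b; apply: val_inj; apply: ml.
have mulr x : linear (mul x) by move=> k a b; apply: val_inj; apply: mr.
pose Ta : nonAssocAlgType K := HB.pack Tl (Lmodule_isNonAssoc.Build K Tl mull mulr).
have one_mul (a : Ta) : (mk Pu : Ta) ** a = a by apply: val_inj; apply: m1 (TP a).
have mulC (a b : Ta) : a ** b = b ** a by apply: val_inj; apply: mC (TP a) (TP b).
have mulJ (a b : Ta) : (a ** a) ** (b ** a) = ((a ** a) ** b) ** a.
  by apply: val_inj; apply: mJ (TP a) (TP b).
pose J : unitalJordanType K :=
  HB.pack Ta (NonAssoc_isUnitalJordan.Build K Ta one_mul mulC mulJ).
exists J, (fun a : J => val (a : T)); split=> //; first exact: val_inj.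
by move=> x; split=> [Px|[a <-]]; [exists (mk Px)|apply: TP].
Qed.
End SubJordan.

(** The homomorphism to the subalgebra P given by freeness, followed by the
    inclusion, is the identity by uniqueness. *)
Lemma free_jordan_generated (K : fieldType) n (F : unitalJordanType K) (g : 'I_n -> F)
    (P : set F) : free_unital_jordan g -> is_subspace P ->
  (forall x y, P x -> P y -> P (x ** y)) -> P jone -> (forall i, P (g i)) ->
  forall x, P x.
Proof.
move=> freeF subP PM P1 Pg.
have [|J [i [il ii iP iM i1]]] := subalgebra_jordan subP (@amul_linearl K F)
  (@amul_linearr K F) PM P1 (fun x _ => jmul1 x) (fun x y _ _ => jmulC x y) _.
  by move=> x y _ _; apply: jordan_id.
have /choice[l lE] j : exists a : J, i a = g j by apply/iP.
have [f [[[[fl fM] f1] fg] _]] := freeF J l.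
have [f0 [_ uniq]] := freeF F g.
have E : (fun x => i (f x)) = id.
  transitivity f0; last first.
    by apply: uniq; split=> //; split=> //; split.
  apply/esym/uniq; split; last by move=> j; rewrite fg lE.
  split; last by rewrite f1 i1.
  by split=> [k a b|a b]; rewrite ?fl ?il ?fM ?iM.
by move=> x; apply/iP; exists (f x); rewrite -[RHS](congr1 (@^~ x) E).
Qed.

Section Coordinates.
Context (K : fieldType) (charK : [pchar K] =i pred0) (L : lieAlgType K) (e f h : L).
Hypotheses (he : h ** e = 2 *: e) (hf : h ** f = - 2 *: f) (ef : e ** f = h).
Local Notation low0 := (low0 f).
Local Notation low2 := (low2 f).
Local Notation jprod := (jprod f).
Local Notation weight2 := (weight2 e f h).

(** The properties of the map which sends a to e(a) in the Lie algebra of J. *)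
Record coordinates (J : unitalJordanType K) (th : J -> L) : Prop := Coordinates {
  coord_linear : linear th;
  coord_mul : forall a b, th (a ** b) = jprod (th a) (th b);
  coord_one : th jone = e;
  coord_abelian : forall a b, th a ** th b = 0;
  coord_weight2 : forall a, weight2 (th a)
}.

Lemma coordinates_exist n (x : 'I_n -> L) (F : unitalJordanType K) (g : 'I_n -> F) :
  free_unital_jordan g -> (forall i, weight2 (x i)) ->
  (forall u v, jtree f x u ** jtree f x v = 0) ->
  exists2 th : F -> L, coordinates th & forall i, th (g i) = x i.
Proof.
move=> freeF wx ab0.
pose S : set L := [set y | y = e \/ exists t, y = jtree f x t].
pose P := Defs.span S.
have subP : is_subspace P by apply: span_subspace.
have span_min (U : set L) : is_subspace U -> S `<=` U -> P `<=` U.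
  by move=> sU SU y Py; apply: (Py U); split.
have SP : S `<=` P by move=> y Sy U [_ SU]; apply: SU.
have wt t : weight2 (jtree f x t).
  have low u v : (leaves u + leaves v < (leaves t).+1)%N ->
    jtree f x u ** jtree f x v = 0 by [].
  exact: (jtree_weight2 charK hf ef wx low (ltnSn _)).
have Pw : P `<=` weight2.
  apply: span_min; first exact: weight2_sub.
  by move=> y [->|[t ->]]; [apply: (weight2_e charK he hf ef)|apply: wt].
have Pab a b : P a -> P b -> a ** b = 0.
  have zr y : is_subspace [set a : L | a ** y = 0].
    split=> [|k u v /= uy vy]; first exact: amul0l.
    by rewrite amul_linearl uy vy scaler0 addr0.
  have zl y : is_subspace [set a : L | y ** a = 0].
    split=> [|k u v /= uy vy]; first exact: amul0r.
    by rewrite amul_linearr uy vy scaler0 addr0.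
  move=> Pa; apply: (span_min [set b | a ** b = 0] (zl a)) => y Sy /=.
  move: a Pa; apply: (span_min [set a | a ** y = 0] (zr y)) => z Sz /=.
  case: Sy Sz => [->|[u ->]] [->|[v ->]]; rewrite ?lie_alt ?ab0 //.
    by rewrite lieC; have [_ -> _] := wt v; rewrite oppr0.
  by have [_ -> _] := wt u.
have Pm a b : P a -> P b -> P (jprod a b).
  have pre (j : L -> L) : linear j -> is_subspace [set y | P (j y)].
    have [Q0 QD] := subP; move=> jl; split=> [|k u v /= ju jv]; first by rewrite /= (linp0 jl).
    by rewrite /= jl; apply: QD.
  move=> Pa; move: b; apply: (span_min [set b | P (jprod a b)]).
    exact: pre (jprod_linearr f a).
  move=> y Sy /=; have Py := SP y Sy; move: a Pa.
  apply: (span_min [set a | P (jprod a y)]); first exact: pre (jprod_linearl f y).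
  move=> z [->|[u ->]] /=; first by rewrite (jprod_e charK ef) //; apply: Pw.
  case: Sy => [->|[v ->]]; last by apply: SP; right; exists (Node u v).
  rewrite (jprodC f (a := jtree f x u)); last by have [_ E _] := wt u; rewrite lieC E oppr0.
  by rewrite (jprod_e charK ef) //; apply: SP; right; exists u.
have Pe : P e by apply: SP; left.
have [|||J [i [il ii iP iM i1]]] := subalgebra_jordan subP (jprod_linearl f)
    (jprod_linearr f) Pm Pe.
- by move=> y Py; apply: (jprod_e charK ef); apply: Pw.
- by move=> y z Py Pz; apply: jprodC; apply: Pab.
- move=> y z Py Pz; have wy := Pw y Py.
  have Pyy := Pm y y Py Py; have yy0 := Pab y y Py Py.
  have yyy := Pab _ _ Pyy Py.
  have := jordan_cyclic charK hf ef z wy wy wy yy0 yy0 yy0 yyy yyy yyy.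
  rewrite -[X in _ = X]/(_ + _ + _) => H.
  have {}H : 3%:R *: jprod (jprod y y) (jprod y z) = 3%:R *: jprod y (jprod (jprod y y) z).
    by rewrite !scaler_nat !mulrS !mulr0n !addr0 !addrA.
  rewrite (jprodC f (Pab z y Pz Py)) (natZ_inj charK H); apply: jprodC.
  by apply: (Pab y _ Py); apply: Pm.
have /choice[l lE] j : exists a : J, i a = x j.
  by apply/iP; apply: SP; right; exists (Leaf j).
have [th [[[[tl tM] t1] tg] _]] := freeF J l.
have iPa a : P (i a) by apply/iP; exists a.
exists (fun a => i (th a)); last by move=> j; rewrite tg lE.
split=> [k a b|a b||a b|a]; rewrite ?tl ?il ?tM ?iM ?t1 ?i1 //; first exact: Pab.
exact: Pw.
Qed.

Lemma coordinates_ext n (F : unitalJordanType K) (g : 'I_n -> F) (th th' : F -> L) :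
  free_unital_jordan g -> coordinates th -> coordinates th' ->
  (forall i, th (g i) = th' (g i)) -> th =1 th'.
Proof.
move=> freeF [tl tM t1 _ _] [tl' tM' t1' _ _] tg.
apply: (free_jordan_generated (P := [set a | th a = th' a]) freeF).
- split=> [|k a b /= Ea Eb]; first by rewrite /= (linp0 tl) (linp0 tl').
  by rewrite tl tl' Ea Eb.
- by move=> a b /= Ea Eb; rewrite tM tM' Ea Eb.
- by rewrite /= t1 t1'.
exact: tg.
Qed.

(** * Coordinates and homomorphisms from the Lie algebra of J *)
Section Hat.
Context (J : unitalJordanType K) (th : J -> L) (coord : coordinates th).
Let tl := coord_linear coord.
Let tM := coord_mul coord.
Let wt := coord_weight2 coord.
Let ab0 := coord_abelian coord.
Local Notation hat := (sl2_hat charK J).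
Local Notation basis := (sl2_basis K).

(** The image of the pair of a and b; kappa takes the value 4 on h and h. *)
Definition der_elt a b : L := 4^-1 *: (low0 (th a) ** low0 (th b)).

Lemma quarter (w : L) : 4 *: (4^-1 *: w) = w.
Proof. by rewrite scalerA divff ?scale1r // ((pcharf0P K).1 charK). Qed.

Lemma der_eltE a b : low0 (th a) ** low0 (th b) = 4 *: der_elt a b.
Proof. by rewrite quarter. Qed.

Lemma der_elt_l b : linear (der_elt^~ b).
Proof.
move=> k a a'; rewrite /der_elt tl low0_linear amul_linearl scalerDr !scalerA.
by rewrite [4^-1 * k]mulrC.
Qed.
Lemma der_elt_r a : linear (der_elt a).
Proof.
move=> k b b'; rewrite /der_elt tl low0_linear amul_linearr scalerDr !scalerA.
by rewrite [4^-1 * k]mulrC.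
Qed.
Lemma der_eltxx a : der_elt a a = 0.
Proof. by rewrite /der_elt lie_alt scaler0. Qed.
Lemma der_eltC a b : der_elt a b = - der_elt b a.
Proof. by rewrite /der_elt lieC scalerN. Qed.
Lemma der_elt_sq a : der_elt a (a ** a) = 0.
Proof.
have H := low0_low0_jprod charK hf ef (wt a) (wt a) (wt a) (ab0 a a) (ab0 a a) (ab0 a a).
rewrite -!tM !ab0 in H; have {}H := H erefl erefl.
rewrite (lieC (low0 (th (a ** a)))) in H.
suff E : low0 (th a) ** low0 (th (a ** a)) = 0 by rewrite /der_elt E scaler0.
apply: (natZ_inj charK (k := 2)); rewrite scaler0 scaler_nat !mulrS mulr0n addr0.
by rewrite {1}H; abel.
Qed.

Lemma der_elt_e a b c : der_elt a b ** th c = th (jder a b c).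
Proof.
have tB := linpB tl.
rewrite /der_elt amulZl (_ : _ ** th c = low0 (th a) ** (low0 (th b) ** th c)
  - low0 (th b) ** (low0 (th a) ** th c)); last by rewrite (lie_derl (low0 (th a))); abel.
rewrite !(low0_mul charK) !(linpZ (jprod_linearr f _)) -!tM !scalerA -natrM -scalerBr.
rewrite scalerA mulVf ?scale1r ?((pcharf0P K).1 charK) // -tB /jder.
by rewrite (jmulC (a ** c)).
Qed.

Lemma low0_der_elt a b : low0 (der_elt a b) = 0.
Proof.
rewrite /der_elt low0Z low0M !(low0_low0E charK) amulNl amulNr amulZl amulZr.
rewrite (low0_low2_swap charK (wt a) (wt b) (ab0 a b)) (lieC (low0 (th b))).
by rewrite scalerN opprK addNr scaler0.
Qed.

Lemma der_elt_h a b c : der_elt a b ** low0 (th c) = low0 (th (jder a b c)).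
Proof. by rewrite -der_elt_e low0M low0_der_elt amul0l add0r. Qed.

Lemma der_elt_f a b c : der_elt a b ** low2 (th c) = low2 (th (jder a b c)).
Proof.
rewrite !low2E -!der_elt_h amulNr amulZr low0M low0_der_elt amul0l.
by rewrite add0r.
Qed.

Lemma der_elt_der a b c d : der_elt a b ** der_elt c d =
  der_elt (jder a b c) d + der_elt c (jder a b d).
Proof.
by rewrite {2 3 4}/der_elt amulZr lie_derl !der_elt_h scalerDr.
Qed.

Definition hat_map (X : hat) : L :=
  low0 (th (X.1 idx_h)) + th (X.1 idx_e) + low2 (th (X.1 idx_f)) + jj_lift der_elt X.2.

Let jl := jj_lift_linear der_elt_l der_elt_r der_eltxx der_elt_sq.
Let jlE := jj_liftE der_elt_l der_elt_r der_eltxx der_elt_sq.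

Lemma hat_map_linear : linear hat_map.
Proof.
move=> k X Y; rewrite /hat_map /= !ffunE !tl low0_linear low2_linear jl !scalerDr.
abel.
Qed.

Definition hat_coord (i : 'I_3) (a : J) : L :=
  if i == idx_h then low0 (th a) else if i == idx_e then th a else low2 (th a).

Lemma hat_map_tensor i a : hat_map (hat_tensor charK (basis i) a) = hat_coord i a.
Proof.
rewrite /hat_map /= !ffunE !mxE (linp0 jl) addr0.
move: i; apply: ord3P; rewrite /hat_coord /= ?scale1r ?scale0r !(linp0 tl);
  rewrite ?low00 ?(linp0 (low2_linear f)) ?addr0 ?add0r //.
Qed.

Lemma hat_map_pair a b : hat_map (hat_pair charK a b) = der_elt a b.
Proof.
by rewrite /hat_map /= !ffunE !(linp0 tl) low00 (linp0 (low2_linear f)) jlE !addr0 add0r.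
Qed.

Lemma hat_basis_ind (Q : hat -> Prop) : Q 0 -> (forall X Y, Q X -> Q Y -> Q (X + Y)) ->
  (forall i a, Q (hat_tensor charK (basis i) a)) ->
  (forall a b, Q (hat_pair charK a b)) -> forall X, Q X.
Proof.
move=> Q0 QD Qt Qp; apply: hat_ind => // y a.
rewrite [y]sl2_sum_basis (linp_sum (hat_tensor_l charK a)).
elim/big_ind: _ => // i _; rewrite (linpZ (hat_tensor_l charK a)).
by rewrite -(linpZ (hat_tensor_r charK _)).
Qed.

Lemma hat_map_hom : alg_hom hat_map.
Proof.
have lin := hat_map_linear; split=> // X Y.
have D := linpD lin; have Z0 := linp0 lin; have N := linpN lin; have SZ := linpZ lin.
elim/hat_basis_ind: X => [|X X' IH IH'|i a|a b].
- by rewrite amul0l Z0 amul0l.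
- by rewrite amulDl !D IH IH' [RHS]amulDl.
- elim/hat_basis_ind: Y => [|Y Y' IH IH'|j b|b c].
  + by rewrite amul0r Z0 amul0r.
  + by rewrite amulDr !D IH IH' [RHS]amulDr.
  + have [r1 r2 r3] := sl2_relations K.
    rewrite hat_tensorE D SZ hat_map_pair !hat_map_tensor (kappaE charK) !mxE.
    have TZ k y c : hat_map (hat_tensor charK (k *: y) c) =
        k *: hat_map (hat_tensor charK y c).
      by rewrite (linpZ (hat_tensor_l charK c)) SZ.
    have TN y c : hat_map (hat_tensor charK (- y) c) = - hat_map (hat_tensor charK y c).
      by rewrite (linpN (hat_tensor_l charK c)) N.
    have T0 c : hat_map (hat_tensor charK 0 c) = 0.
      by rewrite (linp0 (hat_tensor_l charK c)) Z0.
    have coord2 c d : th c ** low2 (th d) = low0 (th (c ** d)) + 2 *: der_elt c d.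
      rewrite (mul_low2 charK f (ab0 c d)) -tM der_eltE scalerA.
      by rewrite (natrM _ 2 2) mulrA mulVf ?mul1r // ((pcharf0P K).1 charK).
    have eh : basis idx_e ** basis idx_h = - (2 *: basis idx_e) by rewrite lieC r1.
    have fh : basis idx_f ** basis idx_h = 2 *: basis idx_f.
      by rewrite lieC r2 scaleNr opprK.
    have fe : basis idx_f ** basis idx_e = - basis idx_h by rewrite lieC r3.
    have simp := (mulr0, mulr1, addr0, add0r, scale0r, T0, TZ, TN, hat_map_tensor).
    move: i j; apply: ord3P; apply: ord3P;
      rewrite /hat_coord /= ?lie_alt ?r1 ?r2 ?r3 ?eh ?fh ?fe !simp /hat_coord /=.
    * by rewrite der_eltE.
    * by rewrite (low0_mul charK) tM.
    * by rewrite (low2_jprod charK (wt a) (wt b) (ab0 a b)) -tM scaleNr.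
    * by rewrite lieC (low0_mul charK) -tM jmulC.
    * by rewrite ab0.
    * by rewrite coord2.
    * by rewrite lieC (low2_jprod charK (wt b) (wt a) (ab0 b a)) -tM jmulC opprK.
    * by rewrite lieC coord2 opprD jmulC der_eltC scalerN.
    by rewrite (low2_low2 charK (wt a) (wt b) (ab0 a b)).
  rewrite hat_anticomm N hat_pair_tensor !hat_map_tensor hat_map_pair [RHS]lieC.
  congr (- _); move: i; apply: ord3P; rewrite /hat_coord /=.
  + by rewrite der_elt_h.
  + by rewrite der_elt_e.
  by rewrite der_elt_f.
elim/hat_basis_ind: Y => [|Y Y' IH IH'|i c|c d].
- by rewrite amul0r Z0 amul0r.
- by rewrite amulDr !D IH IH' [RHS]amulDr.
- rewrite hat_pair_tensor !hat_map_tensor hat_map_pair.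
  move: i; apply: ord3P; rewrite /hat_coord /=.
  + by rewrite der_elt_h.
  + by rewrite der_elt_e.
  by rewrite der_elt_f.
by rewrite hat_pair_pair D !hat_map_pair der_elt_der.
Qed.
End Hat.
End Coordinates.

(** * Images of coordinates, and the coordinates of the Lie algebra of J *)

Section Transport.
Context (K : fieldType) (charK : [pchar K] =i pred0) (L L' : lieAlgType K)
  (phi : L -> L') (phih : alg_hom phi).
Let phil := proj1 phih.
Let phiM := proj2 phih.

Lemma low0_map f a : phi (low0 f a) = low0 (phi f) (phi a).
Proof. by rewrite !low0E phiM. Qed.
Lemma low2_map f a : phi (low2 f a) = low2 (phi f) (phi a).
Proof. by rewrite !low2E (linpN phil) (linpZ phil) !low0_map. Qed.
Lemma jprod_map f a b : phi (jprod f a b) = jprod (phi f) (phi a) (phi b).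
Proof. by rewrite !jprodE (linpZ phil) phiM low0_map. Qed.
Lemma jtree_map f n (x : 'I_n -> L) t :
  phi (jtree f x t) = jtree (phi f) (phi \o x) t.
Proof. by elim: t => //= u IHu v IHv; rewrite jprod_map IHu IHv. Qed.
Lemma weight2_map e f h a : weight2 e f h a ->
  weight2 (phi e) (phi f) (phi h) (phi a).
Proof.
case=> a1 a2 a3; split; rewrite -?low2_map -?low0_map -?phiM.
- by rewrite a1 (linpZ phil).
- by rewrite a2 (linp0 phil).
by rewrite a3 (linp0 phil).
Qed.
Lemma coordinates_map e f h (J : unitalJordanType K) (th : J -> L) :
  coordinates e f h th -> coordinates (phi e) (phi f) (phi h) (phi \o th).
Proof.
move=> [tl tM t1 tab tw]; split=> [k a b|a b||a b|a] /=.
- by rewrite tl phil.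
- by rewrite tM jprod_map.
- by rewrite t1.
- by rewrite -phiM tab (linp0 phil).
exact: weight2_map.
Qed.
End Transport.

Lemma coordinates_comp (K : fieldType) (L : lieAlgType K) (e f h : L)
    (J J' : unitalJordanType K) (th : J -> L) (psi : J' -> J) :
  unital_hom psi -> coordinates e f h th -> coordinates e f h (th \o psi).
Proof.
move=> [[pl pM] p1] [tl tM t1 tab tw].
by split=> [k a b|a b||a b|a] /=; rewrite ?pl ?tl ?pM ?tM ?p1.
Qed.

Section HatCoordinates.
Context (K : fieldType) (charK : [pchar K] =i pred0) (J : unitalJordanType K).
Local Notation hat := (sl2_hat charK J).
Definition hat_elt (i : 'I_3) (a : J) : hat := hat_tensor charK (sl2_basis K i) a.
Local Notation e := (hat_elt idx_e jone).
Local Notation f := (hat_elt idx_f jone).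
Local Notation h := (hat_elt idx_h jone).

Lemma hat_pair1 (a : J) : hat_pair charK a jone = 0.
Proof.
congr (_, _); have := jpair_cyc charK jone jone a.
by rewrite !jmul1 (jmulC a) jmul1 (jpairC jone) addNr add0r.
Qed.

Let simp := (mulr0, mul0r, mulr1, addr0, add0r, scale0r).

Lemma hat_elt_he a b : hat_elt idx_h a ** hat_elt idx_e b = 2 *: hat_elt idx_e (a ** b).
Proof.
have [r1 r2 r3] := sl2_relations K.
rewrite /hat_elt hat_tensorE (kappaE charK) !mxE /= r1 !simp.
by rewrite (linpZ (hat_tensor_l charK _)).
Qed.
Lemma hat_elt_hf a b : hat_elt idx_h a ** hat_elt idx_f b = - 2 *: hat_elt idx_f (a ** b).
Proof.
have [r1 r2 r3] := sl2_relations K.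
rewrite /hat_elt hat_tensorE (kappaE charK) !mxE /= r2 !simp.
by rewrite (linpZ (hat_tensor_l charK _)).
Qed.
Lemma hat_elt_ef a b : hat_elt idx_e a ** hat_elt idx_f b =
  hat_elt idx_h (a ** b) + 2 *: hat_pair charK a b.
Proof.
have [r1 r2 r3] := sl2_relations K.
by rewrite /hat_elt hat_tensorE (kappaE charK) !mxE /= r3 !simp.
Qed.
Lemma hat_elt_hh a b : hat_elt idx_h a ** hat_elt idx_h b = 4 *: hat_pair charK a b.
Proof.
rewrite /hat_elt hat_tensorE (kappaE charK) !mxE /= lie_alt !simp.
by rewrite (linp0 (hat_tensor_l charK _)) add0r.
Qed.
Lemma hat_elt_ee a b : hat_elt idx_e a ** hat_elt idx_e b = 0.
Proof.
rewrite /hat_elt hat_tensorE (kappaE charK) !mxE /= lie_alt !simp.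
exact: linp0 (hat_tensor_l charK _).
Qed.
Lemma hat_elt_ff a b : hat_elt idx_f a ** hat_elt idx_f b = 0.
Proof.
rewrite /hat_elt hat_tensorE (kappaE charK) !mxE /= lie_alt !simp.
exact: linp0 (hat_tensor_l charK _).
Qed.

Lemma hat_low0 a : low0 f (hat_elt idx_e a) = hat_elt idx_h a.
Proof. by rewrite low0E hat_elt_ef hat_pair1 scaler0 addr0 jmulC jmul1. Qed.
Lemma hat_low2 a : low2 f (hat_elt idx_e a) = hat_elt idx_f a.
Proof.
rewrite low2E hat_low0 low0E hat_elt_hf jmulC jmul1 scaleNr scalerN opprK scalerA.
by rewrite mulVf ?scale1r // ((pcharf0P K).1 charK).
Qed.

Lemma hat_coordinates : coordinates e f h (hat_elt idx_e).
Proof.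
split=> [|a b||a b|a]; first exact: hat_tensor_r.
- rewrite jprodE hat_low0 hat_elt_he scalerA.
  by rewrite mulVf ?scale1r // ((pcharf0P K).1 charK).
- by [].
- exact: hat_elt_ee.
split; first by rewrite hat_elt_he jmul1.
  exact: hat_elt_ee.
by rewrite hat_low2 low0E hat_elt_ff.
Qed.

Lemma hat_elt_generate (P : set hat) : is_subspace P -> (forall X Y, P X -> P Y -> P (X ** Y)) ->
  P f -> (forall a, P (hat_elt idx_e a)) -> forall X, P X.
Proof.
move=> [P0 PZ] PM Pf Pe.
have PD X Y : P X -> P Y -> P (X + Y).
  by move=> PX PY; rewrite -[X]scale1r; apply: PZ.
have PZs k X : P X -> P (k *: X).
  by move=> PX; rewrite -[_ *: _]addr0; apply: PZ.
have Ph a : P (hat_elt idx_h a) by rewrite -hat_low0 low0E; apply: PM.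
apply: (hat_basis_ind (charK := charK)) => // [i a|a b].
  have Pf' b : P (hat_elt idx_f b).
    rewrite -hat_low2 low2E hat_low0 low0E -scaleN1r.
    apply: (PZs (-1)); apply: (PZs 2^-1); exact: PM.
  by move: i; apply: ord3P; [exact: Ph|exact: Pe|exact: Pf'].
have <- : 4^-1 *: (hat_elt idx_h a ** hat_elt idx_h b) = hat_pair charK a b.
  by rewrite hat_elt_hh scalerA mulVf ?scale1r // ((pcharf0P K).1 charK).
by apply: PZs; apply: PM.
Qed.
End HatCoordinates.

Lemma quotient_lie_laws (K : fieldType) (L : lieAlgType K) (I : set L) (idI : is_ideal I) :
  lie_laws (quotient_algebra idI).
Proof.
have M := qpiM idI; split=> [p|p q r].
  by have [x <-] := qpi_surj p; rewrite -M lie_alt (linp0 (@qpi_linear _ _ _ _)).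
have [x <-] := qpi_surj p; have [y <-] := qpi_surj q; have [z <-] := qpi_surj r.
rewrite -(M y z) -(M z x) -(M x y) -3!M -!(linpD (@qpi_linear _ _ _ _)) lie_jacobi.
exact: linp0 (@qpi_linear _ _ _ _).
Qed.

Definition lie_quotient (K : fieldType) (L : lieAlgType K) (S : set L) : lieAlgType K :=
  lie_of (quotient_lie_laws (ideal_gen_ideal S)).

Section LieQuotient.
Context (K : fieldType) (L : lieAlgType K) (S : set L).
Definition lpi (x : L) : lie_quotient S := qpi (ideal_gen_ideal S) x.
Lemma lpi_hom : alg_hom lpi.
Proof. exact: qpi_hom. Qed.
Lemma lpi_surj q : exists x, lpi x = q.
Proof. exact: qpi_surj. Qed.
Lemma lpi_eq0 x : lpi x = 0 <-> ideal_gen S x.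
Proof. exact: (qpi_eq0 (ideal_gen_ideal S)). Qed.
Lemma lpi_gen x : S x -> lpi x = 0.
Proof. by move=> Sx; apply/lpi_eq0; apply: ideal_gen_sub. Qed.

Lemma lie_quotient_lift (L' : lieAlgType K) (f : L -> L') : alg_hom f ->
  (forall x, S x -> f x = 0) ->
  exists2 f' : lie_quotient S -> L', alg_hom f' & forall x, f' (lpi x) = f x.
Proof.
move=> fh fS.
have kill : ideal_gen S `<=` [set x | f x = 0].
  by apply: ideal_gen_min; first exact: kernel_ideal.
exists (qlift (idI := ideal_gen_ideal S) f : lie_quotient S -> L').
  exact: (qlift_hom (ideal_gen_ideal S) fh kill).
exact: (qlift_pi (ideal_gen_ideal S) fh kill).
Qed.
End LieQuotient.

(** * The finite presentation *)

Section Relations.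
Context (K : fieldType) (n N : nat) (L : lieAlgType K) (e f h : L) (x : 'I_n -> L).

Fixpoint jtree_values k : seq L :=
  if k is k'.+1 then
    [seq x i | i <- enum 'I_n] ++ [seq jprod f a b | a <- jtree_values k', b <- jtree_values k']
  else [::].

Lemma jtree_valuesP k t : (leaves t <= k)%N -> jtree f x t \in jtree_values k.
Proof.
elim: k t => [|k IH] t; first by rewrite leqNgt leaves_gt0.
case: t => [i|u v] /= uv; rewrite mem_cat; first by rewrite map_f ?mem_enum.
have u0 := leaves_gt0 u; have v0 := leaves_gt0 v.
by apply/orP; right; apply: allpairs_f; apply: IH; lia.
Qed.

Lemma jtree_values_tree k a : a \in jtree_values k -> exists t, a = jtree f x t.
Proof.
elim: k a => // k IH a /=; rewrite mem_cat => /orP[/mapP[i _ ->]|]; first by exists (Leaf i).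
by move=> /allpairsP[[b c] /= [/IH[u ->] /IH[v ->] ->]]; exists (Node u v).
Qed.

(** Relators are imposed for both monomials of degree at most N, which includes all
    pairs of total degree at most N. *)
Definition relators : seq L :=
  [:: h ** e - 2 *: e; h ** f + 2 *: f; e ** f - h]
  ++ [seq h ** x i - 2 *: x i | i <- enum 'I_n]
  ++ [seq e ** x i | i <- enum 'I_n]
  ++ [seq low0 f (low2 f (x i)) | i <- enum 'I_n]
  ++ [seq a ** b | a <- jtree_values N, b <- jtree_values N].

Lemma relators_hold (L' : lieAlgType K) (phi : L -> L') : alg_hom phi ->
  (forall r, r \in relators -> phi r = 0) <->
  [/\ phi h ** phi e = 2 *: phi e, phi h ** phi f = - 2 *: phi f, phi e ** phi f = phi h,
      forall i, weight2 (phi e) (phi f) (phi h) (phi (x i))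
    & forall a b, a \in jtree_values N -> b \in jtree_values N -> phi a ** phi b = 0].
Proof.
move=> phih; have [pl pM] := phih; split=> [R0|[he hf ef wx ab] r].
  split.
  - apply/eqP; rewrite -subr_eq0 -pM -(linpZ pl) -(linpB pl) R0 //.
    by rewrite mem_cat !inE eqxx.
  - apply/eqP; rewrite scaleNr -subr_eq0 opprK -pM -(linpZ pl) -(linpD pl) R0 //.
    by rewrite mem_cat !inE eqxx ?orbT.
  - apply/eqP; rewrite -subr_eq0 -pM -(linpB pl) R0 //.
    by rewrite mem_cat !inE eqxx ?orbT.
  - move=> i; split.
    + apply/eqP; rewrite -subr_eq0 -pM -(linpZ pl) -(linpB pl) R0 //.
      by rewrite !mem_cat (map_f (fun i => h ** x i - 2 *: x i)) ?mem_enum ?orbT.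
    + by rewrite -pM R0 // !mem_cat (map_f (fun i => e ** x i)) ?mem_enum ?orbT.
    rewrite -(low2_map phih) -(low0_map phih) R0 // !mem_cat.
    by rewrite (map_f (fun i => low0 f (low2 f (x i)))) ?mem_enum ?orbT.
  move=> a b Na Nb; rewrite -pM R0 // !mem_cat.
  by rewrite (allpairs_f (fun a b => a ** b)) ?orbT.
have w i : [/\ phi (h ** x i - 2 *: x i) = 0, phi (e ** x i) = 0
    & phi (low0 f (low2 f (x i))) = 0].
  have [w1 w2 w3] := wx i; split.
  - by rewrite (linpB pl) (linpZ pl) pM w1 subrr.
  - by rewrite pM w2.
  by rewrite (low0_map phih) (low2_map phih) w3.
rewrite !mem_cat !inE => /orP[/or3P[]/eqP->|].
- by rewrite (linpB pl) (linpZ pl) pM he subrr.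
- by rewrite (linpD pl) (linpZ pl) pM hf scaleNr addNr.
- by rewrite (linpB pl) pM ef subrr.
move=> /or4P[/mapP[i _ ->]|/mapP[i _ ->]|/mapP[i _ ->]|].
- by have [] := w i.
- by have [] := w i.
- by have [] := w i.
by move=> /allpairsP[[a b] /= [Na Nb ->]]; rewrite pM ab.
Qed.
End Relations.

Lemma coordinates_kernel (K : fieldType) (L : lieAlgType K) (e f h : L)
    (J : unitalJordanType K) (th : J -> L) :
  coordinates e f h th -> is_ideal [set a | th a = 0].
Proof.
move=> [tl tM _ _ _]; split; first split=> [|k a b /= Ea Eb]; first exact: linp0 tl.
  by rewrite tl Ea Eb scaler0 addr0.
move=> a b /= Eb; rewrite !tM Eb (linp0 (jprod_linearr _ _)); split=> //.
exact: linp0 (jprod_linearl _ _).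
Qed.

Lemma coordinates_descend (K : fieldType) (L : lieAlgType K) (e f h : L)
    (J' J : unitalJordanType K) (psi : J' -> J) (th : J' -> L) :
  unital_hom psi -> (forall b, exists a, psi a = b) ->
  (forall a, psi a = 0 -> th a = 0) -> coordinates e f h th ->
  exists2 th' : J -> L, coordinates e f h th' & forall a, th' (psi a) = th a.
Proof.
move=> [[pl pM] p1] psur ker [tl tM t1 tab tw].
have [s sE] := choice psur; pose th' b := th (s b).
have thE a : th' (psi a) = th a.
  apply/eqP; rewrite -subr_eq0 -(linpB tl); apply/eqP/ker.
  by rewrite (linpB pl) sE subrr.
exists th' => //; split=> [k b c|b c||b c|b].
- by rewrite -[b]sE -[c]sE -pl !thE tl.
- by rewrite -[b]sE -[c]sE -pM !thE tM.
- by rewrite -p1 thE t1.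
- exact: tab.
exact: tw.
Qed.

Lemma hat_map_generators (K : fieldType) (charK : [pchar K] =i pred0) (L : lieAlgType K)
    (e f h : L) (J : unitalJordanType K) (th : J -> L) :
  h ** f = - 2 *: f -> e ** f = h -> coordinates e f h th ->
  exists Psi : sl2_hat charK J -> L, [/\ alg_hom Psi,
    Psi (hat_elt charK idx_h jone) = h, Psi (hat_elt charK idx_f jone) = f
    & forall a, Psi (hat_elt charK idx_e a) = th a].
Proof.
move=> hf ef thc; exists (hat_map (charK := charK) f th).
split; first exact: (hat_map_hom charK hf ef thc).
- rewrite /hat_elt (hat_map_tensor charK hf ef thc) /hat_coord /= (coord_one thc).
  by rewrite low0E.
- rewrite /hat_elt (hat_map_tensor charK hf ef thc) /hat_coord /= (coord_one thc).
  by rewrite (low2_e charK hf ef).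
by move=> a; rewrite /hat_elt (hat_map_tensor charK hf ef thc) /hat_coord.
Qed.

Lemma alg_hom_comp (K : fieldType) (A B C : nonAssocAlgType K) (f : A -> B) (g : B -> C) :
  alg_hom f -> alg_hom g -> alg_hom (g \o f).
Proof. by move=> [fl fM] [gl gM]; split=> [k a b|a b] /=; rewrite ?fl ?gl ?fM ?gM. Qed.

Lemma free_lie_hom_eq (K : fieldType) n (F L : lieAlgType K) (g : 'I_n -> F) (f f' : F -> L) :
  free_lie g -> alg_hom f -> alg_hom f' -> (forall i, f (g i) = f' (g i)) -> f =1 f'.
Proof.
move=> freeF fh fh' ff'; have [phi [_ uniq]] := freeF L (f' \o g).
by move=> x; rewrite -(uniq f) // -(uniq f').
Qed.

Lemma sl2_map (K : fieldType) (L L' : lieAlgType K) (phi : L -> L') (e f h : L) :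
  alg_hom phi -> h ** f = - 2 *: f -> e ** f = h ->
  phi h ** phi f = - 2 *: phi f /\ phi e ** phi f = phi h.
Proof. by move=> [pl pM] hf ef; rewrite -!pM hf ef !(linpZ pl). Qed.

Theorem theorem4 (K : fieldType) (charK : [pchar K] =i pred0)
    (J : unitalJordanType K) :
  unital_jordan_finitely_presented J -> lie_finitely_presented (sl2_hat charK J).
Proof.
move=> [n [FJ [gJ [fJ [RJ [freeJ fJh fJs fJk]]]]]].
have [[fJl fJM] fJ1] := fJh.
have [M HM] := nil_ideal_trees charK n.
pose N := (2 * M)%N.
pose F := free_lie_algebra K (3 + n).
pose G : 'I_(3 + n) -> F := @free_lie_gen K (3 + n).
have freeF : free_lie G := @free_lieP K (3 + n).
pose eF := G (lshift n idx_e); pose fF := G (lshift n idx_f); pose hF := G (lshift n idx_h).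
pose xF i := G (rshift 3 i).
pose R1 := relators N eF fF hF xF.
pose hat := sl2_hat charK J.
pose ht := @hat_elt K charK J.
pose l (j : 'I_(3 + n)) : hat := match split j with
  | inl i => ht i jone | inr i => ht idx_e (fJ (gJ i)) end.
have [pi [[pih pig] _]] := freeF hat l.
have piE i : pi (G (lshift n i)) = ht i jone by rewrite pig /l (unsplitK (inl i)).
have pix i : pi (xF i) = ht idx_e (fJ (gJ i)) by rewrite pig /l (unsplitK (inr i)).
have hatc := hat_coordinates charK J.
have hat_abelian a b : hat_elt charK idx_e a ** hat_elt charK idx_e b = 0 :> hat.
  exact: hat_elt_ee.
have piR1 r : r \in R1 -> pi r = 0.
  move: r; apply/(relators_hold N eF fF hF xF pih); rewrite /eF /fF /hF !piE; split.
  - by rewrite hat_elt_he jmul1.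
  - by rewrite hat_elt_hf jmul1.
  - by rewrite hat_elt_ef hat_pair1 scaler0 addr0 jmul1.
  - by move=> i; rewrite pix; apply: (coord_weight2 hatc).
  have tree_hat t : exists a, pi (jtree fF xF t) = ht idx_e a.
    elim: t => [i|u [a Ea] v [b Eb]] /=; first by exists (fJ (gJ i)); rewrite pix.
    by exists (a ** b); rewrite (jprod_map pih) Ea Eb /fF piE; apply/esym/(coord_mul hatc).
  move=> a b /jtree_values_tree[u ->] /jtree_values_tree[v ->].
  by have [a' ->] := tree_hat u; have [b' ->] := tree_hat v; apply: hat_abelian.
(* The relators of J can only be lifted to the free Lie algebra once they have
   an image in a quotient with coordinates; L1 is this quotient. *)
pose L1 := lie_quotient [set` R1].
pose q1 : F -> L1 := lpi [set` R1].
have q1h : alg_hom q1 := lpi_hom [set` R1].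
have [he hf ef wx ab] : [/\ q1 hF ** q1 eF = 2 *: q1 eF, q1 hF ** q1 fF = - 2 *: q1 fF,
    q1 eF ** q1 fF = q1 hF, forall i, weight2 (q1 eF) (q1 fF) (q1 hF) (q1 (xF i))
    & forall a b, a \in jtree_values fF xF N -> b \in jtree_values fF xF N ->
        q1 a ** q1 b = 0].
  by apply/(relators_hold N eF fF hF xF q1h) => r Rr; apply: lpi_gen.
have jtree_q1 t : q1 (jtree fF xF t) = jtree (q1 fF) (q1 \o xF) t := jtree_map q1h _ _ t.
have abelian : forall u v, jtree (q1 fF) (q1 \o xF) u ** jtree (q1 fF) (q1 \o xF) v = 0.
  apply: (jtree_abelian charK hf ef wx HM) => u v uv.
  by rewrite -!jtree_q1 ab // jtree_valuesP //; lia.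
have [th1 th1c th1g] := coordinates_exist charK he hf ef freeJ wx abelian.
have /choice[rho rhoE] r : exists y, q1 y = th1 r := lpi_surj (th1 r).
pose R := R1 ++ [seq rho r | r <- RJ].
have [pi1 pi1h pi1E] : exists2 pi1 : L1 -> hat, alg_hom pi1 & forall x, pi1 (q1 x) = pi x.
  by apply: lie_quotient_lift => // r Rr; apply: piR1.
have pi1_th1 : pi1 \o th1 =1 ht idx_e \o fJ.
  have c1 := coordinates_map pi1h th1c.
  rewrite !pi1E /eF /fF /hF !piE in c1.
  apply: (coordinates_ext freeJ c1 (coordinates_comp fJh hatc)) => i /=.
  by rewrite th1g pi1E pix.
have piR r : r \in R -> pi r = 0.
  rewrite mem_cat => /orP[/piR1 //|/mapP[s Rs ->]].
  have fs : fJ s = 0 by apply/fJk; apply: ideal_gen_sub.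
  rewrite -pi1E rhoE; have := pi1_th1 s; rewrite /= fs => ->.
  exact: linp0 (coord_linear hatc).
exists (3 + n)%N, F, G, pi, R; split=> //.
- move=> X; move: X; apply: (hat_elt_generate (charK := charK) (P := [set X | exists y, pi y = X])).
  + split=> [|k X Y [x <-] [y <-]]; first by exists 0; rewrite (linp0 (proj1 pih)).
    by exists (k *: x + y); rewrite (proj1 pih).
  + by move=> X Y [x <-] [y <-]; exists (x ** y); rewrite (proj2 pih).
  + by exists fF; rewrite piE.
  move=> a; have [b <-] := fJs a.
  by exists (rho b); rewrite -pi1E rhoE; exact: pi1_th1.
pose L0 := lie_quotient [set` R].
pose q0 : F -> L0 := lpi [set` R].
have q0h : alg_hom q0 := lpi_hom [set` R].
have [qq qqh qqE] : exists2 qq : L1 -> L0, alg_hom qq & forall x, qq (q1 x) = q0 x.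
  apply: lie_quotient_lift => // r Rr; apply: lpi_gen => /=.
  by rewrite mem_cat; apply/orP; left.
have [th0 th0c th0E] : exists2 th0 : FJ -> L0,
    coordinates (q0 eF) (q0 fF) (q0 hF) th0 & forall a, th0 a = qq (th1 a).
  have := coordinates_map qqh th1c; rewrite !qqE => th0c.
  by exists (qq \o th1).
have th0_ker a : fJ a = 0 -> th0 a = 0.
  move=> /fJk; apply: (ideal_gen_min (coordinates_kernel th0c)) => r Rr.
  rewrite /= th0E -rhoE qqE; apply: lpi_gen => /=.
  by rewrite mem_cat map_f ?orbT.
have [th thc thE] := coordinates_descend fJh fJs th0_ker th0c.
have [hf0 ef0] : q0 hF ** q0 fF = - 2 *: q0 fF /\ q0 eF ** q0 fF = q0 hF.
  by have := sl2_map qqh hf ef; rewrite !qqE.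
have [Psi [Psih PsiH PsiF PsiE]] := hat_map_generators charK hf0 ef0 thc.
have PsiPi : Psi \o pi =1 q0.
  apply: (free_lie_hom_eq freeF (alg_hom_comp pih Psih) q0h) => j.
  rewrite -(splitK j); case: (split j) => i.
    transitivity (Psi (pi (G (lshift n i)))); first by [].
    rewrite piE; move: i; apply: ord3P; [exact: PsiH| |exact: PsiF].
    by rewrite PsiE (coord_one thc).
  transitivity (Psi (pi (xF i))); first by [].
  by rewrite pix PsiE thE th0E th1g; apply: qqE.
move=> y; split=> [py0|]; last first.
  by apply: (ideal_gen_min (kernel_ideal pih)) => r Rr; apply: piR.
apply/lpi_eq0; have := PsiPi y; rewrite /= py0 (linp0 (proj1 Psih)); exact: esym.
Qed.
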